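(* Let $(Y,D,L)$ be a generic polarized log Calabi--Yau surface, with associated Symington polytope $P$ obtained from the momentum polytope $\overline P$ of a good toric model $(\overline Y,\overline D)$ by cutting out the triangles $\Delta_{ij}$. Then there exists a good polyhedral decomposition $\overline{\mathcal{P}}$ on $\overline P$.
   Context: Over $\mathbb{C}$. A log Calabi--Yau surface is a log canonical pair $(Y,D)$ with $Y$ projective of dimension 2, $D$ a reduced effective divisor that is non-empty and singular, and $K_Y+D$ trivial; polarized means endowed with an ample line bundle $L$; generic means that the minimal resolution $(Y',D')$ ($D'$ the preimage of $D$) contains no smooth rational curve of self-intersection $-2$ disjoint from $D'$. A corner blow-up $(Y_1,D_1)\to(Y_2,D_2)$ is a birational morphism whose exceptional locus is a union of components of $D_1$ and with $D_1$ the preimage of $D_2$; an interior blow-up is the blow-up of a point in the smooth locus of $D_2$, with $D_1$ the strict transform of $D_2$. A good toric model of $(Y,D,L)$ is a diagram $(Y,D)\xleftarrow{g}(\widetilde Y,\widetilde D)\xrightarrow{h}(\overline Y,\overline D)$ of log Calabi--Yau surfaces with $g$ a corner blow-up, $h$ a composition of interior blow-ups at distinct points of $\overline D$, $(\overline Y,\overline D)$ a projective toric surface with its toric boundary, $\overline L=h_*g^*L$ ample, and a decomposition $g^*L=\sum_{i=1}^n c_ih^*\overline D_i-\sum_{i=1}^n\sum_{j=1}^{N_i}m_{ij}E_{ij}$ ($\overline D_i$ the components of $\overline D$, $E_{ij}$ the exceptional curves over $\overline D_i$) with $c_i\ge0$ and $0\le m_{ij}\le c_i$. Construction of $P$: let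 $\overline P$ be the momentum polytope of $\overline L$, with edges $\overline P_i$ corresponding to $\overline D_i$, and let $p\in\overline P$ be the integral point (corresponding to the divisor $\sum c_i\overline D_i$) at lattice distance $c_i$ from each $\overline P_i$. Since $\sum_jm_{ij}\le$ lattice length of $\overline P_i$, one can choose non-overlapping integral segments $\overline P_{ij}\subset\overline P_i$ of lattice length $m_{ij}$. Let $\overline T_{ij}$ be the triangle with base $\overline P_{ij}$ and third vertex $p$, choose an integral point $p_{ij}\in\overline T_{ij}$ at lattice distance $m_{ij}$ from $\overline P_i$ (one exists), and let $\Delta_{ij}$ be the triangle with base $\overline P_{ij}$ and third vertex $p_{ij}$. The edges of $\Delta_{ij}$ adjacent to $p_{ij}$ are its interior edges. The Symington polytope $P$ is the integral affine manifold with singularities obtained from $\overline P\setminus\bigcup_{ij}\mathrm{Int}(\Delta_{ij})$ by gluing the two interior edges of each $\Delta_{ij}$ using a matrix conjugate to $\begin{pmatrix}1&1\\0&1\end{pmatrix}$. The two interior edges of $\Delta_{ij}$ have the same lattice length $d$; with integral points $p_{ij}=a^0,a^1,\dots,a^d$ and $p_{ij}=b^0,b^1,\dots,b^d$ on them in order, the standard decomposition of $\Delta_{ij}$ is the polyhedral decomposition consisting of the triangle with vertices $p_{ij},a^1,b^1$ and the $d-1$ trapezoids with vertices $a^k,a^{k+1},b^k,b^{k+1}$, $1\le k\le d-1$. An integral polyhedral decomposition of $\overline P$ is a finite covering by strongly convex polyhedra with integral vertices, closed under taking faces, any two meeting in a common face. It is regular if there is a convex piecewise linear function $\varphi:\overline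 P\to\mathbb{R}$ such that the polyhedra of the decomposition correspond to the domains of linearity of $\varphi$. A good polyhedral decomposition of $\overline P$ is a regular integral polyhedral decomposition $\overline{\mathcal{P}}$ such that (i) each $\Delta_{ij}$ is a union of some polyhedra of $\overline{\mathcal{P}}$ which form the standard decomposition of $\Delta_{ij}$; (ii) each two-dimensional polyhedron of $\overline{\mathcal{P}}$ not contained in a triangle $\Delta_{ij}$ is a triangle of size $1$, that is, a triangle all of whose edges have integral length $1$. *)

(* Defs.v *)
From mathcomp Require Import all_boot all_order all_algebra.
From mathcomp Require Import boolp classical_sets functions cardinality reals.
From mathcomp Require Import complex.

Set Implicit Arguments.
Unset Strict Implicit.
Unset Printing Implicit Defensive.

Import Order.TTheory GRing.Theory Num.Theory.
Local Open Scope classical_set_scope.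
Local Open Scope ring_scope.

(* Lattice points are 'rV[int]_2 and points of the real plane are 'rV[R]_2.   *)

Definition dot (K : pzRingType) (u v : 'rV[K]_2) : K :=
  u 0 0 * v 0 0 + u 0 1 * v 0 1.

Definition cross (K : pzRingType) (u v : 'rV[K]_2) : K :=
  u 0 0 * v 0 1 - u 0 1 * v 0 0.

Definition llen (u : 'rV[int]_2) : nat := gcdn (absz (u 0 0)) (absz (u 0 1)).

Definition vec2 (a b : int) : 'rV[int]_2 :=
  \row_k (if k == 0 then a else b).

(* The minimum of s when s is not empty, and 0 otherwise. *)
Definition seq_min (s : seq int) : int := foldr Order.min (head 0 s) s.

(******************************************************************************)
(* Irreducible curves in the torus (C^* )^2.                                  *)
(*                                                                            *)
(* f : {poly {poly C}} is a polynomial in x (inner variable) and y (outer     *)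
(* variable); the coefficient of x^a y^b is f`_b`_a.                          *)
(******************************************************************************)
Section TorusCurves.
Variable C : fieldType.
Implicit Types (f : {poly {poly C}}) (e m : 'rV[int]_2) (z : 'rV[C]_2).

(* Up to units, the irreducible Laurent polynomials in x and y are the        *)
(* irreducible polynomials that are associated neither with x nor with y.     *)
Definition torus_irreducible f : Prop :=
  [/\ f != 0,
      f \isn't a GRing.unit,
      forall g h : {poly {poly C}}, f = g * h ->
        g \is a GRing.unit \/ h \is a GRing.unit,
      forall u : {poly {poly C}}, u \is a GRing.unit -> f <> u * ('X)%:P
    & forall u : {poly {poly C}}, u \is a GRing.unit -> f <> u * 'X].

Definition coef2 f m : C := f`_(absz (m 0 1))`_(absz (m 0 0)).

Definition supp f : seq 'rV[int]_2 :=
  [seq m <- [seq vec2 a%:Z b%:Z | b <- iota 0 (size f), a <- iota 0 (size f`_b)]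
      | coef2 f m != 0].

Definition monom z m : C := (z 0 0) ^ (m 0 0) * (z 0 1) ^ (m 0 1).

(* For e primitive, w := (- e_1, e_0) is primitive and cross e m = <w, m>.    *)
(* Hence cross e m is the order of the monomial z^m along the toric divisor   *)
(* D_w of the ray spanned by w, and ord_toric e f is the order of f along D_w.*)
Definition ord_toric e f : int := seq_min [seq cross e m | m <- supp f].

(* The torus point z determines the point lim_(s -> 0) (s^w . z) in the open  *)
(* orbit of D_w, on which the character e is a coordinate. The part of f of   *)
(* order k along D_w is f_k = z^m' g_k(z^e) for some m' and some Laurent      *)
(* polynomial g_k in one variable; jet e z f k r is the value at z of the     *)
(* r-th iterate on f_k of the derivation z^m |-> (e . m) z^m. So the least r  *)
(* such that jet e z f k r != 0 is the order of vanishing of g_k at z^e.      *)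
Definition jet e z f (k : int) (r : nat) : C :=
  \sum_(m <- supp f | cross e m == k)
     coef2 f m * ((dot e m)%:~R ^+ r * monom z m).

(* The order of f along the exceptional curve of the blow-up of the point of  *)
(* D_w determined by z: f = sum_k (local equation of D_w)^k * unit * g_k, and *)
(* this order is the minimum over k of k + ord_(z^e) g_k. When f_k != 0, the  *)
(* order of g_k is smaller than the number of monomials of f (Vandermonde).   *)
Definition ord_exc e z f : int :=
  seq_min [seq kr.1 + kr.2%:Z |
    kr <- [seq (k, r) | k <- [seq cross e m | m <- supp f],
                        r <- iota 0 (size (supp f))]
    & jet e z f kr.1 kr.2 != 0].

End TorusCurves.

(******************************************************************************)
(* A good toric model is a diagram                                            *)
(*                                                                            *)
(*               (Y, D) <-- g -- (Yt, Dt) -- h --> (Yb, Db).                  *)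
(*                                                                            *)
(* The projective toric surface Yb with its ample line bundle Lb is given by  *)
(* its momentum polygon, h by the blown-up points, and g by the components of *)
(* Dt that it contracts. As L is recovered from g^* L and Y from the curves   *)
(* contracted by g, these data determine (Y, D, L).                           *)
(******************************************************************************)
Record toric_model (R : realType) := ToricModel {
  nsides : nat;
  (* vertices of the momentum polygon, in counterclockwise order; the i-th    *)
  (* edge joins vert i to vert (ordS i) and corresponds to the component i    *)
  vert : 'I_nsides -> 'rV[int]_2;
  (* exc indexes the exceptional curves of h: an element x with side x = i    *)
  (* stands for a pair (i, j) with 1 <= j <= N_i                              *)
  exc : finType;
  side : exc -> 'I_nsides;
  (* a torus point that determines the blown-up point, as in ord_exc          *)
  bpt : exc -> 'rV[complex R]_2;
  (* the components of Dt that are contracted by g                            *)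
  contracted : {set 'I_nsides};
  (* g^* L = sum_i cc i h^* Db_i - sum_x mm x E_x                             *)
  cc : 'I_nsides -> nat;
  mm : exc -> nat;
  (* the point of the momentum polygon that corresponds to sum_i cc i Db_i    *)
  base_pt : 'rV[int]_2
}.

Section ToricModel.
Variables (R : realType) (X : toric_model R).
Implicit Types (i k : 'I_(nsides X)) (x y : exc X).

Definition edge i : 'rV[int]_2 := vert (ordS i) - vert i.

Definition edge_dir i : 'rV[int]_2 :=
  map_mx (fun t : int => (t %/ (llen (edge i))%:Z)%Z) (edge i).

(* The affine function that vanishes on the i-th edge, is positive inside the *)
(* polygon, and is primitive.                                                 *)
Definition lattice_dist i (q : 'rV[int]_2) : int :=
  cross (edge_dir i) (q - vert i).

Definition good_toric_model : Prop :=
  [/\ (2 < nsides X)%N,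
      (forall i k, k != i -> k != ordS i -> 0 < cross (edge i) (vert k - vert i)),
      (forall x, (bpt x 0 0 != 0) && (bpt x 0 1 != 0)) /\
      (forall x y, x != y -> side x = side y ->
         monom (bpt x) (edge_dir (side x)) != monom (bpt y) (edge_dir (side y))),
      (forall i, lattice_dist i (base_pt X) = (cc i)%:Z)
    & (forall x, (mm x <= cc (side x))%N)].

(* Intersection theory on Yt. The divisors Dt_i (strict transforms of the     *)
(* Db_i) and E_x generate the rational class group; a pair (d, t) stands for  *)
(* sum_i d_i Dt_i + sum_x t_x E_x.                                            *)
Definition bdiv : Type := (('I_(nsides X) -> int) * (exc X -> int))%type.

(* The index of the cone spanned by the inner normals of edges i and i + 1.   *)
Definition cone_index i : rat := (cross (edge_dir i) (edge_dir (ordS i)))%:~R.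

(* The intersection number Db_i . Db_k. *)
Definition toric_int i k : rat :=
  if k == i then
    - (cross (edge_dir (ord_pred i)) (edge_dir (ordS i)))%:~R
      / (cone_index (ord_pred i) * cone_index i)
  else if k == ordS i then (cone_index i)^-1
  else if i == ordS k then (cone_index k)^-1
  else 0.

Definition D_D i k : rat :=
  toric_int i k - (if k == i then #|[pred x | side x == i]|%:R else 0).

Definition D_E i x : rat := (side x == i)%:R.

Definition E_E x y : rat := - (x == y)%:R.

Definition inter (A B : bdiv) : rat :=
    \sum_i \sum_k (A.1 i)%:~R * (B.1 k)%:~R * D_D i k
  + \sum_i \sum_x ((A.1 i)%:~R * (B.2 x)%:~R + (A.2 x)%:~R * (B.1 i)%:~R) * D_E i x
  + \sum_x \sum_y (A.2 x)%:~R * (B.2 y)%:~R * E_E x y.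

Definition cls_D i : bdiv := (fun k => (k == i)%:R, fun=> 0).

Definition cls_E x : bdiv := (fun=> 0, fun y => (y == x)%:R).

(* The closure in Yt of the torus curve f = 0: as a rational function on Yt,  *)
(* f has divisor curve(f) + sum_i ord_(Dt_i) f Dt_i + sum_x ord_(E_x) f E_x.  *)
Definition cls_curve (f : {poly {poly (complex R)}}) : bdiv :=
  (fun i => - ord_toric (edge_dir i) f,
   fun x => - ord_exc (edge_dir (side x)) (bpt x) f).

(* The class of g^* L, as h^* Db_i = Dt_i + sum_(x | side x = i) E_x. *)
Definition cls_L : bdiv :=
  (fun i => (cc i)%:Z, fun x => (cc (side x))%:Z - (mm x)%:Z).

(* L is ample on Y (Nakai-Moishezon): the irreducible curves of Yt are the    *)
(* Dt_i, the E_x and the closures of the irreducible torus curves, and those  *)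
(* of Y are the images of those that g does not contract. Since D is a        *)
(* nonempty divisor, g does not contract all of Dt.                           *)
Definition polarized : Prop :=
  [/\ contracted X != [set: 'I_(nsides X)]%SET,
      0 < inter cls_L cls_L,
      (forall i, if i \in contracted X then inter cls_L (cls_D i) = 0
                 else 0 < inter cls_L (cls_D i)),
      (forall x, 0 < inter cls_L (cls_E x))
    & (forall f, torus_irreducible f -> 0 < inter cls_L (cls_curve f))].

(* Over the complement of the boundary, the minimal resolution of Y and g are *)
(* isomorphisms, so that a (-2)-curve disjoint from D' is a curve of Yt       *)
(* disjoint from Dt. It is the closure of a torus curve, as the E_x meet Dt.  *)
(* As K_Yt + Dt is trivial, an irreducible curve disjoint from Dt and of      *)
(* self-intersection -2 has arithmetic genus 0 by adjunction: it is smooth    *)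
(* and rational.                                                              *)
Definition generic : Prop :=
  ~ exists f : {poly {poly (complex R)}},
      [/\ torus_irreducible f,
          forall i, inter (cls_curve f) (cls_D i) = 0
        & inter (cls_curve f) (cls_curve f) = - 2].

End ToricModel.

Section Plane.
Variable R : realType.
Implicit Types (S F P : set 'rV[R]_2) (Pc : set (set 'rV[R]_2)).

Definition emb (q : 'rV[int]_2) : 'rV[R]_2 := map_mx (fun t : int => t%:~R) q.

Definition hull (s : seq 'rV[R]_2) : set 'rV[R]_2 :=
  [set a | exists l : 'I_(size s) -> R,
     [/\ forall k, 0 <= l k, \sum_k l k = 1 & a = \sum_k l k *: s`_k]].

(* Inside a bounded polygon, the strongly convex polyhedra with integral      *)
(* vertices are the convex hulls of nonempty finite sets of lattice points.   *)
Definition lattice_polytope S : Prop :=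
  exists2 s : seq 'rV[int]_2, s != [::] & S = hull (map emb s).

(* Nonempty faces, S included (take u = 0 and b = 0). *)
Definition face F S : Prop :=
  F !=set0 /\
  exists (u : 'rV[R]_2) (b : R),
    (forall a, S a -> b <= dot u a) /\ F = [set a | S a /\ dot u a = b].

Definition two_dim S : Prop :=
  exists a b c : 'rV[R]_2,
    cross (b - a) (c - a) != 0 /\ hull [:: a; b; c] `<=` S.

Definition integral_decomposition P Pc : Prop :=
  [/\ finite_set Pc /\ \bigcup_(S in Pc) S = P,
      forall S, Pc S -> lattice_polytope S,
      forall S F, Pc S -> face F S -> Pc F
    & forall S S', Pc S -> Pc S' -> S `&` S' !=set0 ->
        face (S `&` S') S /\ face (S `&` S') S'].

Definition convex_on P (phi : 'rV[R]_2 -> R) : Prop :=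
  forall (a b : 'rV[R]_2) (t : R), P a -> P b -> 0 <= t -> t <= 1 ->
    phi (t *: a + (1 - t) *: b) <= t * phi a + (1 - t) * phi b.

Definition piecewise_linear_on P (phi : 'rV[R]_2 -> R) : Prop :=
  exists ss : seq (seq 'rV[R]_2),
    P = \bigcup_(S in [set hull s | s in [set` ss]]) S /\
    forall s, s \in ss -> exists (u : 'rV[R]_2) (b : R),
      forall a, hull s a -> phi a = dot u a + b.

(* S is the region where phi coincides with a given affine function, this     *)
(* region being two-dimensional.                                              *)
Definition linearity_domain P (phi : 'rV[R]_2 -> R) S : Prop :=
  two_dim S /\
  exists (u : 'rV[R]_2) (b : R), S = [set a | P a /\ phi a = dot u a + b].

Definition regular_decomposition P Pc : Prop :=
  exists phi : 'rV[R]_2 -> R,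
    [/\ convex_on P phi,
        piecewise_linear_on P phi
      & forall S, (Pc S /\ two_dim S) <-> linearity_domain P phi S].

Definition size1_triangle S : Prop :=
  exists a b c : 'rV[int]_2,
    [/\ cross (b - a) (c - a) != 0,
        [/\ llen (b - a) = 1%N, llen (c - b) = 1%N & llen (a - c) = 1%N]
      & S = hull (map emb [:: a; b; c])].

End Plane.


(* The choices in the construction of the Symington polytope: the base of the *)
(* triangle Delta_x starts at lattice distance cut_off x from the first       *)
(* vertex of the edge, and its third vertex is cut_apex x.                    *)
Record cut_data (R : realType) (X : toric_model R) := CutData {
  cut_off : exc X -> nat;
  cut_apex : exc X -> 'rV[int]_2
}.

Section Cut.
Variables (R : realType) (X : toric_model R) (K : cut_data X).
Implicit Types (x y : exc X).

Definition momentum_polygon : set 'rV[R]_2 :=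
  hull [seq emb R (vert i) | i <- enum 'I_(nsides X)].

Definition base_start x : 'rV[int]_2 :=
  vert (side x) + edge_dir (side x) *+ cut_off K x.

Definition base_end x : 'rV[int]_2 :=
  vert (side x) + edge_dir (side x) *+ (cut_off K x + mm x).

Definition big_triangle x : set 'rV[R]_2 :=
  hull (map (emb R) [:: base_start x; base_end x; base_pt X]).

Definition cut_triangle x : set 'rV[R]_2 :=
  hull (map (emb R) [:: base_start x; base_end x; cut_apex K x]).

Definition symington_cut : Prop :=
  [/\ forall x, (cut_off K x + mm x <= llen (edge (side x)))%N,
      forall x y, x != y -> side x = side y ->
        (cut_off K x + mm x <= cut_off K y)%N \/
        (cut_off K y + mm y <= cut_off K x)%N
    & forall x, lattice_dist (side x) (cut_apex K x) = (mm x)%:Z /\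
                big_triangle x (emb R (cut_apex K x))].

(* The common lattice length of the two interior edges. *)
Definition int_edge_len x : nat := llen (base_start x - cut_apex K x).

(* The k-th integral point, from the apex, of the interior edge ending at q.  *)
Definition int_edge_pt x (q : 'rV[int]_2) (k : nat) : 'rV[R]_2 :=
  emb R (cut_apex K x)
  + (k%:R / (int_edge_len x)%:R) *: (emb R q - emb R (cut_apex K x)).

(* For k = 0 this is the triangle at the apex, as a^0 = b^0; otherwise it is  *)
(* the k-th trapezoid.                                                        *)
Definition standard_cell x (k : nat) : set 'rV[R]_2 :=
  hull [:: int_edge_pt x (base_start x) k; int_edge_pt x (base_start x) k.+1;
           int_edge_pt x (base_end x) k; int_edge_pt x (base_end x) k.+1].

Definition standard_cells x : set (set 'rV[R]_2) :=
  [set standard_cell x k | k in [set k : nat | (k < int_edge_len x)%N]].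

Definition good_decomposition (Pc : set (set 'rV[R]_2)) : Prop :=
  [/\ integral_decomposition momentum_polygon Pc,
      regular_decomposition momentum_polygon Pc,
      forall x, standard_cells x `<=` Pc /\
                cut_triangle x = \bigcup_(S in standard_cells x) S
    & forall S, Pc S -> two_dim S ->
        (forall x, ~ (S `<=` cut_triangle x)) -> size1_triangle S].

End Cut.

(* Main.v *)
(* The decomposition is the regular subdivision obtained by prescribing heights on a
   finite set V of lattice points: the lattice points of the interior edges of the
   triangles Delta_x and the point p (the core), and the lattice points of the
   polygon outside all the Delta_x. The heights are combinations, with rapidly
   decreasing weights, of several functions, so that all comparisons are
   lexicographic.
   - On the core, the leading function is linear on each triangle T_x with vertices p
     and the endpoints q of the base of Delta_x, and equal to |q - p| at q: it is
     strictly convex across the rays from p. Let lev be the affine function on T_x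
     equal to 0 at p and 1 on the base. To subdivide Delta_x into its strips one adds
     the convex function lev^2 - lev of this level, with a weight indexed by an
     integer E_x. When T_x and T_y share a ray, E_x - E_y is prescribed by that ray;
     such E exist because ampleness leaves a unit segment of the boundary outside the
     bases, which breaks the cyclic order of the triangles. The remaining functions
     separate the rays and the levels: if four core points are coplanar in the lower
     hull, then the segment between two of them meets a lattice point, or the interior
     or base of some Delta_x.
   - Lattice points outside the core get a strictly convex function, and independent
     perturbations: then every point of V is a vertex of the subdivision, and four
     coplanar points of the lower hull are core points.
   A two-dimensional cell that meets Delta_x outside its interior edges is a strip of
   Delta_x. In any other two-dimensional cell, the segment between two vertices has no
   further lattice point, so that there are three vertices and the edges have length
   1. *)

Require Import Defs.
From mathcomp Require Import all_boot all_order all_algebra.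
From mathcomp Require Import boolp classical_sets functions cardinality reals.
From mathcomp Require Import complex lra ring zify.

Set Implicit Arguments.
Unset Strict Implicit.
Unset Printing Implicit Defensive.

Import Order.TTheory GRing.Theory Num.Theory.
Local Open Scope classical_set_scope.
Local Open Scope ring_scope.

(** * Farkas' lemma and convex hulls *)

(** The parabolas cannot be weighted triangle by triangle. On a ray shared by T_x and T_y the two
    levels agree, and a core point of T_y on the ray must lie above the planes of the strips of
    Delta_x. If only T_y has core points strictly between [p] and the base on this ray, the parabola
    of T_x is made to dominate: [E x = E y + 1]. If both have such points, they share some, which
    must carry one height: [E x = E y]. As lev^2 - lev vanishes at levels 0 and 1, nothing is
    required at [p] and on the bases. The prescribed differences need not add up to zero around [p],
    which is why the cyclic order has to be broken. The strips being cells by construction, any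
    other two-dimensional cell misses the interiors of the Delta_x; two of its vertices whose
    segment enters such an interior, or contains a further lattice point, are therefore a
    contradiction. A fourth vertex always produces such a pair. *)

Lemma row2P (K : Type) (u v : 'rV[K]_2) :
  u 0 0 = v 0 0 -> u 0 1 = v 0 1 -> u = v.
Proof.
move=> e0 e1; apply/rowP => k; case: k => [[|[|//]] hk].
- by rewrite (_ : Ordinal hk = 0) //; apply/val_inj.
- by rewrite (_ : Ordinal hk = 1) //; apply/val_inj.
Qed.

Section Cones.
Variable R : realType.

Local Notation dual := ('rV[R]_2 * R^o * R^o)%type.
Implicit Types (y b g : dual) (s : seq dual).

(** A triple holds a vector, a homogenizing coordinate and a height: the same cones serve plane
    convex hulls, with all heights 0, and hulls of lifted points. *)
Definition pairing y b : R := dot y.1.1 b.1.1 + y.1.2 * b.1.2 + y.2 * b.2.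

Lemma pairingDr y b g : pairing y (b + g) = pairing y b + pairing y g.
Proof. rewrite /pairing /dot /= !mxE; ring. Qed.

Lemma pairingZr y t b : pairing y (t *: b) = t * pairing y b.
Proof. rewrite /pairing /dot /= !mxE /GRing.scale /=; ring. Qed.

Lemma pairingC y b : pairing y b = pairing b y.
Proof. rewrite /pairing /dot /=; ring. Qed.

Lemma pairingDl y b g : pairing (y + b) g = pairing y g + pairing b g.
Proof. by rewrite pairingC pairingDr !(pairingC g). Qed.

Lemma pairingZl y t b : pairing (t *: y) b = t * pairing y b.
Proof. by rewrite pairingC pairingZr pairingC. Qed.

Lemma pairing_gt0 b : b != 0 -> 0 < pairing b b.
Proof.
move=> b0; have e : pairing b b =
  b.1.1 0 0 ^+ 2 + b.1.1 0 1 ^+ 2 + b.1.2 ^+ 2 + b.2 ^+ 2.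
  by rewrite /pairing /dot; ring.
rewrite lt_def e !addr_ge0 ?sqr_ge0 // andbT; apply: contra b0.
rewrite !paddr_eq0 ?addr_ge0 ?sqr_ge0 // !sqrf_eq0.
case: b {e} => [[u p] q] /= /andP[/andP[/andP[/eqP u0 /eqP u1] /eqP->] /eqP->].
by apply/eqP; congr (_, _, _); apply: row2P; rewrite mxE.
Qed.

(** Removing one generator at a time suits the induction in [farkas]; [coneP] recovers explicit
    coefficients. *)
Fixpoint cone s b : Prop :=
  if s is g :: s' then exists2 t : R, 0 <= t & cone s' (b - t *: g) else b = 0.

Lemma cone_scale s k b : 0 <= k -> cone s b -> cone s (k *: b).
Proof.
move=> k0; elim: s b => [b ->|g s ih b [t t0 /ih c]]; first by rewrite /= scaler0.
by exists (k * t); [rewrite mulr_ge0 | move: c; rewrite scalerBr scalerA].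
Qed.

(** A sum of nonnegative terms vanishes only term by term, so generators with positive pairing have
    coefficient 0. [hull_face] and its consequences come from this. *)
Lemma cone_face s y b : (forall g, g \in s -> 0 <= pairing y g) -> cone s b ->
  0 <= pairing y b /\ (pairing y b = 0 -> cone [seq g <- s | pairing y g == 0] b).
Proof.
elim: s b => [b _ ->|g s ih b ys [t t0 c]] /=.
  by rewrite -(scale0r (0 : dual)) pairingZr mul0r scale0r.
have yg : 0 <= pairing y g by rewrite ys ?mem_head.
have [p0 pf] := ih _ (fun h hs => ys h (mem_behead (s := g :: s) hs)) c.
have e : pairing y b = pairing y (b - t *: g) + t * pairing y g.
  by rewrite -pairingZr -pairingDr subrK.
split; first by rewrite e addr_ge0 // mulr_ge0.
rewrite e => /eqP; rewrite paddr_eq0 ?mulr_ge0 // mulf_eq0.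
case/andP => /eqP/pf cf; case: ifP => yg0 /=; first by exists t.
by rewrite orbF => /eqP t00; move: cf; rewrite t00 scale0r subr0.
Qed.

(* Farkas, by induction on the generators: when the functional given by the
   induction hypothesis is negative on the new generator, everything is
   projected along that generator onto the kernel of the functional. *)
Lemma farkas s b : cone s b \/
  exists2 y, (forall g, g \in s -> 0 <= pairing y g) & pairing y b < 0.
Proof.
move: {2}(size s) (leqnn (size s)) => n; elim: n s b => [|n ih] [|g s] b //= hs.
- have [->|b0] := eqVneq b 0; first by left.
  right; exists (- 1 *: b) => //; rewrite pairingZl mulN1r oppr_lt0.
  exact: pairing_gt0.
- have [->|b0] := eqVneq b 0; first by left.
  right; exists (- 1 *: b) => //; rewrite pairingZl mulN1r oppr_lt0.
  exact: pairing_gt0.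
have [c|[y ys yb]] := ih s b hs; first by left; exists 0 => //; rewrite scale0r subr0.
have [yg|yg] := leP 0 (pairing y g).
  by right; exists y => // h; rewrite inE => /orP[/eqP->|/ys].
pose pr h := h - (pairing y h / pairing y g) *: g.
have pr_ge h : h \in s -> 0 <= - (pairing y h / pairing y g).
  by move=> /ys ?; rewrite -mulrN -invrN divr_ge0 // oppr_ge0 ltW.
have hs' : (size (map pr s) <= n)%N by rewrite size_map.
have [c|[z zs zb]] := ih (map pr s) (pr b) hs'.
  left.
  suff [t t0 ct] : exists2 t, 0 <= t & cone s (pr b - t *: g).
    exists (pairing y b / pairing y g + t).
      by rewrite addr_ge0 // ltW // -mulrNN -invrN divr_gt0 // oppr_gt0.
    by rewrite scalerDl opprD addrA.
  elim: s {hs ih ys hs'} pr_ge (pr b) c => [|h s ihs] prs d /=.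
    by move=> ->; exists 0; rewrite // scale0r subr0.
  move=> [t t0 /ihs[|t' t'0 c]].
    by move=> k ks; apply: prs; rewrite inE ks orbT.
  exists (t' + t * - (pairing y h / pairing y g)) => /=.
    by rewrite addr_ge0 // mulr_ge0 // prs // mem_head.
  exists t => //; move: c; congr cone.
  rewrite /pr scalerBr scalerDl mulrN scaleNr scalerA.
  by rewrite !opprB !addrA [LHS]addrAC.
(* On [h] the corrected functional takes the value of [z] at [pr h], and it vanishes on [g]. *)
right. exists (z + - (pairing z g / pairing y g) *: y); last first.
  move: zb; rewrite /pr -scaleNr pairingDr pairingZr pairingDl pairingZl.
  by congr (_ < _); field; rewrite lt_eqF.
move=> h; rewrite inE pairingDl pairingZl => /orP[/eqP->|hin].
  by rewrite mulNr divfK ?subrr // lt_eqF.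
have := zs (pr h) (map_f _ hin); rewrite /pr -scaleNr pairingDr pairingZr.
by congr (_ <= _); field; rewrite lt_eqF.
Qed.

End Cones.

Section AffineFunctions.
Variable R : realType.
Local Notation affine := ('rV[R]_2 * R^o)%type.
Implicit Types (l y : affine) (a b c : 'rV[R]_2) (s : seq 'rV[R]_2).

(* Sealed, as unfolding it makes conversion tests diverge. *)
Lemma af_sig : {f : affine -> 'rV[R]_2 -> R | forall l a, f l a = dot l.1 a + l.2}.
Proof. by eexists. Qed.
Definition af : affine -> 'rV[R]_2 -> R := sval af_sig.
Lemma afE l a : af l a = dot l.1 a + l.2.
Proof. exact: (svalP af_sig). Qed.

Lemma afD l y a : af (l + y) a = af l a + af y a.
Proof. rewrite !afE /dot /= !mxE; ring. Qed.

Lemma afZ k l a : af (k *: l) a = k * af l a.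
Proof. rewrite !afE /dot /= !mxE /GRing.scale /=; ring. Qed.

Lemma afN l a : af (- l) a = - af l a.
Proof. rewrite !afE /dot /= !mxE; ring. Qed.

Lemma afB l y a : af (l - y) a = af l a - af y a.
Proof. by rewrite afD afN. Qed.

Lemma af0 a : af 0 a = 0.
Proof. by rewrite !afE /dot /= !mxE !mul0r !addr0. Qed.

Definition afc (k : R) : affine := (0, k).

Lemma af_c k a : af (afc k) a = k.
Proof. rewrite !afE /dot /= !mxE; ring. Qed.

Lemma af_conv l t a b :
  af l (t *: a + (1 - t) *: b) = t * af l a + (1 - t) * af l b.
Proof. rewrite !afE /dot !mxE; ring. Qed.

Lemma af_ext l y : af l =1 af y -> l = y.
Proof.
case: l y => [u p] [v q] e.
have e0 := e 0; have e1 := e (\row_k (k == 0)%:R); have e2 := e (\row_k (k == 1)%:R).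
move: e0 e1 e2; rewrite !afE /dot /= !mxE /= => e0 e1 e2.
by congr (_, _); last lra; apply: row2P; lra.
Qed.

Lemma af_indep l a b c : cross (b - a) (c - a) != 0 ->
  af l a = 0 -> af l b = 0 -> af l c = 0 -> l = 0.
Proof.
move=> d la lb lc; apply: af_ext => z; rewrite af0.
move: d la lb lc; rewrite !afE /dot /cross !mxE.
case: l => u p /=; move: (u 0 0) (u 0 1) => u0 u1.
move: (a 0 0) (a 0 1) (b 0 0) (b 0 1) (c 0 0) (c 0 1) => a0 a1 b0 b1 c0 c1 d la lb lc.
have {lb}lb : u0 * (b0 - a0) + u1 * (b1 - a1) = 0 by lra.
have {lc}lc : u0 * (c0 - a0) + u1 * (c1 - a1) = 0 by lra.
have h0 : u0 * ((b0 - a0) * (c1 - a1) - (b1 - a1) * (c0 - a0)) = 0.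
  have -> : u0 * ((b0 - a0) * (c1 - a1) - (b1 - a1) * (c0 - a0)) =
    (u0 * (b0 - a0) + u1 * (b1 - a1)) * (c1 - a1)
    - (u0 * (c0 - a0) + u1 * (c1 - a1)) * (b1 - a1) by ring.
  by rewrite lb lc !mul0r subr0.
have h1 : u1 * ((b0 - a0) * (c1 - a1) - (b1 - a1) * (c0 - a0)) = 0.
  have -> : u1 * ((b0 - a0) * (c1 - a1) - (b1 - a1) * (c0 - a0)) =
    (u0 * (c0 - a0) + u1 * (c1 - a1)) * (b0 - a0)
    - (u0 * (b0 - a0) + u1 * (b1 - a1)) * (c0 - a0) by ring.
  by rewrite lb lc !mul0r subr0.
move/eqP: h0; rewrite mulf_eq0 (negbTE d) orbF => /eqP u00.
move/eqP: h1; rewrite mulf_eq0 (negbTE d) orbF => /eqP u10.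
by move: la; rewrite u00 u10 !mul0r !add0r.
Qed.

(** The middle coordinate 1 turns the condition that the weights add up to 1 into a linear
    equation. *)
Definition lifted (t : R) a : 'rV[R]_2 * R^o * R^o := (a, 1, t).

Lemma coneP (s : seq ('rV[R]_2 * R^o * R^o)) (b : 'rV[R]_2 * R^o * R^o) :
  cone s b <->
  exists w : 'I_(size s) -> R, (forall k, 0 <= w k) /\ b = \sum_k w k *: s`_k.
Proof.
split.
  elim: s b => [b ->|g s ih b [t t0 /ih[w [w0 e]]]].
    by exists (fun=> 0); split=> //; rewrite big_ord0.
  exists (fun k => oapp w t (unlift ord0 k)); split.
    by move=> k; case: unliftP => [j|] _ /=.
  rewrite big_ord_recl unlift_none /=; under eq_bigr do rewrite liftK /=.
  by rewrite -e addrC subrK.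
elim: s b => [b [w [_ ->]]|g s ih b [w [w0 e]]]; first by rewrite /= big_ord0.
exists (w ord0) => //; apply: ih; exists (fun k => w (lift ord0 k)).
by split=> // ; rewrite e big_ord_recl /= addrC addKr.
Qed.

Lemma sum_lifted n (w t : 'I_n -> R) (p : 'I_n -> 'rV[R]_2) :
  \sum_k w k *: lifted (t k) (p k) =
  (\sum_k w k *: p k, \sum_k w k, \sum_k w k * t k).
Proof.
elim: n w t p => [|n ih] w t p; first by rewrite !big_ord0.
rewrite !big_ord_recl ih; congr (_, _, _).
by rewrite /= /GRing.scale /= mulr1.
Qed.

Lemma hullP s a : hull s a <-> cone [seq lifted 0 v | v <- s] (lifted 0 a).
Proof.
have nthE (w : 'I_(size s) -> R) :
    \sum_k w k *: lifted 0 s`_k = (\sum_k w k *: s`_k, \sum_k w k, 0).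
  by rewrite sum_lifted; congr (_, _, _); rewrite big1 // => k; rewrite mulr0.
have castE (w : 'I_(size (map (lifted 0) s)) -> R) :
    \sum_k w k *: [seq lifted 0 v | v <- s]`_k =
    \sum_k w (cast_ord (esym (size_map _ _)) k) *: lifted 0 s`_k.
  rewrite (reindex (cast_ord (esym (size_map (lifted 0) s)))) /=.
    by apply: eq_bigr => k _; rewrite (nth_map 0).
  by exists (cast_ord (size_map _ _)) => k _; apply: val_inj.
split=> [[w [w0 w1 e]]|/coneP[w [w0]]].
  apply/coneP; exists (fun k => w (cast_ord (size_map _ _) k)); split=> //.
  rewrite castE (_ : \sum_k _ = \sum_k w k *: lifted 0 s`_k).
    by rewrite nthE -e w1.
  by apply: eq_bigr => k _; congr (w _ *: _); apply: val_inj.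
rewrite castE nthE => -[ea e1]; eexists; split; last exact: ea; last exact: esym.
by move=> k; apply: w0.
Qed.

Definition ext l : 'rV[R]_2 * R^o * R^o := (l.1, l.2, 0).

Lemma pairing_ext l t a : pairing (ext l) (lifted t a) = af l a.
Proof. by rewrite /pairing !afE /= mulr1 mul0r addr0. Qed.

Lemma hull_face s l a : hull s a -> (forall v, v \in s -> 0 <= af l v) ->
  0 <= af l a /\ (af l a = 0 -> hull [seq v <- s | af l v == 0] a).
Proof.
move=> /hullP c ls; have := cone_face (y := ext l) _ c.
case=> [g /mapP[v vs ->]|]; first by rewrite pairing_ext ls.
rewrite pairing_ext => p0 pf; split=> // /pf {}c; apply/hullP; move: c.
by rewrite filter_map; congr cone; congr map; apply: eq_filter => v /=; rewrite pairing_ext.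
Qed.

Lemma hull_separation s a : ~ hull s a ->
  exists2 l, (forall v, v \in s -> 0 <= af l v) & af l a < 0.
Proof.
move=> na; have [/hullP //|[y ys ya]] :=
  farkas [seq lifted 0 v | v <- s] (lifted 0 a).
have e v : af y.1 v = pairing y (lifted 0 v).
  by rewrite !afE /pairing /= mulr1 mulr0 addr0.
by exists y.1 => [v vs|]; rewrite e //; apply/ys/map_f.
Qed.

Lemma hull_mem s a : a \in s -> hull s a.
Proof.
move=> sa; apply/asboolP; apply/negPn/negP => /asboolPn/hull_separation[l ls].
by rewrite ltNge ls.
Qed.

Lemma hull_hull s s' a : (forall v, v \in s -> hull s' v) -> hull s a -> hull s' a.
Proof.
move=> ss sa; apply/asboolP; apply/negPn/negP => /asboolPn/hull_separation[l ls'].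
apply/negP; rewrite -leNgt; have [|//] := hull_face (l := l) sa.
by move=> v /ss h; have [] := hull_face (l := l) h.
Qed.

Lemma hull_sub s s' : {subset s <= s'} -> hull s `<=` hull s'.
Proof. by move=> ss a; apply: hull_hull => v /ss; apply: hull_mem. Qed.

Lemma hull_eq s s' : s =i s' -> hull s = hull s'.
Proof.
by move=> e; apply/seteqP; split; apply: hull_sub => a; rewrite ?e // -e.
Qed.

Lemma hull_conv s a b t : 0 <= t -> t <= 1 -> hull s a -> hull s b ->
  hull s (t *: a + (1 - t) *: b).
Proof.
move=> t0 t1 sa sb; apply/asboolP; apply/negPn/negP.
move=> /asboolPn/hull_separation[l ls]; apply/negP; rewrite -leNgt af_conv.
have [la _] := hull_face sa ls; have [lb _] := hull_face sb ls.
by rewrite addr_ge0 // mulr_ge0 // subr_ge0.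
Qed.

Lemma hull_nil a : ~ hull [::] a.
Proof. by move=> [w [_ /esym/eqP]]; rewrite big_ord0 oner_eq0. Qed.

Lemma hull1 a b : hull [:: a] b -> b = a.
Proof. by case=> w []; rewrite !big_ord1 /= => _ -> ->; rewrite scale1r. Qed.

End AffineFunctions.

(** * Regular subdivisions *)

Lemma exists_eps (R : realType) (T : eqType) (s : seq T) (f g : T -> R) :
  exists2 e : R, 0 < e & forall e', 0 < e' -> e' <= e ->
    forall v, v \in s -> 0 < f v -> 0 < f v - e' * g v.
Proof.
elim: s => [|v s [e e0 he]]; first by exists 1.
have [fv|fv] := ltP 0 (f v); last first.
  exists e => // e' e'0 e'e u; rewrite inE => /orP[/eqP->|us]; last exact: he.
  by rewrite ltNge fv.
have g0 : 0 < 1 + `|g v| by rewrite ltr_pwDl.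
exists (Order.min e (f v / (1 + `|g v|))); first by rewrite lt_min e0 divr_gt0.
move=> e' e'0; rewrite le_min => /andP[e'e]; rewrite ler_pdivlMr // => hv u.
rewrite inE => /orP[/eqP-> _|us]; last exact: he.
rewrite subr_gt0; apply: lt_le_trans hv.
by rewrite mulrDr mulr1 ltr_pwDl // ler_pM2l // ler_norm.
Qed.

Lemma tripleB (R : realType) (a b : 'rV[R]_2) (p q u v : R^o) (t : R) :
  (a, p, u) - t *: (b, q, v) = (a - t *: b, p - t * q, u - t * v).
Proof. by []. Qed.

Section Subdivision.
Variables (R : realType) (V : seq 'rV[int]_2) (h : 'rV[int]_2 -> R).
Local Notation affine := ('rV[R]_2 * R^o)%type.
Local Notation emb := (emb R).
Implicit Types (l y : affine) (v : 'rV[int]_2) (a : 'rV[R]_2).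

(** The cells are the projections of the faces of the lower hull of the lifted points [(v, h v)],
    each face being given by an affine function whose graph supports it. *)
Definition minorant l : Prop := forall v, v \in V -> af l (emb v) <= h v.
Definition contact l : seq 'rV[int]_2 := [seq v <- V | af l (emb v) == h v].
Definition cell l : set 'rV[R]_2 := hull (map emb (contact l)).

Lemma contactP l v : reflect (v \in V /\ af l (emb v) = h v) (v \in contact l).
Proof.
rewrite mem_filter; apply: (iffP andP) => [[/eqP? ?]|[? /eqP?]] //.
Qed.

(** The difference [l - l'] is nonnegative at the contact points of [l], hence on their hull, and
    [hull_face] describes its zeros. *)
Lemma cell_le l l' a : minorant l' -> cell l a -> af l' a <= af l a /\
  (af l' a = af l a ->
   hull (map emb [seq v <- contact l | af l' (emb v) == af l (emb v)]) a).
Proof.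
move=> sl' la; have [|p0 p1] := hull_face (l := l - l') la.
  by move=> _ /mapP[v /contactP[vV e] ->]; rewrite afB e subr_ge0 sl'.
move: p0; rewrite afB subr_ge0 => p0; split=> // e; move: p1.
rewrite afB e subrr => /(_ erefl); rewrite filter_map; congr hull; congr map.
by apply: eq_filter => v /=; rewrite afB subr_eq0 eq_sym.
Qed.

Lemma cell_val l l' a : minorant l -> minorant l' -> cell l a -> cell l' a ->
  af l a = af l' a.
Proof.
move=> sl sl' la la'; apply/le_anti.
by rewrite (cell_le sl la').1 (cell_le sl' la).1.
Qed.

Lemma cell_of_val l l' a : minorant l' -> cell l a -> af l' a = af l a -> cell l' a.
Proof.
move=> sl' la e; have [_ /(_ e)] := cell_le sl' la.
apply: hull_sub => _ /mapP[v + ->]; rewrite mem_filter => /andP[/eqP ev].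
by case/contactP => vV hv; apply/map_f/contactP; split=> //; rewrite ev.
Qed.

(** Points outside the contact set have positive slack, which absorbs a small multiple of [y]. This
    lets a minorant rotate about a face of its cell. *)
Lemma tilt l y : minorant l -> (forall v, v \in contact l -> 0 <= af y (emb v)) ->
  exists2 e, 0 < e & minorant (l - e *: y) /\
    contact (l - e *: y) = [seq v <- contact l | af y (emb v) == 0].
Proof.
move=> sl ly.
have [e e0 /(_ e e0 (lexx e)) he] :=
  exists_eps V (fun v => h v - af l (emb v)) (fun v => - af y (emb v)).
have key v : v \in V -> 0 <= h v - af (l - e *: y) (emb v) /\
    (h v - af (l - e *: y) (emb v) = 0 <->
     af l (emb v) = h v /\ af y (emb v) = 0).
  move=> vV; rewrite afB afZ.
  have -> : h v - (af l (emb v) - e * af y (emb v)) =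
    h v - af l (emb v) - e * - af y (emb v) by ring.
  have [d|] := ltP 0 (h v - af l (emb v)).
    have := he _ vV d => p; split; first exact: ltW.
    by split=> [q|[q _]]; [move: p; rewrite q ltxx | move: d; rewrite q subrr ltxx].
  rewrite subr_le0 => q; have e' : af l (emb v) = h v by apply/le_anti; rewrite sl.
  have yv : 0 <= af y (emb v) by apply/ly/contactP.
  rewrite e' subrr sub0r mulrN opprK mulr_ge0 ?(ltW e0) //; split=> //; split.
    by move/eqP; rewrite mulf_eq0 gt_eqF //= => /eqP.
  by case=> _ ->; rewrite mulr0.
exists e => //; split.
  by move=> v vV; rewrite -subr_ge0; case: (key v vV).
rewrite /contact -filter_predI; apply: eq_in_filter => v vV /=.
rewrite -subr_eq0 -oppr_eq0 opprB; apply/eqP/andP.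
  by move/(key v vV).2 => [-> ->]; rewrite !eqxx.
by case=> /eqP y0 /eqP l0; apply/(key v vV).2.
Qed.

Let gens := [seq lifted (h v) (emb v) | v <- V].

(** The heights over [a] of the hull of the lifted points; their infimum is the lower hull. *)
Let vals a : set R := [set t | cone gens (lifted t a)].

Lemma vals_lb l a t : minorant l -> vals a t -> af l a <= t.
Proof.
move=> sl /(cone_face (y := (- l.1, - l.2, 1))).
have e b r : pairing (- l.1, - l.2, 1) (lifted r b) = r - af l b.
  by rewrite /pairing !afE /dot /= !mxE; ring.
case=> [g /mapP[v vV ->]|]; first by rewrite e subr_ge0 sl.
by rewrite e subr_ge0.
Qed.

Lemma vals_nonempty a : hull (map emb V) a -> vals a !=set0.
Proof.
move=> /hullP; rewrite -map_comp => c.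
suff /(_ 1 a c) : forall (p : R^o) b,
  cone [seq lifted 0 (emb v) | v <- V] (b, p, 0) ->
  exists t : R^o, cone gens (b, p, t) by [].
move=> p b {c}; rewrite /gens; elim: V p b => [|v s ih] p b /=.
  by move=> [-> ->]; exists 0.
move=> [t t0 c]; have [|u cu] := ih (p - t) (b - t *: emb v).
  by move: c; rewrite /lifted tripleB mulr1 mulr0 subr0.
exists (u + t * h v) => /=; exists t => //; move: cu.
by rewrite /lifted tripleB mulr1 addrK.
Qed.

(* Linear programming duality: otherwise Farkas' certificate is a point of
   [vals a] below its infimum. *)
Lemma dual_bound a t : (forall u, vals a u -> t <= u) ->
  exists2 l, minorant l & t <= af l a.
Proof.
move=> tlb.
(* In the first case [r] is the coefficient of [(- a, - 1, - t)], and division by it gives an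
   element of [vals a] below [t]. In the second case the target forces [y.2 > 0], and [- y.1 / y.2]
   is the required minorant. *)
have [|[y ys yb]] := farkas ((0, 0, 1) :: (- a, - 1, - t) :: gens) (0, 0, -1).
  move=> /= [s s0 [r r0 c]]; exfalso.
  have {}c : cone gens (r *: a, r, - 1 - s + r * t).
    move: c; rewrite (tripleB 0 0 0 0 _ 1) tripleB !scaler0 !mulr0 !mulr1 !subr0 !sub0r.
    by rewrite !mulrN mulr1 scalerN !opprK.
  (* For [r = 0] every lifted generator has coefficient 0, its middle coordinate being 1, which
     leaves [- 1 - s = 0]. *)
  move: r0; rewrite le_eqVlt => /orP[/eqP r0|r0].
    have [g /mapP[v _ ->]|_ +] := cone_face (y := (0, 1, 0)) _ c.
    - by rewrite /pairing /dot /= !mxE; lra.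
    rewrite -r0 {1}/pairing /dot /= !mxE mulr0 !mul0r !addr0 => /(_ erefl).
    rewrite (eq_in_filter (a2 := pred0)) ?filter_pred0.
      case=> _ e; move: (e : - 1 - s = 0 :> R); lra.
    by move=> g /mapP[v _ ->]; rewrite /pairing /dot /= !mxE; apply/eqP; lra.
  have ri : 0 <= r^-1 by rewrite invr_ge0 ltW.
  have /tlb : vals a (t - (1 + s) / r).
    have := cone_scale ri c; rewrite /vals /lifted /=.
    have -> : r^-1 *: ((r *: a, r, - 1 - s + r * t) : 'rV[R]_2 * R^o * R^o) =
      (r^-1 *: (r *: a), r^-1 * r, r^-1 * (- 1 - s + r * t)) by [].
    rewrite scalerA mulVf ?gt_eqF // scale1r; congr cone; congr (_, _).
    by field; rewrite gt_eqF.
  have : 0 < (1 + s) / r by rewrite divr_gt0 // ltr_pwDl.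
  lra.
have ys0 : 0 < y.2.
  by move: yb; rewrite /pairing /dot /= !mxE; lra.
have yv v : v \in V -> 0 <= af y.1 (emb v) + y.2 * h v.
  move=> vV; have := ys (lifted (h v) (emb v)).
  rewrite /pairing !afE /= mulr1; apply.
  by rewrite !inE (map_f (fun v => lifted (h v) (emb v))) ?orbT.
have ya : 0 <= - af y.1 a - y.2 * t.
  have := ys (- a, - 1, - t); rewrite !inE eqxx orbT => /(_ erefl).
  rewrite /pairing !afE /dot /= !mxE; lra.
exists (- y.2^-1 *: y.1) => [v vV|]; rewrite afZ mulNr -mulrN.
  by rewrite -(ler_pM2l ys0) mulVKf ?gt_eqF //; have := yv v vV; lra.
by rewrite -(ler_pM2l ys0) mulVKf ?gt_eqF //; lra.
Qed.

(** A minorant attaining the infimum of [vals a] works: were [a] outside its cell, tilting along a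
    separating function would give a minorant with a larger value at [a]. *)
Lemma support_exists a : hull (map emb V) a -> exists2 l, minorant l & cell l a.
Proof.
move=> Va; have [l0 sl0] : exists l0, minorant l0.
  pose m := \big[Order.min/0]_(v <- V) h v; exists (afc m) => v vV.
  by rewrite af_c; apply: ge_bigmin_seq.
have hinf : has_inf (vals a).
  split; first exact: vals_nonempty.
  by exists (af l0 a) => t; apply: vals_lb.
have [l sl la] : exists2 l, minorant l & inf (vals a) <= af l a.
  by apply: dual_bound => u ua; apply: ge_inf => //; case: hinf.
exists l => //; apply/asboolP/negPn/negP => /asboolPn/hull_separation[y ly ya].
have [v vl|e e0 [sl' _]] := @tilt l y sl; first by apply/ly/map_f.
have : af (l - e *: y) a <= inf (vals a).
  by apply: lb_le_inf; [case: hinf | move=> t; apply: vals_lb].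
rewrite afB afZ; apply/negP; rewrite -ltNge; apply: le_lt_trans la _.
by rewrite ltrDl oppr_gt0 pmulr_rlt0.
Qed.

End Subdivision.

Section RegularDecomposition.
Variables (R : realType) (V : seq 'rV[int]_2) (h : 'rV[int]_2 -> R).
Local Notation affine := ('rV[R]_2 * R^o)%type.
Local Notation emb := (emb R).
Local Notation minorant := (minorant V h).
Local Notation contact := (contact V h).
Local Notation cell := (cell V h).
Implicit Types (l y : affine) (v : 'rV[int]_2) (a : 'rV[R]_2).

Definition cells : set (set 'rV[R]_2) :=
  [set S | exists l, [/\ minorant l, contact l != [::] & S = cell l]].

Lemma two_dim_affine l y : two_dim (cell l) ->
  (forall v, v \in contact l -> af y (emb v) = 0) -> y = 0.
Proof.
move=> [a [b [c [d abc]]]] yl.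
have z a' : a' \in [:: a; b; c] -> af y a' = 0.
  move=> /hull_mem/abc la'; apply/le_anti/andP; split.
    have [|] := hull_face (l := - y) la'; last by rewrite afN oppr_ge0.
    by move=> _ /mapP[v vl ->]; rewrite afN yl ?oppr0.
  have [|//] := hull_face (l := y) la'.
  by move=> _ /mapP[v vl ->]; rewrite yl.
by apply: (af_indep d); apply: z; rewrite !inE eqxx ?orbT.
Qed.

Lemma cell_cell l a : minorant l -> cell l a -> contact l != [::].
Proof. by move=> _; rewrite /cell; case: (contact l) => // /hull_nil. Qed.

Lemma cells_mem l a : minorant l -> cell l a -> cells (cell l).
Proof. by move=> sl la; exists l; split=> //; apply: cell_cell la. Qed.

Lemma cell_hull l : cell l `<=` hull (map emb V).
Proof.
by apply: hull_sub => _ /mapP[v /contactP[vV _] ->]; apply: map_f.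
Qed.

(** Tilting the minorant along the functional that defines the face gives a minorant whose cell is
    this face. *)
Lemma cells_face l F : minorant l -> face F (cell l) -> cells F.
Proof.
move=> sl [[a Fa] [u [b [ub FE]]]].
have [v vl|e e0 [sl' cl']] := @tilt R V h l (u, - b) sl.
  rewrite !afE /= subr_ge0; apply: ub.
  exact/hull_mem/map_f.
have FE' : F = cell (l - e *: ((u, - b) : affine)).
  rewrite FE; apply/seteqP; split=> c /=.
    move=> [lc uc]; have [|_] := hull_face (l := (u, - b)) lc.
      move=> _ /mapP[v vl ->]; rewrite !afE /= subr_ge0; apply: ub.
      exact/hull_mem/map_f.
    by rewrite !afE /= uc subrr => /(_ erefl); rewrite filter_map /cell cl'.
  rewrite /cell cl' => c0; split.
    by apply: hull_sub c0 => _ /mapP[v + ->]; rewrite mem_filter => /andP[_ ?]; apply: map_f.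
  apply/eqP; rewrite -subr_eq0; apply/eqP; apply/le_anti/andP; split.
    have [|] := hull_face (l := (- u, b)) c0.
      move=> _ /mapP[v + ->]; rewrite mem_filter => /andP[/eqP + _].
      by rewrite !afE /dot /= !mxE; lra.
    by rewrite !afE /dot /= !mxE; lra.
  have [|] := hull_face (l := (u, - b)) c0.
    by move=> _ /mapP[v + ->]; rewrite mem_filter => /andP[/eqP ->].
  by rewrite !afE.
by rewrite FE'; apply: cells_mem sl' (_ : cell _ a); rewrite -FE'.
Qed.

(** The difference of the two minorants is nonnegative on the first cell and vanishes there exactly
    on the intersection. *)
Lemma cellI_face l l' : minorant l -> minorant l' -> cell l `&` cell l' !=set0 ->
  face (cell l `&` cell l') (cell l).
Proof.
move=> sl sl' ne; split=> //; exists (l - l').1, (- (l - l').2).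
have e a : dot (l - l').1 a = af (l - l') a - (l - l').2 by rewrite !afE addrK.
split=> [a la|].
  by rewrite e -subr_ge0 opprK subrK afB subr_ge0 (cell_le sl' la).1.
apply/seteqP; split=> a /= [la].
  move=> la'; split=> //; rewrite e afB (cell_val sl sl' la la') subrr sub0r.
  by [].
rewrite e => /eqP; rewrite -subr_eq0 opprK subrK afB subr_eq0 => /eqP e'.
by split=> //; apply: cell_of_val la _.
Qed.

(** By [cell_val] the choice of the minorant does not matter; the default [0] is taken only off the
    hull of [V]. *)
Definition height a : R := af (xget 0 [set l | minorant l /\ cell l a]) a.

Lemma height_cell l a : minorant l -> cell l a -> height a = af l a.
Proof.
move=> sl la; rewrite /height; set l' := xget _ _.
have [sl' la'] : [set l | minorant l /\ cell l a] l' by apply: xgetPex; exists l.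
exact: (cell_val sl' sl la' la).
Qed.

Lemma height_ge l a : hull (map emb V) a -> minorant l -> af l a <= height a.
Proof.
move=> /(support_exists h)[l' sl' la'] sl.
by rewrite (height_cell sl' la') (cell_le sl la').1.
Qed.

Lemma cell_height l a : hull (map emb V) a -> minorant l -> height a = af l a ->
  cell l a.
Proof.
move=> /(support_exists h)[l' sl' la'] sl e.
by apply: (cell_of_val sl la'); rewrite -e (height_cell sl' la').
Qed.

Lemma height_convex : convex_on (hull (map emb V)) height.
Proof.
move=> a b t Va Vb t0 t1; have Vab := hull_conv t0 t1 Va Vb.
have [l sl lab] := support_exists h Vab; rewrite (height_cell sl lab) af_conv.
by rewrite lerD // ler_wpM2l ?subr_ge0 //; apply: height_ge.
Qed.

(** Contact lists are masks of [V], which makes the set of cells finite. *)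
Let contacts := [seq s <- [seq mask m V | m : (size V).-tuple bool] |
  `[< exists l, [/\ minorant l, contact l != [::] & s = contact l] >]].

Lemma contacts_mem l : minorant l -> contact l != [::] -> contact l \in contacts.
Proof.
move=> sl cl; rewrite mem_filter; apply/andP; split; first by apply/asboolP; exists l.
rewrite {1}/contact filter_mask; apply/mapP.
by exists (map_tuple (fun v => af l (emb v) == h v) (in_tuple V)); rewrite ?mem_enum.
Qed.

Lemma cells_contacts : cells = [set hull (map emb s) | s in [set` contacts]].
Proof.
apply/seteqP; split=> S.
  by move=> [l [sl cl ->]]; exists (contact l) => //=; apply: contacts_mem.
move=> [s /=]; rewrite mem_filter => /andP[/asboolP[l [sl cl ->]] _ <-].
by exists l.
Qed.

Lemma bigcup_cells : \bigcup_(S in cells) S = hull (map emb V).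
Proof.
apply/seteqP; split=> a; first by move=> [_ [l [_ _ ->]] /cell_hull].
move=> /(support_exists h)[l sl la]; exists (cell l) => //.
exact: cells_mem la.
Qed.

Lemma cells_decomposition : integral_decomposition (hull (map emb V)) cells.
Proof.
split.
- by split; [rewrite cells_contacts; apply/finite_image/finite_seq |
             exact: bigcup_cells].
- by move=> _ [l [sl cl ->]]; exists (contact l).
- by move=> _ F [l [sl cl ->]]; apply: cells_face.
- move=> _ _ [l [sl _ ->]] [l' [sl' _ ->]] ne; split; first exact: cellI_face.
  by rewrite setIC; apply: cellI_face; rewrite // setIC.
Qed.

(** A minorant touching over the centroid of the triangle agrees there with the given affine
    function and does not exceed it at the three vertices; so the two coincide. *)
Lemma domain_supp u b (S := [set a | hull (map emb V) a /\ height a = dot u a + b]) :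
  two_dim S -> minorant (u, b) /\ S = cell (u, b).
Proof.
move=> [a [c [d [dt acd]]]].
have [Va ea] : S a by apply/acd/hull_mem; rewrite inE eqxx.
have [Vc ec] : S c by apply/acd/hull_mem; rewrite !inE eqxx ?orbT.
have [Vd ed] : S d by apply/acd/hull_mem; rewrite !inE eqxx ?orbT.
pose m := 3^-1 *: a + (1 - 3^-1) *: (2^-1 *: c + (1 - 2^-1) *: d).
have [Vm em] : S m.
  apply: acd; rewrite /m; apply: hull_conv; [lra|lra| |apply: hull_conv; [lra|lra| |]];
    by apply/hull_mem; rewrite !inE eqxx ?orbT.
have [l sl lm] := support_exists h Vm.
have e : l = (u, b).
  have hm : af l m = af ((u, b) : affine) m by rewrite -(height_cell sl lm) afE.
  have := height_ge Va sl; have := height_ge Vc sl; have := height_ge Vd sl.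
  have ee x : dot u x + b = af ((u, b) : affine) x by rewrite afE.
  rewrite ea ec ed !ee; move: hm; rewrite /m !af_conv => hm hd hc ha.
  apply/eqP; rewrite -subr_eq0; apply/eqP/(af_indep dt); rewrite afB; lra.
rewrite -e; split=> //; apply/seteqP; split=> x.
  by move=> [Vx ex]; apply: cell_height => //; rewrite e afE.
move=> lx; split; first exact: cell_hull lx.
by rewrite (height_cell sl lx) e afE.
Qed.

Lemma cells_regular : regular_decomposition (hull (map emb V)) cells.
Proof.
exists height; split; first exact: height_convex.
- exists (map (map emb) contacts); split.
    rewrite -bigcup_cells cells_contacts; apply/seteqP; split=> a [S].
      move=> [s /= sc <-] sa; exists (hull (map emb s)) => //.
      by exists (map emb s) => //=; apply: map_f.
    move=> [_ /= /mapP[s sc ->] <-] sa; exists (hull (map emb s)) => //.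
    by exists s.
  move=> _ /mapP[s + ->]; rewrite mem_filter => /andP[/asboolP[l [sl cl ->]] _].
  by exists l.1, l.2 => a la; rewrite (height_cell sl la) afE.
- move=> S; split.
    move=> [[l [sl cl ->]] t]; split=> //; exists l.1, l.2.
    apply/seteqP; split=> a.
      by move=> la; split; [exact: cell_hull la | rewrite (height_cell sl la) afE].
    by move=> [Va e]; apply: cell_height => //; rewrite e afE.
  move=> [t [u [b e]]]; split=> //; move: t; rewrite e => t.
  have [sl ->] := domain_supp t; have [a [a1 [a2 [_ abc]]]] := t.
  have : [set a | hull (map emb V) a /\ height a = dot u a + b] a.
    by apply/abc/hull_mem; rewrite inE eqxx.
  by rewrite (domain_supp t).2; apply: cells_mem.
Qed.

End RegularDecomposition.

(** * Lexicographic heights *)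

Section Lexicographic.
Variable R : realType.
Implicit Types (w c : seq R).

Fixpoint lexpos c : bool :=
  if c is x :: c' then (0 < x) || ((x == 0) && lexpos c') else false.

Fixpoint wsum w c : R :=
  match w, c with x :: w', y :: c' => x * y + wsum w' c' | _, _ => 0 end.

(* Weights so rapidly decreasing that the sign of a weighted sum is the
   lexicographic one. *)
Lemma lex_weights n (cs : seq (seq R)) : (forall c, c \in cs -> size c = n) ->
  exists2 w, size w = n & forall c, c \in cs -> lexpos c -> 0 < wsum w c.
Proof.
elim: n cs => [|n ih] cs hs; first by exists [::] => // c /hs/size0nil->.
have [c /mapP[d /hs + ->]|w ws wp] := ih [seq behead c | c <- cs].
  by rewrite size_behead => ->.
have [e e0 /(_ e e0 (lexx e)) he] :=
  exists_eps cs (fun c => head 0 c) (fun c => - wsum w (behead c)).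
exists (e^-1 :: w) => [|c]; first by rewrite /= ws.
case: c => // x c cin /= /orP[x0|/andP[/eqP-> cp]].
  have := he _ cin x0; rewrite /= mulrN opprK => p.
  by rewrite -(pmulr_rgt0 _ e0) mulrDr mulVKf ?gt_eqF.
by rewrite mulr0 add0r wp //; apply/mapP; exists (x :: c).
Qed.

Lemma wsum_mapD w (I : Type) (r : seq I) (F G : I -> R) :
  wsum w [seq F i + G i | i <- r] = wsum w (map F r) + wsum w (map G r).
Proof.
elim: r w => [|i r ih] [|x w] //=; rewrite ?addr0 //.
by rewrite ih; ring.
Qed.

Lemma wsum_mapZ w (I : Type) (r : seq I) (F : I -> R) k :
  wsum w [seq k * F i | i <- r] = k * wsum w (map F r).
Proof.
elim: r w => [|i r ih] [|x w] //=; rewrite ?mulr0 //.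
by rewrite ih; ring.
Qed.

Lemma lex_trichotomy c : [\/ lexpos c, lexpos (map -%R c) | all (pred1 0) c].
Proof.
elim: c => [|x c ih] /=; first by constructor 3.
rewrite oppr_gt0 oppr_eq0; case: ltgtP => //= _; try by constructor.
Qed.

Lemma lexpos_cat c d : lexpos c -> lexpos (c ++ d).
Proof.
elim: c => //= x c ih /orP[->|/andP[-> /ih->]] //; by rewrite orbT.
Qed.

Lemma lexpos_cat0 c d : all (pred1 0) c -> lexpos (c ++ d) = lexpos d.
Proof. by elim: c => //= x c ih /andP[/eqP-> /ih->]; rewrite ltxx eqxx. Qed.

End Lexicographic.

Section Weighted.
Variable R : realType.
Local Notation affine := ('rV[R]_2 * R^o)%type.

Fixpoint awsum (w : seq R) (ls : seq affine) : affine :=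
  match w, ls with x :: w', l :: ls' => x *: l + awsum w' ls' | _, _ => 0 end.

Lemma af_awsum w (I : Type) (r : seq I) (L : I -> affine) a :
  af (awsum w (map L r)) a = wsum w [seq af (L i) a | i <- r].
Proof.
elim: r w => [|i r ih] [|x w] /=; rewrite ?af0 //.
by rewrite afD afZ ih.
Qed.

End Weighted.

(** * Affine dependencies and collinearity *)

Section Dependency.
Variable R : realType.
Local Notation emb := (emb R).
Implicit Types (a b c d : 'rV[int]_2).

Lemma emb_inj : injective emb.
Proof.
move=> u v e; apply: row2P; [have := congr1 (fun x : 'rV[R]_2 => x 0 0) e |
  have := congr1 (fun x : 'rV[R]_2 => x 0 1) e]; rewrite !mxE => /eqP;
  by rewrite eqr_int => /eqP.
Qed.

Definition area a b c : R := cross (emb b - emb a) (emb c - emb a).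

Lemma areaE a b c : area a b c = cross (emb b - emb a) (emb c - emb a).
Proof. by []. Qed.

(* The affine dependency of four points of the plane, applied to a function. *)
Definition dep (f : 'rV[int]_2 -> R) a b c d : R :=
  area b c d * f a - area a c d * f b + area a b d * f c - area a b c * f d.

Lemma dep_af l a b c d : dep (fun v => af l (emb v)) a b c d = 0.
Proof. rewrite /dep /area /cross !afE /dot /emb !mxE; ring. Qed.

Lemma depB f g a b c d : dep (fun v => f v - g v) a b c d = dep f a b c d - dep g a b c d.
Proof. rewrite /dep; ring. Qed.

Lemma wsum_dep w (I : Type) (r : seq I) (F : I -> 'rV[int]_2 -> R) a b c d :
  wsum w [seq dep (F i) a b c d | i <- r] =
  dep (fun v => wsum w [seq F i v | i <- r]) a b c d.
Proof.
elim: r w => [|i r ih] [|x w] /=; rewrite ?ih /dep; ring.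
Qed.

Lemma area0_between a b c : a != b -> area a b c = 0 ->
  exists r : R, emb c = (1 - r) *: emb a + r *: emb b.
Proof.
move=> ab; have : emb a != emb b by apply: contra ab => /eqP/emb_inj->.
rewrite /area; move: (emb a) (emb b) (emb c) => {ab}u v z uv.
rewrite /cross !mxE => e.
have : (u 0 0 != v 0 0) || (u 0 1 != v 0 1).
  by rewrite -negb_and; apply: contra uv => /andP[/eqP? /eqP?]; apply/eqP/row2P.
case/orP => h.
  exists ((z 0 0 - u 0 0) / (v 0 0 - u 0 0)).
  have d : v 0 0 - u 0 0 != 0 by rewrite subr_eq0 eq_sym.
  apply: row2P; rewrite !mxE; apply: (mulfI d); first by field.
  have -> : (v 0 0 - u 0 0) * z 0 1 = (v 0 0 - u 0 0) * u 0 1 +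
    ((v 0 0 - u 0 0) * (z 0 1 - u 0 1) - (v 0 1 - u 0 1) * (z 0 0 - u 0 0))
    + (v 0 1 - u 0 1) * (z 0 0 - u 0 0) by ring.
  by rewrite e; field.
exists ((z 0 1 - u 0 1) / (v 0 1 - u 0 1)).
have d : v 0 1 - u 0 1 != 0 by rewrite subr_eq0 eq_sym.
apply: row2P; rewrite !mxE; apply: (mulfI d); last by field.
have -> : (v 0 1 - u 0 1) * z 0 0 = (v 0 1 - u 0 1) * u 0 0 -
  ((v 0 0 - u 0 0) * (z 0 1 - u 0 1) - (v 0 1 - u 0 1) * (z 0 0 - u 0 0))
  + (v 0 0 - u 0 0) * (z 0 1 - u 0 1) by ring.
by rewrite e; field.
Qed.

End Dependency.

(** * Vertices of the subdivision *)

Section Used.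
Variables (R : realType) (V : seq 'rV[int]_2) (h : 'rV[int]_2 -> R).
Local Notation emb := (emb R).
Implicit Types (a b c v z : 'rV[int]_2).

(** The point is by itself a cell, that is, a vertex of the subdivision. *)
Definition used v : Prop :=
  exists2 l, minorant V h l & contact V h l =i pred1 v.

(** If [a] and [b] both differ from [z], a minorant touching only at [z] is strictly below [l] at
    both, hence also at [z], where it equals [h z] and so is at least [l]. *)
Lemma used_extreme l z a b t : used z -> minorant V h l -> a \in contact V h l ->
  b \in contact V h l -> 0 <= t -> t <= 1 ->
  emb z = t *: emb a + (1 - t) *: emb b -> z = a \/ z = b.
Proof.
move=> [l' sl' lz] sl la lb t0 t1 e.
have /contactP[zV hz] : z \in contact V h l' by rewrite lz inE.
have [-> |za] := eqVneq z a; first by left.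
have [-> |zb] := eqVneq z b; first by right.
have gt v : v \in V -> v != z -> af l' (emb v) < h v.
  move=> vV vz; rewrite lt_neqAle sl' // andbT; apply: contra vz => /eqP ev.
  by rewrite -[_ == _]/(v \in pred1 z) -lz; apply/contactP.
have /contactP[aV ha] := la; have /contactP[bV hb] := lb.
have ga := gt a aV; have gb := gt b bV; have := sl z zV.
rewrite -hz e !af_conv ha hb => p; exfalso.
have {}ga : 0 < h a - af l' (emb a) by rewrite subr_gt0 ga // eq_sym.
have {}gb : 0 < h b - af l' (emb b) by rewrite subr_gt0 gb // eq_sym.
have : t * (h a - af l' (emb a)) + (1 - t) * (h b - af l' (emb b)) <= 0 by lra.
apply/negP; rewrite -ltNge; have [->|tn] := eqVneq t 0; first by lra.
have t0' : 0 < t by rewrite lt_def tn.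
have p1 := mulr_gt0 t0' ga.
have p2 : 0 <= (1 - t) * (h b - af l' (emb b)) by rewrite mulr_ge0 ?(ltW gb) // subr_ge0.
by rewrite ltr_wpDr.
Qed.

(** Of three collinear points one lies between the others, against [used_extreme]. *)
Lemma used_area l a b c : (forall v, v \in V -> used v) -> minorant V h l ->
  a \in contact V h l -> b \in contact V h l -> c \in contact V h l ->
  a != b -> a != c -> b != c -> area R a b c != 0.
Proof.
move=> uV sl la lb lc ab ac bc; apply/eqP => /(area0_between ab)[r e].
have u v : v \in contact V h l -> used v by move=> /contactP[/uV].
have [r1|r1] := leP r 1; last first.
  have r0 : r != 0 by rewrite gt_eqF // (lt_trans _ r1).
  have e' : emb b = r^-1 *: emb c + (1 - r^-1) *: emb a.
    by rewrite e; apply: row2P; rewrite !mxE; field.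
  have [||ebc|eba] := used_extreme (u _ lb) sl lc la _ _ e'.
  - by rewrite invr_ge0 (le_trans _ (ltW r1)).
  - by rewrite invf_le1 ?(lt_trans _ r1) // ltW.
  - by rewrite ebc eqxx in bc.
  - by rewrite eba eqxx in ab.
have [r0|r0] := leP 0 r.
  rewrite addrC in e.
  have [ecb|eca] := used_extreme (u _ lc) sl lb la r0 r1 e.
  - by rewrite ecb eqxx in bc.
  - by rewrite eca eqxx in ac.
have r0' : 1 - r != 0 by rewrite gt_eqF // subr_gt0 (lt_trans r0).
have e' : emb a = (1 - r)^-1 *: emb c + (1 - (1 - r)^-1) *: emb b.
  by rewrite e; apply: row2P; rewrite !mxE; field.
have [||eac|eab] := used_extreme (u _ la) sl lc lb _ _ e'.
- by rewrite invr_ge0; lra.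
- by rewrite invf_le1; lra.
- by rewrite eac eqxx in ac.
- by rewrite eab eqxx in ab.
Qed.

End Used.

(** * Cross products and barycentric coordinates *)

Lemma crossC (K : comPzRingType) (u v : 'rV[K]_2) : cross u v = - cross v u.
Proof. rewrite /cross; ring. Qed.

Lemma crossvv (K : comPzRingType) (u : 'rV[K]_2) : cross u u = 0.
Proof. rewrite /cross; ring. Qed.

Section Barycentric.
Variable R : realType.
Local Notation affine := ('rV[R]_2 * R^o)%type.
Local Notation emb := (emb R).
Implicit Types (o a b z w : 'rV[R]_2) (u v : 'rV[int]_2) (l : affine).

Lemma embD u v : emb (u + v) = emb u + emb v.
Proof. by apply: row2P; rewrite !mxE rmorphD. Qed.

Lemma embB u v : emb (u - v) = emb u - emb v.
Proof. by apply: row2P; rewrite !mxE rmorphB. Qed.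

Lemma embMn u n : emb (u *+ n) = n%:R *: emb u.
Proof. by apply: row2P; rewrite !mxE mulmxnE rmorphMn /= -mulr_natl. Qed.

Lemma cross_emb u v : cross (emb u) (emb v) = (cross u v)%:~R.
Proof. by rewrite /cross !mxE rmorphB !rmorphM. Qed.

Definition cross_form o w : affine :=
  ((\row_k (if k == 0 then - w 0 1 else w 0 0)), - cross w o).

Lemma cross_formE o w z : af (cross_form o w) z = cross w (z - o).
Proof. rewrite !afE /= /dot /cross !mxE /=; ring. Qed.

Lemma af_eq3 l l' a b c : cross (b - a) (c - a) != 0 ->
  af l a = af l' a -> af l b = af l' b -> af l c = af l' c -> l = l'.
Proof.
move=> d ea eb ec; apply/eqP; rewrite -subr_eq0; apply/eqP.
by apply: (af_indep d); rewrite afB ?ea ?eb ?ec subrr.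
Qed.

(* The coordinate of a in the affine frame with origin o and vectors a - o and
   b - o. *)
Definition bary o a b : affine :=
  (cross (a - o) (b - o))^-1 *: - cross_form o (b - o).

Lemma baryE o a b z :
  af (bary o a b) z = cross (z - o) (b - o) / cross (a - o) (b - o).
Proof. rewrite afZ afN cross_formE mulrC; congr (_ / _); rewrite /cross; ring. Qed.

Lemma bary_o o a b : af (bary o a b) o = 0.
Proof. by rewrite baryE subrr /cross !mxE !mul0r subrr mul0r. Qed.

Lemma bary_a o a b : cross (a - o) (b - o) != 0 -> af (bary o a b) a = 1.
Proof. by move=> d; rewrite baryE divff. Qed.

Lemma bary_b o a b : af (bary o a b) b = 0.
Proof. by rewrite baryE crossvv mul0r. Qed.

Lemma baryP o a b z : cross (a - o) (b - o) != 0 ->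
  z = o + af (bary o a b) z *: (a - o) + af (bary o b a) z *: (b - o).
Proof.
move=> d; have d' : cross (b - o) (a - o) != 0 by rewrite crossC oppr_eq0.
rewrite !baryE; move: d d'; rewrite /cross !mxE => d d'.
by apply: row2P; rewrite !mxE; field; rewrite d d'.
Qed.

Lemma bary_triangle o a b z : cross (a - o) (b - o) != 0 ->
  hull [:: a; b; o] z <->
  [/\ 0 <= af (bary o a b) z, 0 <= af (bary o b a) z
    & af (bary o a b) z + af (bary o b a) z <= 1].
Proof.
move=> d; have d' : cross (b - o) (a - o) != 0 by rewrite crossC oppr_eq0.
have [[Aa Ab] Ao] := (bary_a d, bary_b o a b, bary_o o a b).
have [[Bb Ba] Bo] := (bary_a d', bary_b o b a, bary_o o b a).
split=> [hz|[]].
  have pos l : 0 <= af l a -> 0 <= af l b -> 0 <= af l o -> 0 <= af l z.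
    move=> la lb lo; have [|//] := hull_face (l := l) hz.
    by move=> w; rewrite !inE => /or3P[] /eqP->.
  split; first by apply: pos; rewrite ?Aa ?Ab ?Ao.
    by apply: pos; rewrite ?Ba ?Bb ?Bo.
  have : 0 <= af (afc 1 - (bary o a b + bary o b a)) z.
    by apply: pos; rewrite afB afD af_c ?Aa ?Ab ?Ao ?Ba ?Bb ?Bo; lra.
  by rewrite afB afD af_c; lra.
rewrite [z in hull _ z](baryP z d); move: (af _ z) (af _ z) => r s s0 r0 sr.
have hm w : w \in [:: a; b; o] -> hull [:: a; b; o] w by apply: hull_mem.
have [sr0|sr0] := eqVneq (s + r) 0.
  have [-> ->] : s = 0 /\ r = 0 by lra.
  by rewrite !scale0r !addr0; apply: hm; rewrite !inE eqxx !orbT.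
have sr0' : 0 < s + r by rewrite lt_def sr0 addr_ge0.
have -> : o + s *: (a - o) + r *: (b - o) =
  (s + r) *: ((s / (s + r)) *: a + (1 - s / (s + r)) *: b) + (1 - (s + r)) *: o.
  by apply: row2P; rewrite !mxE; field.
apply: hull_conv => //; [exact: ltW | | by apply: hm; rewrite !inE eqxx !orbT].
apply: hull_conv; rewrite ?divr_ge0 ?(ltW sr0') //.
- by rewrite ler_pdivrMr // mul1r lerDl.
- by apply: hm; rewrite !inE eqxx.
- by apply: hm; rewrite !inE eqxx !orbT.
Qed.

End Barycentric.

(** * Lattice lengths and primitive vectors *)

Lemma edge_scale (u : 'rV[int]_2) : (0 < llen u)%N ->
  u = map_mx (fun t : int => (t %/ (llen u)%:Z)%Z) u *+ llen u.
Proof.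
move=> u0; have d (k : 'I_2) : ((llen u)%:Z %| u 0%R k)%Z.
  rewrite dvdzE /=; case: k => [[|[|//]] hk].
    by rewrite (_ : Ordinal hk = 0) ?dvdn_gcdl //; apply/val_inj.
  by rewrite (_ : Ordinal hk = 1) ?dvdn_gcdr //; apply/val_inj.
by apply/rowP => k; rewrite mulmxnE mxE -[RHS]mulr_natr natz divzK.
Qed.

(* The lattice points of a segment are its multiples of the primitive vector,
   by Bezout. *)
Lemma primitive_multiple (R : realType) (u v : 'rV[int]_2) (s : R) :
  (0 < llen u)%N -> emb R v = s *: emb R u -> exists k : int, s * (llen u)%:R = k%:~R.
Proof.
move=> u0 e; have [a [b g]] := Bezoutz (u 0 0) (u 0 1).
exists (a * v 0 0 + b * v 0 1).
have e0 := congr1 (fun x : 'rV[R]_2 => x 0 0) e.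
have e1 := congr1 (fun x : 'rV[R]_2 => x 0 1) e.
rewrite !mxE in e0 e1.
rewrite rmorphD !rmorphM /= e0 e1 !(mulrCA _ s) -mulrDr -!rmorphM -rmorphD /=.
by congr (_ * _); rewrite g.
Qed.

Lemma crossMnl (u w : 'rV[int]_2) n : cross (u *+ n) w = cross u w * n%:Z.
Proof. by rewrite /cross !mulmxnE !mulrnAl -mulrnBl -mulr_natr natz. Qed.

Lemma crossMnr (u w : 'rV[int]_2) n : cross u (w *+ n) = cross u w * n%:Z.
Proof. by rewrite /cross !mulmxnE !mulrnAr -mulrnBl -mulr_natr natz. Qed.

Lemma crossBr (K : comPzRingType) (u v w : 'rV[K]_2) :
  cross u (v - w) = cross u v - cross u w.
Proof. rewrite /cross !mxE; ring. Qed.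

(** The directions [a], [b], [c] belong to three consecutive edges. The terms are the distances of
    [p] to these edges times the intersection numbers with the middle component; the Plucker
    relation [pl] reduces their sum to the lattice length of the middle edge. *)
Lemma toric_degree_aux (a b c p v : 'rV[int]_2) (s t : nat) :
  cross a b != 0 -> cross b c != 0 ->
  (cross b (p - (v + a *+ s)))%:~R *
    (- (cross a c)%:~R / ((cross a b)%:~R * (cross b c)%:~R)) +
  ((cross a (p - v))%:~R / (cross a b)%:~R +
   (cross c (p - (v + a *+ s + b *+ t)))%:~R / (cross b c)%:~R) = t%:~R :> rat.
Proof.
rewrite -!(intr_eq0 rat) => d1 d2.
have e1 : cross b (p - (v + a *+ s)) = cross b (p - v) + cross a b * s%:Z.
  have -> : p - (v + a *+ s) = p - v - a *+ s by rewrite opprD addrA.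
  rewrite crossBr crossMnr (crossC b a); ring.
have e2 : cross c (p - (v + a *+ s + b *+ t)) =
    cross c (p - v) + cross a c * s%:Z + cross b c * t%:Z.
  have -> : p - (v + a *+ s + b *+ t) = p - v - a *+ s - b *+ t by rewrite !opprD !addrA.
  rewrite !crossBr !crossMnr (crossC c a) (crossC c b); ring.
have pl : cross c (p - v) * cross a b + cross a (p - v) * cross b c =
    cross b (p - v) * cross a c by rewrite /cross !mxE; ring.
rewrite e1 e2.
move: d1 d2 pl; move: (cross a b) (cross b c) (cross a c) => ab bc ac.
move: (cross a _) (cross b _) (cross c _) => pa pb pc d1 d2.
move/(congr1 (fun z : int => z%:~R : rat)); rewrite !intrD !intrM => pl.
have e : t%:~R = t%:~R + (pc%:~R * ab%:~R + pa%:~R * bc%:~R - pb%:~R * ac%:~R)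
    / (ab%:~R * bc%:~R) :> rat by rewrite pl subrr mul0r addr0.
by rewrite [RHS]e; field; rewrite d1 d2.
Qed.

(** * Consequences of ampleness *)

Section Intersections.
Variables (R : realType) (X : toric_model R).
Hypotheses (Hgood : good_toric_model X) (Hpol : polarized X).
Implicit Types (i k : 'I_(nsides X)) (x y : exc X).

Lemma ordS_neq i : ordS i != i.
Proof.
case: Hgood => n3 _ _ _ _; apply/eqP => /(congr1 val) /=.
case: (ltnP i.+1 (nsides X)) => hi; first by rewrite modn_small //; lia.
have -> : i.+1 = nsides X by have := ltn_ord i; lia.
by rewrite modnn; lia.
Qed.

Lemma ordS2_neq i : ordS (ordS i) != i.
Proof.
case: Hgood => n3 _ _ _ _; apply/eqP => /(congr1 val) /=.
have hi := ltn_ord i.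
have [h1|h1] : (i.+1 < nsides X)%N \/ i.+1 = nsides X by lia.
  rewrite (modn_small h1).
  have [h2|h2] : (i.+2 < nsides X)%N \/ i.+2 = nsides X by lia.
    by rewrite modn_small //; lia.
  by rewrite h2 modnn; lia.
by rewrite h1 modnn modn_small; lia.
Qed.

Lemma cross_dir_edge i (w : 'rV[int]_2) :
  cross (edge_dir i) w * (llen (edge i))%:Z = cross (edge i) w /\ (0 < llen (edge i))%N.
Proof.
case: Hgood => n3 cvx _ _ _.
have l0 : (0 < llen (edge i))%N.
  rewrite lt0n; apply/eqP => e0.
  have e : edge i = 0.
    have := gcdn_gt0 `|edge i 0%R 0%R| `|edge i 0%R 1%R|.
    rewrite -/(llen _) e0 !absz_gt0 => /esym/negbT; rewrite negb_or !negbK.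
    by case/andP => /eqP? /eqP?; apply: row2P; rewrite [RHS]mxE.
  have := cvx i (ordS (ordS i)) (ordS2_neq i) (ordS_neq _).
  by rewrite e /cross !mxE !mul0r subrr ltxx.
split=> //; rewrite {2}(edge_scale l0) -/(edge_dir i).
by rewrite crossMnl.
Qed.

Lemma cone_index_gt0 i : 0 < cross (edge_dir i) (edge_dir (ordS i)).
Proof.
case: (Hgood) => n3 cvx _ _ _.
have [e1 l1] := cross_dir_edge i (edge_dir (ordS i)).
have [e2 l2] := cross_dir_edge (ordS i) (edge i).
have c := cvx i (ordS (ordS i)) (ordS2_neq i) (ordS_neq _).
have e3 : cross (edge i) (vert (ordS (ordS i)) - vert i) = cross (edge i) (edge (ordS i)).
  by rewrite /edge /cross !mxE; ring.
have e4 (u v : 'rV[int]_2) : cross u v = - cross v u by rewrite /cross; ring.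
rewrite -(@pmulr_lgt0 _ (llen (edge i))%:Z) ?ltz_nat // e1.
rewrite -(@pmulr_lgt0 _ (llen (edge (ordS i)))%:Z) ?ltz_nat //.
by rewrite e4 mulNr e2 -e4 -e3.
Qed.

Lemma vert_ordS i : vert (ordS i) = vert i + edge_dir i *+ llen (edge i).
Proof. by rewrite -(edge_scale (cross_dir_edge i 0).2) /edge addrC subrK. Qed.

Lemma inter_L_E x : inter (cls_L X) (cls_E x) = (mm x)%:R.
Proof.
rewrite /inter /cls_L /cls_E /=.
rewrite big1 ?add0r; last by move=> i _; rewrite big1 // => k _; rewrite mulr0 mul0r.
rewrite (bigD1 (side x)) //= (bigD1 x) //= big1 ?addr0; last first.
  by move=> y yx; rewrite (negbTE yx) !mulr0 addr0 mul0r.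
rewrite eqxx /D_E eqxx !mulr1 mulr0 addr0 big1 ?addr0; last first.
  move=> i /negbTE ix; rewrite big1 // => y _; rewrite mulr0 addr0.
  have [->|] := eqVneq y x; last by rewrite mulr0 mul0r.
  by rewrite eq_sym ix mulr0.
rewrite (bigD1 x) //= (bigD1 x) //= !eqxx /E_E eqxx !big1 ?addr0.
- by rewrite rmorphB /=; ring.
- move=> y /negbTE yx; rewrite big1 // => z _; rewrite /E_E.
  have [->|] := eqVneq z x; last by rewrite mulr0 mul0r.
  by rewrite yx oppr0 mulr0.
- by move=> y /negbTE yx; rewrite yx mulr0 mul0r.
Qed.

Lemma mm_gt0 x : (0 < mm x)%N.
Proof. by case: Hpol => _ _ _ /(_ x); rewrite inter_L_E ltr0n. Qed.

(** Only the component itself and its two neighbours contribute; the sum is the degree of Lb on a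
    boundary component. *)
Lemma toric_degree i :
  \sum_k (cc k)%:R * toric_int k i = (llen (edge i))%:R :> rat.
Proof.
case: (Hgood) => n3 cvx _ ld _.
set j := ord_pred i; have ji : ordS j = i by rewrite ord_predK.
have nij : j != i by rewrite -[X in _ != X]ji eq_sym ordS_neq.
have nSi : ordS i != i := ordS_neq i.
have nSj : ordS i != j by rewrite -{1}ji ordS2_neq.
rewrite (bigD1 i) //= (bigD1 j) //= (bigD1 (ordS i)) /=; last by rewrite nSi nSj.
rewrite big1 ?addr0; last first.
  move=> k /andP[/andP[ki kj] kSi]; rewrite /toric_int eq_sym (negbTE ki).
  rewrite (_ : (i == ordS k) = false); last first.
    by apply/negbTE; apply: contra kj; rewrite /j => /eqP->; rewrite ordSK.
  by rewrite (negbTE kSi) mulr0.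
have -> : toric_int i i = - (cross (edge_dir j) (edge_dir (ordS i)))%:~R
      / (cone_index j * cone_index i) by rewrite /toric_int eqxx.
have -> : toric_int j i = (cone_index j)^-1.
  by rewrite /toric_int eq_sym (negbTE nij) ji eqxx.
have -> : toric_int (ordS i) i = (cone_index i)^-1.
  by rewrite /toric_int eq_sym (negbTE nSi) eq_sym (negbTE (ordS2_neq i)) eqxx.
rewrite /cone_index ji.
have p1 := cone_index_gt0 j; rewrite ji in p1; have p2 := cone_index_gt0 i.
have cast k : (cc k)%:R = (lattice_dist k (base_pt X))%:~R :> rat by rewrite ld.
have -> : (llen (edge i))%:R = (llen (edge i))%:Z%:~R :> rat by [].
rewrite !cast /lattice_dist (vert_ordS i) -[in vert i]ji (vert_ordS j).
by apply: toric_degree_aux; rewrite gt_eqF.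
Qed.
Lemma inter_L_D i : inter (cls_L X) (cls_D i) =
  (llen (edge i))%:R - (\sum_(x | side x == i) mm x)%:R.
Proof.
rewrite /inter /cls_L /cls_D /=.
rewrite [X in _ + X]big1 ?addr0; last first.
  by move=> x _; rewrite big1 // => y _; rewrite mulr0 mul0r.
have -> : \sum_k \sum_l (cc k)%:~R * (l == i)%:R%:~R * D_D k l =
    \sum_k (cc k)%:R * D_D k i.
  apply: eq_bigr => k _; rewrite (bigD1 i) //= eqxx mulr1 big1 ?addr0 //.
  by move=> l /negbTE->; rewrite mulr0 mul0r.
have -> : \sum_k (cc k)%:R * D_D k i = \sum_k (cc k)%:R * toric_int k i
    - (cc i)%:R * #|[pred x | side x == i]|%:R.
  rewrite (bigD1 i) //= [in RHS](bigD1 i) //= /D_D eqxx mulrBr -!addrA; congr (_ + _).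
  rewrite addrC; congr (_ - _); apply: eq_bigr => k ki.
  by rewrite eq_sym (negbTE ki) subr0.
rewrite toric_degree -addrA; congr (_ + _).
rewrite exchange_big /= (eq_bigr (fun x =>
    if side x == i then (cc i)%:R - (mm x)%:R else 0)); last first.
  move=> x _; rewrite (bigD1 i) //= eqxx mulr0 add0r mulr1 big1 ?addr0 /D_E.
    by have [->|_] := eqVneq (side x) i; rewrite ?mulr0 // rmorphB /= mulr1.
  by move=> k /negbTE ki; rewrite mulr0 add0r ki mulr0 mul0r.
rewrite -big_mkcond /= sumrB sumr_const natr_sum mulr_natr addrA addNr add0r.
by [].
Qed.

(** Some component is not contracted by g, and L has positive degree on it. *)
Lemma gap_side : exists i, (\sum_(x | side x == i) mm x < llen (edge i))%N.
Proof.
case: Hpol => ct _ hD _ _.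
have [i ic] : exists i, i \notin contracted X.
  apply/existsP; apply: contraNT ct; rewrite negb_exists => /forallP c.
  by apply/eqP/setP => i; rewrite inE; have := c i; rewrite negbK.
exists i; have := hD i; rewrite (negbTE ic) inter_L_D subr_gt0 ltr_nat.
by [].
Qed.

End Intersections.

(** * The momentum polygon and the triangles *)

Definition cut_model (R : realType) (X : toric_model R) (K : cut_data X) : Prop :=
  [/\ good_toric_model X, polarized X & symington_cut K].

Section Polygon.
Variables (R : realType) (X : toric_model R) (K : cut_data X).
Hypothesis H : cut_model K.
Local Notation affine := ('rV[R]_2 * R^o)%type.
Local Notation emb := (emb R).
Implicit Types (i k : 'I_(nsides X)) (x y : exc X) (z : 'rV[R]_2).

Let Hg : good_toric_model X. Proof. by case: H. Qed.

Definition side_form i : affine := cross_form (emb (vert i)) (emb (edge_dir i)).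

Lemma side_formE i v : af (side_form i) (emb v) = (lattice_dist i v)%:~R.
Proof. by rewrite cross_formE -embB cross_emb. Qed.

Lemma lattice_dist_edge i n : lattice_dist i (vert i + edge_dir i *+ n) = 0.
Proof.
rewrite /lattice_dist; have -> : vert i + edge_dir i *+ n - vert i = edge_dir i *+ n.
  by rewrite addrC addKr.
by rewrite crossMnr crossvv mul0r.
Qed.

Lemma lattice_dist_vert i : lattice_dist i (vert i) = 0.
Proof. by rewrite -(lattice_dist_edge i 0) mulr0n addr0. Qed.

Lemma lattice_dist_vertS i : lattice_dist i (vert (ordS i)) = 0.
Proof. by rewrite (vert_ordS Hg) lattice_dist_edge. Qed.

Lemma lattice_dist_gt0 i k : k != i -> k != ordS i -> 0 < lattice_dist i (vert k).
Proof.
move=> ki kS; case: (Hg) => _ cvx _ _ _; have := cvx i k ki kS.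
have [<- l0] := cross_dir_edge Hg i (vert k - vert i).
by rewrite pmulr_lgt0 // ltz_nat.
Qed.

Lemma lattice_dist_ge0 i k : 0 <= lattice_dist i (vert k).
Proof.
have [->|ki] := eqVneq k i; first by rewrite lattice_dist_vert.
have [->|kS] := eqVneq k (ordS i); first by rewrite lattice_dist_vertS.
exact/ltW/lattice_dist_gt0.
Qed.

Lemma polygon_vert i : momentum_polygon X (emb (vert i)).
Proof. by apply: hull_mem; apply: map_f; rewrite mem_enum. Qed.

Lemma side_form_ge0 i z : momentum_polygon X z -> 0 <= af (side_form i) z.
Proof.
move=> Pz; have [|//] := hull_face (l := side_form i) Pz.
by move=> _ /mapP[k _ ->]; rewrite side_formE ler0z lattice_dist_ge0.
Qed.

(** Among the vertices only [vert i] is at distance 0 from both sides, so [hull_face] leaves a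
    single point. *)
Lemma vert_extreme i z : momentum_polygon X z ->
  af (side_form (ord_pred i)) z + af (side_form i) z = 0 -> z = emb (vert i).
Proof.
rewrite -afD => Pz e; have [|_ /(_ e)] := hull_face (l := side_form (ord_pred i) + side_form i) Pz.
  by move=> _ /mapP[k _ ->]; rewrite afD !side_formE addr_ge0 ?ler0z ?lattice_dist_ge0.
move=> hz; apply: (@hull1 R); apply: hull_sub hz => v; rewrite mem_filter.
case/andP => /eqP + /mapP[k _ ev]; rewrite ev afD !side_formE -intrD => /eqP.
rewrite intr_eq0 paddr_eq0 ?lattice_dist_ge0 // => /andP[/eqP k1 /eqP k2].
have [->|ki] := eqVneq k i; first by rewrite mem_head.
exfalso; have [e1|kS] := eqVneq k (ordS i); last first.
  by have := lattice_dist_gt0 ki kS; rewrite k2 ltxx.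
have := @lattice_dist_gt0 (ord_pred i) k; rewrite k1 ord_predK ki ltxx.
move=> hh; suff /hh : k != ord_pred i by move/(_ isT).
rewrite e1 -{1}(ord_predK i); exact: (ordS2_neq Hg).
Qed.

(* A functional attains its minimum on the vertices at a vertex where it is a
   nonnegative combination of the two adjacent side forms. *)
Lemma polygonP z : (forall i, 0 <= af (side_form i) z) -> momentum_polygon X z.
Proof.
move=> hz; apply/asboolP/negPn/negP => /asboolPn/hull_separation[l lv].
apply/negP; rewrite -leNgt; case: (Hg) => n3 _ _ _ _.
pose i0 : 'I_(nsides X) := Ordinal (ltn_trans (isT : (0 < 2)%N) n3).
have [i hi] : exists i, forall k, af l (emb (vert i)) <= af l (emb (vert k)).
  pose i := [arg min_(i < i0) af l (emb (vert i))]%O; exists i => k.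
  by rewrite /i; case: Order.TotalTheory.arg_minP => // j _; apply.
set j := ord_pred i; have ji : ordS j = i by rewrite ord_predK.
have c0 : 0 < cross (emb (edge_dir j)) (emb (edge_dir i)).
  by rewrite cross_emb ltr0z -ji; apply: cone_index_gt0.
have lj : (0 < llen (edge j))%N := (cross_dir_edge Hg j 0).2.
have li : (0 < llen (edge i))%N := (cross_dir_edge Hg i 0).2.
have eS : emb (vert (ordS i)) = emb (vert i) + (llen (edge i))%:R *: emb (edge_dir i).
  by rewrite (vert_ordS Hg) embD embMn.
have ej : emb (vert i) = emb (vert j) + (llen (edge j))%:R *: emb (edge_dir j).
  by rewrite -{1}ji (vert_ordS Hg) embD embMn.
have l0 : 0 <= af l (emb (vert i)) by apply/lv/map_f; rewrite mem_enum.
have := hi (ordS i); have := hi j; rewrite eS; have := hz j; have := hz i.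
rewrite !cross_formE; have -> : emb (vert j) = emb (vert i) - (llen (edge j))%:R *: emb (edge_dir j).
  by rewrite ej addrK.
move: lj li; rewrite -!(ltr0n R); move: l0 c0.
move: (_%:R : R) ((llen (edge i))%:R : R) => s r.
move: (emb (edge_dir j)) (emb (edge_dir i)) (emb (vert i)) => u v o.
move=> l0 c0 s0 r0 ti tj lj li.
have {}li : 0 <= dot l.1 v.
  by rewrite -(pmulr_rge0 _ r0); move: li; rewrite !afE /dot !mxE; lra.
have {}lj : dot l.1 u <= 0.
  by rewrite -(pmulr_rle0 _ s0); move: lj; rewrite !afE /dot !mxE; lra.
have {}tj : 0 <= cross u (z - o).
  by move: tj; congr (_ <= _); rewrite /cross !mxE; ring.
have e : cross u v * af l z = cross u v * af l o + cross u (z - o) * dot l.1 v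
    - cross v (z - o) * dot l.1 u.
  by rewrite /cross !afE /dot !mxE; ring.
rewrite -(pmulr_rge0 _ c0) e -addrA; apply: addr_ge0; first by rewrite mulr_ge0 // ltW.
by apply: addr_ge0; [apply: mulr_ge0 | rewrite -mulrN mulr_ge0 ?oppr_ge0].
Qed.

Lemma base_pt_polygon : momentum_polygon X (emb (base_pt X)).
Proof.
apply: polygonP => i; rewrite side_formE; case: (Hg) => _ _ _ -> _.
by rewrite ler0z.
Qed.

Lemma side_polygon i n : (n <= llen (edge i))%N ->
  momentum_polygon X (emb (vert i + edge_dir i *+ n)).
Proof.
move=> hn; have l0 : (0 < llen (edge i))%N := (cross_dir_edge Hg i 0).2.
have l0' : (llen (edge i))%:R != 0 :> R by rewrite pnatr_eq0 -lt0n.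
have -> : emb (vert i + edge_dir i *+ n) =
    (n%:R / (llen (edge i))%:R) *: emb (vert (ordS i))
    + (1 - n%:R / (llen (edge i))%:R) *: emb (vert i).
  by rewrite (vert_ordS Hg) !embD !embMn; apply: row2P; rewrite !mxE; field.
apply: hull_conv; try exact: polygon_vert; first by rewrite divr_ge0.
by rewrite ler_pdivrMr ?ltr0n // mul1r ler_nat.
Qed.

End Polygon.

(** * Affine coordinates on the triangles *)

Section Triangles.
Variables (R : realType) (X : toric_model R) (K : cut_data X).
Hypothesis H : cut_model K.
Local Notation affine := ('rV[R]_2 * R^o)%type.
Local Notation emb := (emb R).
Implicit Types (i k : 'I_(nsides X)) (x y : exc X) (z : 'rV[R]_2) (b : bool).

Let Hg : good_toric_model X. Proof. by case: H. Qed.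
Let Hp : polarized X. Proof. by case: H. Qed.

Local Notation p := (base_pt X).
Local Notation apex := (cut_apex K).

(** The boolean names the end of the base, so that symmetric statements are proved once, with [~~ b]
    for the other end. *)
Definition base_vtx x b : 'rV[int]_2 := if b then base_end K x else base_start K x.
Local Notation q := base_vtx.

(* Coordinates on the triangle T_x with respect to its vertex p, and on Delta_x
   with respect to its apex. They are sealed: unfolding them makes conversion
   tests diverge. *)
Lemma tco_sig : {f : exc X -> bool -> affine |
  forall x b, f x b = bary (emb p) (emb (q x b)) (emb (q x (~~ b)))}.
Proof. by eexists. Qed.
Definition tco : exc X -> bool -> affine := sval tco_sig.
Lemma tco_def x b : tco x b = bary (emb p) (emb (q x b)) (emb (q x (~~ b))).
Proof. exact: (svalP tco_sig). Qed.

Lemma dco_sig : {f : exc X -> bool -> affine |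
  forall x b, f x b = bary (emb (apex x)) (emb (q x b)) (emb (q x (~~ b)))}.
Proof. by eexists. Qed.
Definition dco : exc X -> bool -> affine := sval dco_sig.
Lemma dco_def x b : dco x b = bary (emb (apex x)) (emb (q x b)) (emb (q x (~~ b))).
Proof. exact: (svalP dco_sig). Qed.

(* The level is 0 at p, and 1 on the side containing the base. *)
Lemma lev_sig : {f : exc X -> affine | forall x, f x = tco x false + tco x true}.
Proof. by eexists. Qed.
Definition lev : exc X -> affine := sval lev_sig.
Lemma lev_def x : lev x = tco x false + tco x true.
Proof. exact: (svalP lev_sig). Qed.

Lemma dlev_sig : {f : exc X -> affine | forall x, f x = dco x false + dco x true}.
Proof. by eexists. Qed.
Definition dlev : exc X -> affine := sval dlev_sig.
Lemma dlev_def x : dlev x = dco x false + dco x true.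
Proof. exact: (svalP dlev_sig). Qed.

Definition lev0 x : R := 1 - (mm x)%:R / (cc (side x))%:R.

Lemma cc_gt0 x : (0 < cc (side x))%N.
Proof. by case: (Hg) => _ _ _ _ /(_ x); apply: leq_trans; apply: mm_gt0. Qed.

Lemma base_endE x : base_end K x = base_start K x + edge_dir (side x) *+ mm x.
Proof. by rewrite /base_end /base_start mulrnDr addrA. Qed.

Lemma lattice_dist_base x b : lattice_dist (side x) (q x b) = 0.
Proof. by case: b; apply: lattice_dist_edge. Qed.

Lemma cross_base (w : 'rV[int]_2) x :
  cross (q x false - w) (q x true - w) = (mm x)%:Z * lattice_dist (side x) w.
Proof.
rewrite /= base_endE /lattice_dist.
have -> : cross (base_start K x - w) (base_start K x + edge_dir (side x) *+ mm x - w)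
  = cross (edge_dir (side x) *+ mm x) (w - base_start K x).
  rewrite /cross !mxE; ring.
rewrite crossMnl mulrC; congr (_ * _); rewrite /base_start.
rewrite opprD addrA [RHS](_ : _ = cross (edge_dir (side x)) (w - vert (side x))
   - cross (edge_dir (side x)) (edge_dir (side x) *+ cut_off K x)).
  by rewrite -crossBr.
by rewrite crossMnr crossvv mul0r subr0.
Qed.

Lemma tri_gt0 x : 0 < cross (emb (q x false) - emb p) (emb (q x true) - emb p).
Proof.
rewrite -!embB cross_emb ltr0z cross_base; case: (Hg) => _ _ _ -> _.
by rewrite mulr_gt0 // ltz_nat ?cc_gt0 // (mm_gt0 Hp).
Qed.

Lemma tri_neq0 x b : cross (emb (q x b) - emb p) (emb (q x (~~ b)) - emb p) != 0.
Proof.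
case: b; last exact: lt0r_neq0 (tri_gt0 x).
by rewrite crossC oppr_eq0; apply: lt0r_neq0 (tri_gt0 x).
Qed.

Lemma apex_dist x : lattice_dist (side x) (apex x) = (mm x)%:Z.
Proof. by case: H => _ _ [_ _ /(_ x)[]]. Qed.

Lemma dtri_gt0 x :
  0 < cross (emb (q x false) - emb (apex x)) (emb (q x true) - emb (apex x)).
Proof.
rewrite -!embB cross_emb ltr0z cross_base apex_dist.
by rewrite mulr_gt0 // ltz_nat (mm_gt0 Hp).
Qed.

Lemma dtri_neq0 x b :
  cross (emb (q x b) - emb (apex x)) (emb (q x (~~ b)) - emb (apex x)) != 0.
Proof.
case: b; last exact: lt0r_neq0 (dtri_gt0 x).
by rewrite crossC oppr_eq0; apply: lt0r_neq0 (dtri_gt0 x).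
Qed.

Lemma tco_p x b : af (tco x b) (emb p) = 0.
Proof. by rewrite tco_def bary_o. Qed.

Lemma tco_q x b b' : af (tco x b) (emb (q x b')) = (b == b')%:R.
Proof.
have [<-|] := eqVneq b b'; first by rewrite tco_def bary_a // tri_neq0.
by rewrite tco_def; case: b b' => [] [] //= _; rewrite bary_b.
Qed.

Lemma dco_apex x b : af (dco x b) (emb (apex x)) = 0.
Proof. by rewrite dco_def bary_o. Qed.

Lemma dco_q x b b' : af (dco x b) (emb (q x b')) = (b == b')%:R.
Proof.
have [<-|] := eqVneq b b'; first by rewrite dco_def bary_a // dtri_neq0.
by rewrite dco_def; case: b b' => [] [] //= _; rewrite bary_b.
Qed.

Lemma tcoP x b z : z = emb p + af (tco x b) z *: (emb (q x b) - emb p)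
  + af (tco x (~~ b)) z *: (emb (q x (~~ b)) - emb p).
Proof. by rewrite !tco_def negbK; apply/baryP/tri_neq0. Qed.

Lemma dcoP x b z : z = emb (apex x) + af (dco x b) z *: (emb (q x b) - emb (apex x))
  + af (dco x (~~ b)) z *: (emb (q x (~~ b)) - emb (apex x)).
Proof. by rewrite !dco_def negbK; apply/baryP/dtri_neq0. Qed.

Lemma lev_p x : af (lev x) (emb p) = 0.
Proof. by rewrite lev_def afD !tco_p addr0. Qed.

Lemma lev_q x b : af (lev x) (emb (q x b)) = 1.
Proof. by rewrite lev_def afD !tco_q; case: b; rewrite ?addr0 ?add0r. Qed.

Lemma levE x b z : af (lev x) z = af (tco x b) z + af (tco x (~~ b)) z.
Proof. by rewrite lev_def afD; case: b; rewrite // addrC. Qed.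

Lemma dlevE x b z : af (dlev x) z = af (dco x b) z + af (dco x (~~ b)) z.
Proof. by rewrite dlev_def afD; case: b; rewrite // addrC. Qed.

(** Both sides agree at [p] and at the ends of the base. Consequently the level is at most 1 on the
    whole polygon. *)
Lemma lev_side x z :
  af (side_form (side x)) z = (cc (side x))%:R * (1 - af (lev x) z).
Proof.
have -> : side_form (side x) = (cc (side x))%:R *: (afc 1 - lev x).
  apply: (af_eq3 (lt0r_neq0 (tri_gt0 x))); rewrite afZ afB af_c.
  - by rewrite lev_p side_formE subr0 mulr1; case: (Hg) => _ _ _ -> _.
  - by rewrite lev_q side_formE lattice_dist_base subrr mulr0.
  - by rewrite lev_q side_formE lattice_dist_base subrr mulr0.
by rewrite afZ afB af_c.
Qed.

Lemma lev_apex x : af (lev x) (emb (apex x)) = lev0 x.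
Proof.
have := lev_side x (emb (apex x)); rewrite side_formE apex_dist /lev0.
have c0 : (cc (side x))%:R != 0 :> R by rewrite pnatr_eq0 -lt0n cc_gt0.
move=> e; have -> : (mm x)%:R = (mm x)%:Z%:~R :> R by [].
by rewrite e mulrAC divff // mul1r; ring.
Qed.

Lemma lev0_ge0 x : 0 <= lev0 x.
Proof.
rewrite subr_ge0 ler_pdivrMr ?ltr0n ?cc_gt0 // mul1r ler_nat.
by case: (Hg) => _ _ _ _.
Qed.

Lemma lev0_lt1 x : lev0 x < 1.
Proof. by rewrite gtrDl oppr_lt0 divr_gt0 // ltr0n ?cc_gt0 // (mm_gt0 Hp). Qed.

Lemma lev_dlev x z : af (lev x) z = lev0 x + (1 - lev0 x) * af (dlev x) z.
Proof.
have -> : lev x = afc (lev0 x) + (1 - lev0 x) *: dlev x.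
  apply: (af_eq3 (lt0r_neq0 (dtri_gt0 x))); rewrite afD af_c afZ.
  - by rewrite lev_apex (dlevE x true) !dco_apex addr0 mulr0 addr0.
  - by rewrite lev_q (dlevE x true) !dco_q /= add0r mulr1; ring.
  - by rewrite lev_q (dlevE x true) !dco_q /= addr0 mulr1; ring.
by rewrite afD af_c afZ.
Qed.

Lemma base_polygon x b : momentum_polygon X (emb (q x b)).
Proof.
case: H => _ _ [/(_ x) hx _ _]; case: b; apply: (side_polygon H) => //.
exact: leq_trans (leq_addr _ _) hx.
Qed.

Lemma big_triangleP x z : big_triangle K x z <->
  [/\ 0 <= af (tco x false) z, 0 <= af (tco x true) z & af (lev x) z <= 1].
Proof. by rewrite lev_def afD !tco_def; apply/bary_triangle/(tri_neq0 x false). Qed.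

Lemma cut_triangleP x z : cut_triangle K x z <->
  [/\ 0 <= af (dco x false) z, 0 <= af (dco x true) z & af (dlev x) z <= 1].
Proof. by rewrite dlev_def afD !dco_def; apply/bary_triangle/(dtri_neq0 x false). Qed.

Lemma apex_tco_ge0 x b : 0 <= af (tco x b) (emb (apex x)).
Proof.
have : big_triangle K x (emb (apex x)) by case: H => _ _ [_ _ /(_ x)[]].
by move=> /big_triangleP[]; case: b.
Qed.

Lemma cut_sub_big x z : cut_triangle K x z -> big_triangle K x z.
Proof.
apply: hull_hull => _ /mapP[v + ->]; rewrite !inE => /or3P[] /eqP->.
- by apply: hull_mem; rewrite /= !inE eqxx.
- by apply: hull_mem; rewrite /= !inE eqxx ?orbT.
- by case: H => _ _ [_ _ /(_ x)[]].
Qed.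

Lemma big_sub_polygon x z : big_triangle K x z -> momentum_polygon X z.
Proof.
apply: hull_hull => _ /mapP[v + ->]; rewrite !inE => /or3P[] /eqP->.
- exact: (base_polygon x false).
- exact: (base_polygon x true).
- exact: (base_pt_polygon H).
Qed.

Lemma cut_sub_polygon x z : cut_triangle K x z -> momentum_polygon X z.
Proof. by move=> /cut_sub_big/big_sub_polygon. Qed.

End Triangles.

(** * Interior edges and standard cells *)

Lemma llen_dvd (u : 'rV[int]_2) (k : 'I_2) : ((llen u)%:Z %| u 0%R k)%Z.
Proof.
rewrite dvdzE /=; case: k => [[|[|//]] hk].
  by rewrite (_ : Ordinal hk = 0) ?dvdn_gcdl //; apply/val_inj.
by rewrite (_ : Ordinal hk = 1) ?dvdn_gcdr //; apply/val_inj.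
Qed.

Lemma dvd_llen d (u : 'rV[int]_2) : (forall k : 'I_2, (d%:Z %| u 0%R k)%Z) -> (d %| llen u)%N.
Proof. by move=> h; rewrite dvdn_gcd; have := h 0; have := h 1; rewrite !dvdzE /= => -> ->. Qed.

Lemma grid_interval (R : realType) n (s : R) : 0 < s -> s <= 1 -> (0 < n)%N ->
  exists2 k, (k < n)%N & k%:R / n%:R < s <= k.+1%:R / n%:R.
Proof.
move=> s0 s1 n0; have n0' : 0 < n%:R :> R by rewrite ltr0n.
have ex : exists k, s * n%:R <= k.+1%:R.
  by exists n.-1; rewrite prednK // -[X in _ <= X]mul1r ler_pM2r.
case: (ex_minnP ex) => k hk mink; exists k.
  have : s * n%:R <= n.-1.+1%:R by rewrite prednK // -[X in _ <= X]mul1r ler_pM2r.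
  by move=> /mink; lia.
rewrite ltr_pdivrMr // ler_pdivlMr // hk andbT ltNge; apply/negP.
case: k hk mink => [|k] hk mink; first by rewrite leNgt mulr_gt0.
by move=> /mink; rewrite ltnn.
Qed.

Section Edges.
Variables (R : realType) (X : toric_model R) (K : cut_data X).
Hypothesis H : cut_model K.
Local Notation emb := (emb R).
Implicit Types (x y : exc X) (z : 'rV[R]_2) (b : bool).

Local Notation apex := (cut_apex K).
Local Notation deg := (int_edge_len K).
Local Notation q := (base_vtx K).

(** The length of an interior edge divides the lattice distance [mm x] from the apex to the side,
    hence the base vector, hence the other interior edge. *)
Lemma llen_interior_edge x b : llen (q x b - apex x) = deg x.
Proof.
have dm b' : (llen (q x b' - apex x) %| mm x)%N.
  suff : ((llen (q x b' - apex x))%:Z %| (mm x)%:Z)%Z by rewrite dvdzE.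
  have -> : (mm x)%:Z = - cross (edge_dir (side x)) (q x b' - apex x).
    rewrite -(apex_dist H) -[LHS]subr0 -(lattice_dist_base K x b') /lattice_dist.
    rewrite -crossBr opprB addrA subrK [RHS](_ : _ = cross (edge_dir (side x)) (- (q x b' - apex x))).
      by rewrite opprB.
    by rewrite /cross !mxE; ring.
  by rewrite rpredN rpredB // dvdz_mull // llen_dvd.
have dd b' : (llen (q x b' - apex x) %| llen (q x (~~ b') - apex x))%N.
  apply: dvd_llen => k; have := llen_dvd (q x b' - apex x) k.
  have : ((llen (q x b' - apex x))%:Z %| (edge_dir (side x) *+ mm x) 0%R k)%Z.
    by rewrite mulmxnE -mulr_natr natz dvdz_mull // dvdzE /= dm.
  have e : q x true - apex x = q x false - apex x + edge_dir (side x) *+ mm x.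
    by rewrite /= (base_endE K) addrAC.
  case: b' => h1 h2 /=; last by rewrite -/(q x true) e mxE rpredD.
  have -> : base_start K x - apex x = q x true - apex x - edge_dir (side x) *+ mm x.
    by rewrite e addrK.
  by rewrite mxE rpredD // mxE rpredN.
by case: b => //; apply/eqP; rewrite eqn_dvd (dd true) (dd false).
Qed.

Lemma deg_gt0 x : (0 < deg x)%N.
Proof.
rewrite lt0n; apply/negP => /eqP; rewrite /int_edge_len => d0.
have /negP := dtri_neq0 H x false; apply.
have u0 (k : 'I_2) : (base_start K x - apex x) 0 k = 0.
  by have := llen_dvd (base_start K x - apex x) k; rewrite d0 dvd0z => /eqP.
rewrite /= -!embB cross_emb intr_eq0 {1}/cross.
by rewrite (u0 0) (u0 1) !mul0r subrr.
Qed.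

Definition edge_vec x b : 'rV[int]_2 :=
  map_mx (fun t : int => (t %/ (llen (q x b - apex x))%:Z)%Z) (q x b - apex x).

Definition edge_pt x b k : 'rV[int]_2 := apex x + edge_vec x b *+ k.

Lemma edge_vec_deg x b : edge_vec x b *+ deg x = q x b - apex x.
Proof.
by rewrite -(llen_interior_edge x b) -edge_scale // llen_interior_edge deg_gt0.
Qed.

Lemma degR_neq0 x : (deg x)%:R != 0 :> R.
Proof. by rewrite pnatr_eq0 -lt0n deg_gt0. Qed.

Lemma edge_ptE x b k : emb (edge_pt x b k) = int_edge_pt K x (q x b) k.
Proof.
rewrite /int_edge_pt -embB -edge_vec_deg embD !embMn scalerA; congr (_ + _ *: _).
by rewrite divfK // degR_neq0.
Qed.

Lemma edge_pt0 x b : edge_pt x b 0 = apex x.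
Proof. by rewrite /edge_pt mulr0n addr0. Qed.

Lemma edge_pt_deg x b : edge_pt x b (deg x) = q x b.
Proof. by rewrite /edge_pt edge_vec_deg addrC subrK. Qed.

Lemma af_edge_pt l x b k : af l (emb (edge_pt x b k)) =
  (1 - k%:R / (deg x)%:R) * af l (emb (apex x)) + k%:R / (deg x)%:R * af l (emb (q x b)).
Proof.
rewrite edge_ptE /int_edge_pt; move: (_ / _) => t.
rewrite !afE /dot !mxE; ring.
Qed.

Lemma dco_edge_pt x b b' k :
  af (dco K x b') (emb (edge_pt x b k)) = (b' == b)%:R * (k%:R / (deg x)%:R).
Proof. by rewrite af_edge_pt dco_apex mulr0 add0r dco_q // mulrC. Qed.

Lemma dlev_edge_pt x b k : af (dlev K x) (emb (edge_pt x b k)) = k%:R / (deg x)%:R.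
Proof.
by rewrite (dlevE K x b) !dco_edge_pt eqxx mul1r; case: b; rewrite mul0r addr0.
Qed.

Lemma edge_pt_lattice x b (v : 'rV[int]_2) : 0 <= af (dco K x b) (emb v) <= 1 ->
  af (dco K x (~~ b)) (emb v) = 0 -> exists2 k, (k <= deg x)%N & v = edge_pt x b k.
Proof.
move=> /andP[s0 s1] r0; set s := af _ _ in s0 s1.
have e : emb (v - apex x) = s *: emb (q x b - apex x).
  rewrite !embB {1}(dcoP H x b (emb v)) r0 scale0r addr0 -/s.
  by rewrite addrC addKr.
have [|k hk] := primitive_multiple _ e; first by rewrite llen_interior_edge deg_gt0.
rewrite llen_interior_edge in hk.
have d0 : 0 < (deg x)%:R :> R by rewrite ltr0n deg_gt0.
have k0 : 0 <= k by rewrite -(ler0z R) -hk mulr_ge0 // ltW.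
case: k k0 hk => // k _ hk; exists k.
  by rewrite -(ler_nat R) -[X in X <= _]hk ger_pMl.
apply: (@emb_inj R); rewrite edge_ptE /int_edge_pt -embB -[_%:R]hk mulfK ?degR_neq0 //.
by rewrite -e embB addrC subrK.
Qed.

Definition core x : seq 'rV[int]_2 :=
  [seq edge_pt x b k | b <- [:: false; true], k <- iota 0 (deg x).+1].

Lemma coreP x v : reflect (exists b, exists2 k, (k <= deg x)%N & v = edge_pt x b k)
  (v \in core x).
Proof.
apply: (iffP allpairsP) => [[[b k] [_ hk ->]]|[b [k kd ->]]].
  by exists b, k => //; rewrite mem_iota in hk; rewrite -ltnS.
by exists (b, k); split=> //; [case: b | rewrite mem_iota ltnS].
Qed.

Definition std_corners x k : seq 'rV[int]_2 :=
  [:: edge_pt x false k; edge_pt x false k.+1; edge_pt x true k; edge_pt x true k.+1].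

Lemma standard_cellE x k : standard_cell K x k = hull (map emb (std_corners x k)).
Proof. by rewrite /standard_cell /= !edge_ptE. Qed.

(* A point of the k-th strip is a convex combination of the points of the two
   interior edges at the same height, which are in turn convex combinations of the
   corners. *)
Lemma strip_conv x k z (s := af (dlev K x) z) (r := s * (deg x)%:R - k%:R) :
  s != 0 -> z =
    (af (dco K x false) z / s) *:
      (r *: emb (edge_pt x false k.+1) + (1 - r) *: emb (edge_pt x false k))
    + (1 - af (dco K x false) z / s) *:
      (r *: emb (edge_pt x true k.+1) + (1 - r) *: emb (edge_pt x true k)).
Proof.
move=> s0; rewrite !edge_ptE /int_edge_pt {1}(dcoP H x false z).
have -> : af (dco K x (~~ false)) z = s - af (dco K x false) z.
  by rewrite /s (dlevE K x false); ring.
have := degR_neq0 x; rewrite {}/r -natr1; move: s s0 (af (dco _ _ _) _) => s s0 t d0.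
by apply: row2P; rewrite !mxE /=; field; rewrite s0 d0.
Qed.

Lemma standard_cellP x k z : (k < deg x)%N -> standard_cell K x k z <->
  [/\ 0 <= af (dco K x false) z, 0 <= af (dco K x true) z
    & k%:R / (deg x)%:R <= af (dlev K x) z <= k.+1%:R / (deg x)%:R].
Proof.
move=> kd; have d0 : 0 < (deg x)%:R :> R by rewrite ltr0n deg_gt0.
have k0 : 0 <= k%:R / (deg x)%:R :> R by rewrite divr_ge0 // ltW.
have kk : k%:R / (deg x)%:R <= k.+1%:R / (deg x)%:R :> R by rewrite ler_pM2r ?invr_gt0 // ler_nat.
rewrite standard_cellE; split=> [hz|[t0 t1 /andP[s0 s1]]].
  have pos l : (forall b, 0 <= af l (emb (edge_pt x b k)) /\ 0 <= af l (emb (edge_pt x b k.+1))) ->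
      0 <= af l z.
    move=> hl; have [|//] := hull_face (l := l) hz.
    move=> _ /mapP[w + ->]; rewrite !inE => /or4P[] /eqP->;
      by have [] := hl true; have [] := hl false.
  have posd b' : 0 <= af (dco K x b') z.
    apply: pos => b; rewrite !dco_edge_pt.
    by split; apply: mulr_ge0; rewrite ?ler0n // divr_ge0 // ltW.
  split=> //; apply/andP; split.
    have : 0 <= af (dlev K x - afc (k%:R / (deg x)%:R)) z.
      by apply: pos => b; rewrite !afB !af_c !dlev_edge_pt; lra.
    by rewrite afB af_c; lra.
  have : 0 <= af (afc (k.+1%:R / (deg x)%:R) - dlev K x) z.
    by apply: pos => b; rewrite !afB !af_c !dlev_edge_pt; lra.
  by rewrite afB af_c; lra.
have hm w : w \in std_corners x k -> hull (map emb (std_corners x k)) (emb w).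
  by move=> hw; apply/hull_mem/map_f.
have st : af (dlev K x) z = af (dco K x false) z + af (dco K x true) z := dlevE K x false z.
(* [strip_conv] divides by the level, so the apex is treated apart. *)
have [s00|sn0] := eqVneq (af (dlev K x) z) 0.
  have [f0 tt0] : af (dco K x false) z = 0 /\ af (dco K x true) z = 0 by lra.
  have k00 : k = 0%N.
    apply/eqP; rewrite -(eqr_nat R) -(mulIr_eq0 _ (mulIf (invr_neq0 (degR_neq0 x)))).
    by rewrite eq_le k0 andbT -s00.
  have -> : z = emb (edge_pt x false k).
    by rewrite k00 edge_pt0 {1}(dcoP H x false z) f0 tt0 !scale0r !addr0.
  by apply: hm; rewrite inE eqxx.
rewrite (strip_conv k sn0); set r := _ * _ - _.
have r0 : 0 <= r by rewrite subr_ge0 -ler_pdivrMr.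
have r1 : r <= 1 by rewrite lerBlDr -ler_pdivlMr // addrC natr1.
have sp : 0 < af (dlev K x) z by rewrite lt_def sn0 (le_trans k0).
apply: hull_conv; [by rewrite divr_ge0 // ltW | by rewrite ler_pdivrMr // mul1r; lra | |];
  by apply: hull_conv => //; apply: hm; rewrite !inE eqxx ?orbT.
Qed.

Lemma cut_triangle_cells x : cut_triangle K x = \bigcup_(S in standard_cells K x) S.
Proof.
have d0 : 0 < (deg x)%:R :> R by rewrite ltr0n deg_gt0.
apply/seteqP; split=> z.
  move=> /(cut_triangleP H)[t0 t1 s1].
  have s0 : 0 <= af (dlev K x) z by rewrite (dlevE K x false) addr_ge0.
  have [k kd hk] : exists2 k, (k < deg x)%N &
      k%:R / (deg x)%:R <= af (dlev K x) z <= k.+1%:R / (deg x)%:R.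
    move: s0; rewrite le_eqVlt => /orP[/eqP<-|s0].
      by exists 0%N; rewrite ?deg_gt0 // mul0r lexx divr_ge0 // ltW.
    have [k kd /andP[h1 h2]] := grid_interval s0 s1 (deg_gt0 x).
    by exists k => //; rewrite (ltW h1).
  by exists (standard_cell K x k); [exists k | apply/standard_cellP].
move=> [_ [k /= kd <-] /(standard_cellP z kd)[t0 t1 /andP[_ s1]]].
apply/(cut_triangleP H); split=> //; apply: le_trans s1 _.
by rewrite ler_pdivrMr // mul1r ler_nat.
Qed.

End Edges.

(** * The fan through the base point *)

Section Norm.
Variable R : realType.
Implicit Types (a b : 'rV[R]_2).

Definition enorm a : R := Num.sqrt (dot a a).

Lemma dot_ge0 a : 0 <= dot a a.
Proof. by rewrite /dot -!expr2 addr_ge0 ?sqr_ge0. Qed.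

Lemma enorm_sqr a : enorm a ^+ 2 = dot a a.
Proof. exact/sqr_sqrtr/dot_ge0. Qed.

(** If the left side is nonnegative, [s] and [r] have opposite signs, and the strict Cauchy-Schwarz
    inequality compares the squares. This is what makes the leading function strictly convex across
    rays. *)
Lemma enorm_comb_lt a b (s r : R) : cross a b != 0 -> s < 0 \/ r < 0 ->
  s * enorm a + r * enorm b < enorm (s *: a + r *: b).
Proof.
move=> d sr; have [neg|pos] := ltP (s * enorm a + r * enorm b) 0.
  exact: lt_le_trans neg (sqrtr_ge0 _).
have A0 : 0 <= enorm a := sqrtr_ge0 _; have B0 : 0 <= enorm b := sqrtr_ge0 _.
have cs : dot a b < enorm a * enorm b.
  have [n|p] := ltP (dot a b) 0; first by apply: lt_le_trans n _; rewrite mulr_ge0.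
  rewrite -(ltr_pXn2r (n := 2)) ?nnegrE ?mulr_ge0 // exprMn !enorm_sqr.
  have -> : dot a a * dot b b = dot a b ^+ 2 + cross a b ^+ 2.
    by rewrite /dot /cross; ring.
  by rewrite ltrDl lt_def sqrf_eq0 d sqr_ge0.
have A1 : 0 < enorm a.
  rewrite lt_def A0 andbT; apply: contra d => /eqP a0.
  have := enorm_sqr a; rewrite a0 expr0n /= /dot => /esym/eqP.
  rewrite -!expr2 paddr_eq0 ?sqr_ge0 // !sqrf_eq0 => /andP[/eqP e0 /eqP e1].
  by rewrite /cross e0 e1 !mul0r subrr.
have B1 : 0 < enorm b.
  rewrite lt_def B0 andbT; apply: contra d => /eqP b0.
  have := enorm_sqr b; rewrite b0 expr0n /= /dot => /esym/eqP.
  rewrite -!expr2 paddr_eq0 ?sqr_ge0 // !sqrf_eq0 => /andP[/eqP e0 /eqP e1].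
  by rewrite /cross e0 e1 !mulr0 subrr.
have sr0 : s * r < 0.
  case: sr => n.
    have r0 : 0 < r * enorm b.
      by have : s * enorm a < 0; [rewrite pmulr_llt0|lra].
    by rewrite nmulr_rlt0 //; move: r0; rewrite pmulr_lgt0.
  have s0 : 0 < s * enorm a.
    by have : r * enorm b < 0; [rewrite pmulr_llt0|lra].
  by rewrite nmulr_llt0 //; move: s0; rewrite pmulr_lgt0.
rewrite -(ltr_pXn2r (n := 2)) ?nnegrE ?sqrtr_ge0 // enorm_sqr.
have -> : dot (s *: a + r *: b) (s *: a + r *: b) =
    s ^+ 2 * dot a a + r ^+ 2 * dot b b + (s * r) * dot a b *+ 2.
  by rewrite /dot !mxE; ring.
have -> : (s * enorm a + r * enorm b) ^+ 2 =
    s ^+ 2 * dot a a + r ^+ 2 * dot b b + (s * r) * (enorm a * enorm b) *+ 2.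
  by rewrite -!enorm_sqr; ring.
by rewrite ltrD2l ltrMn2r /= ltr_nM2l.
Qed.

End Norm.

Section Fan.
Variables (R : realType) (X : toric_model R) (K : cut_data X).
Hypothesis H : cut_model K.
Local Notation emb := (emb R).
Implicit Types (i k : 'I_(nsides X)) (x y : exc X) (z : 'rV[R]_2) (b : bool)
  (W : 'rV[int]_2 -> R).

Let Hg : good_toric_model X. Proof. by case: H. Qed.
Let Hp : polarized X. Proof. by case: H. Qed.

Local Notation q := (base_vtx K).
Local Notation off := (cut_off K).

Definition base_off x b : nat := if b then (off x + mm x)%N else off x.

Lemma base_vtxE x b : q x b = vert (side x) + edge_dir (side x) *+ base_off x b.
Proof. by case: b. Qed.

Lemma ordS_inj : injective (@ordS (nsides X)).
Proof. exact: can_inj (@ordSK _). Qed.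

Lemma lattice_dist_lin k (v w : 'rV[int]_2) n :
  lattice_dist k (v + w *+ n) = lattice_dist k v + cross (edge_dir k) w * n%:Z.
Proof.
rewrite /lattice_dist (addrAC v) -[w *+ n]opprK crossBr -crossMnr.
rewrite [cross _ (- _)](_ : _ = - cross (edge_dir k) (w *+ n)) ?opprK //.
by rewrite /cross !mxE; ring.
Qed.

Lemma side_two i k : lattice_dist k (vert i) = 0 ->
  lattice_dist k (vert (ordS i)) = 0 -> i = k.
Proof.
move=> e1 e2; apply/eqP/negPn/negP => ik.
have iS : i = ordS k.
  apply/eqP/negPn/negP => iS; have := lattice_dist_gt0 H ik iS.
  by rewrite e1 ltxx.
have [e|n1] := eqVneq (ordS i) k.
  by have := ordS2_neq Hg k; rewrite -iS e eqxx.
have [/ordS_inj e|n2] := eqVneq (ordS i) (ordS k); first by rewrite e eqxx in ik.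
by have := lattice_dist_gt0 H n1 n2; rewrite e2 ltxx.
Qed.

(** The distance to side [k] is affine and nonnegative along side [i], so a zero at an inner point
    would give zeros at both ends, against [side_two]. *)
Lemma side_meet i k n : (n <= llen (edge i))%N -> k != i ->
  lattice_dist k (vert i + edge_dir i *+ n) = 0 ->
  (n = 0%N /\ i = ordS k) \/ (n = llen (edge i) /\ k = ordS i).
Proof.
move=> hn ki e; have A0 := lattice_dist_ge0 H k i.
have B0 := lattice_dist_ge0 H k (ordS i).
have eB : lattice_dist k (vert (ordS i)) =
    lattice_dist k (vert i) + cross (edge_dir k) (edge_dir i) * (llen (edge i))%:Z.
  by rewrite (vert_ordS Hg) lattice_dist_lin.
have eq : lattice_dist k (vert i) * (llen (edge i) - n)%N%:Z
    + lattice_dist k (vert (ordS i)) * n%:Z = 0.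
  move: e; rewrite lattice_dist_lin eB => e.
  rewrite -subzn // -[X in _ = X](mul0r (llen (edge i))%:Z) -{1}e; ring.
move/eqP: eq; rewrite paddr_eq0 ?mulr_ge0 // !mulf_eq0 => /andP[].
move=> /orP[/eqP a0|n1].
  move=> /orP[/eqP b0|n0].
    by move: ki; rewrite (side_two a0 b0) eqxx.
  left; split; first by move: n0; lia.
  apply/eqP/negPn/negP => iS; have := @lattice_dist_gt0 _ _ _ H k i.
  by rewrite a0 ltxx eq_sym ki iS => /(_ isT isT).
move=> b0; right; have en : n = llen (edge i) by move: n1; lia.
split=> //; have [e0|] := eqVneq n 0%N.
  by have := (cross_dir_edge Hg i 0).2; rewrite -en e0.
move=> nn; move: b0; rewrite (_ : (n%:Z == 0) = false) ?orbF; last by lia.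
move=> /eqP b0; apply/eqP; rewrite eq_sym; apply/negPn/negP => ne.
have [/ordS_inj e1|n2] := eqVneq (ordS i) (ordS k); first by rewrite e1 eqxx in ki.
by have := lattice_dist_gt0 H ne n2; rewrite b0 ltxx.
Qed.

Lemma base_off_le x b : (base_off x b <= llen (edge (side x)))%N.
Proof. by case: H => _ _ [/(_ x) h _ _]; case: b => //=; lia. Qed.

Lemma edge_dir_neq0 i : edge_dir i != 0.
Proof.
apply/eqP => e; have := cone_index_gt0 Hg i.
by rewrite e /cross !mxE !mul0r subrr ltxx.
Qed.

Lemma edge_dir_inj i : injective (fun n => vert i + edge_dir i *+ n).
Proof.
move=> n m /addrI e; have [nm|mn] := leqP n m.
  have : edge_dir i *+ (m - n) = 0 by rewrite mulrnBr // e subrr.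
  move=> /rowP z; apply/eqP; rewrite eqn_leq nm /= -subn_eq0; apply/negPn/negP => d.
  case/eqP: (edge_dir_neq0 i); apply/rowP => k; have := z k.
  by rewrite mulmxnE [RHS]mxE => /eqP; rewrite mulrn_eq0 (negbTE d) => /eqP ->; rewrite [RHS]mxE.
have : edge_dir i *+ (n - m) = 0 by rewrite mulrnBr ?e ?subrr // ltnW.
move=> /rowP z; exfalso; case/eqP: (edge_dir_neq0 i); apply/rowP => k; have := z k.
rewrite mulmxnE [RHS]mxE => /eqP; rewrite mulrn_eq0 => /orP[|/eqP->]; last by rewrite [RHS]mxE.
by lia.
Qed.

Lemma base_vtx_sides x y b b' : q x b = q y b' ->
  [\/ side x = side y /\ base_off x b = base_off y b',
      [/\ base_off x b = 0%N, side x = ordS (side y)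
        & base_off y b' = llen (edge (side y))]
    | [/\ base_off y b' = 0%N, side y = ordS (side x)
        & base_off x b = llen (edge (side x))]].
Proof.
move=> e; have [s|ns] := eqVneq (side x) (side y).
  constructor 1; split=> //; apply: (@edge_dir_inj (side y)).
  by rewrite -base_vtxE -e base_vtxE s.
have ex : lattice_dist (side y) (vert (side x) + edge_dir (side x) *+ base_off x b) = 0.
  by rewrite -base_vtxE e lattice_dist_base.
have ey : lattice_dist (side x) (vert (side y) + edge_dir (side y) *+ base_off y b') = 0.
  by rewrite -base_vtxE -e lattice_dist_base.
have ns' : side y != side x by rewrite eq_sym.
have [[x0 xS]|[xl yS]] := side_meet (base_off_le x b) ns' ex.
  have [[y0 yS]|[yl _]] := side_meet (base_off_le y b') ns ey; last by constructor 2.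
  by have := ordS2_neq Hg (side x); rewrite -yS -xS eqxx.
have [[y0 _]|[yl xS]] := side_meet (base_off_le y b') ns ey; first by constructor 3.
by have := ordS2_neq Hg (side x); rewrite -yS -xS eqxx.
Qed.

Lemma bases_disjoint x y : x != y -> side x = side y ->
  (off x + mm x <= off y)%N \/ (off y + mm y <= off x)%N.
Proof. by case: H => _ _ [_ h _]; apply: h. Qed.

(** Bases have positive length and do not overlap. Hence a ray is the first, or the last, ray of at
    most one triangle. *)
Lemma base_vtx_inj x y b : q x b = q y b -> x = y.
Proof.
move=> e; apply/eqP/negPn/negP => xy; have mx := mm_gt0 Hp x; have my := mm_gt0 Hp y.
have bx b' := base_off_le x b'; have by' b' := base_off_le y b'.
have := bx true; have := by' true; have := bx false; have := by' false.
case: (base_vtx_sides e) => [[s]|[]|[]].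
- by have := bases_disjoint xy s; case: b {e} => /=; lia.
- case: b {e} => /= e1 _ e2; lia.
- case: b {e} => /= e1 _ e2; lia.
Qed.

Lemma base_side x k : lattice_dist k (q x false) = 0 ->
  lattice_dist k (q x true) = 0 -> side x = k.
Proof.
rewrite !base_vtxE => e2 e3; apply/eqP/negPn/negP => ns.
have ns' : k != side x by rewrite eq_sym.
have := side_meet (base_off_le x true) ns' e3.
have := side_meet (base_off_le x false) ns' e2.
have := base_off_le x true; have := mm_gt0 Hp x; rewrite /=.
move: (ordS2_neq Hg (side x)) (llen _) => s2 L {e2 e3 ns ns'} m0 ml.
case=> [[_ e]|[e4 _]]; last by lia.
case=> [[e5 _]|[_ e']]; first by lia.
by move: s2; rewrite -e' -e eqxx.
Qed.

Lemma base_off_gap x y b : side x = side y ->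
  ~ (off x < base_off y b < off x + mm x)%N.
Proof.
move=> ss; have [->|/bases_disjoint/(_ ss)] := eqVneq x y.
  by case: b => /=; lia.
by case: b => /=; lia.
Qed.

(** On one side the offsets contradict each other; on two sides, each would follow the other, which
    at least three sides exclude. *)
Lemma base_vtx_swap x y : q y false = q x true -> q y true = q x false -> False.
Proof.
move=> e e'; have mx := mm_gt0 Hp x; have my := mm_gt0 Hp y.
have := base_off_le x true; have := base_off_le y true => /=.
move: (base_vtx_sides e) (base_vtx_sides e') => /= h h'.
move: (llen (edge (side x))) (llen (edge (side y))) h h' => Lx Ly h h'.
have s1 := ordS_neq Hg (side y); have s1' := ordS_neq Hg (side x).
have s2 := ordS2_neq Hg (side x).
clear e e'; move=> hy hx.
case: h => [[h0 h]|[h1 h2 h3]|[h1 h2 h3]]; case: h' => [[h0' h']|[h1' h2' h3']|[h1' h2' h3']];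
  try (clear -mx my hx hy h h'; lia); try (clear -mx my hx hy h1 h3 h'; lia);
  try (clear -mx my hx hy h h1' h3'; lia); try (clear -mx my hx hy h1 h3 h1' h3'; lia).
all: try by rewrite -h2' h0 eqxx in s1.
all: try by rewrite -h2' -h0 eqxx in s1'.
all: try by rewrite -h2 h0' eqxx in s1.
all: try by rewrite -h2 -h0' eqxx in s1'.
all: try by rewrite -h2 -h2' eqxx in s2.
all: try by rewrite -h2' -h2 eqxx in s2.
Qed.

End Fan.

(** * Fan functions on the core *)

Section FanFunctions.
Variables (R : realType) (X : toric_model R) (K : cut_data X).
Hypothesis H : cut_model K.
Local Notation affine := ('rV[R]_2 * R^o)%type.
Local Notation emb := (emb R).
Implicit Types (x y : exc X) (z : 'rV[R]_2) (b : bool)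
  (W : 'rV[int]_2 -> R) (v : 'rV[int]_2) (l : affine).

Let Hg : good_toric_model X. Proof. by case: H. Qed.
Let Hp : polarized X. Proof. by case: H. Qed.

Local Notation p := (base_pt X).
Local Notation q := (base_vtx K).
Local Notation off := (cut_off K).
Local Notation tco := (tco K).
Local Notation lev := (lev K).
Local Notation core := (core K).

Lemma dist_p_sig : {f : 'rV[int]_2 -> R | forall v, f v = enorm (emb v - emb p)}.
Proof. by eexists. Qed.
Definition dist_p : 'rV[int]_2 -> R := sval dist_p_sig.
Lemma dist_pE v : dist_p v = enorm (emb v - emb p).
Proof. exact: (svalP dist_p_sig). Qed.

(** The fan function on T_x, extended to the whole plane so that the pieces of different triangles
    can be compared. *)
Lemma fan_sig : {f : ('rV[int]_2 -> R) -> exc X -> affine | forall W x,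
  f W x = W (q x false) *: tco x false + W (q x true) *: tco x true}.
Proof. by eexists. Qed.
Definition fan : ('rV[int]_2 -> R) -> exc X -> affine := sval fan_sig.

Lemma fanE W x b z : af (fan W x) z =
  W (q x b) * af (tco x b) z + W (q x (~~ b)) * af (tco x (~~ b)) z.
Proof. by rewrite [fan W x](svalP fan_sig) afD !afZ; case: b => //; rewrite addrC. Qed.

Lemma fan_p W x : af (fan W x) (emb p) = 0.
Proof. by rewrite (fanE W x true) !tco_p !mulr0 addr0. Qed.

Lemma fan_q W x b : af (fan W x) (emb (q x b)) = W (q x b).
Proof.
rewrite (fanE W x b) !tco_q // eqxx mulr1.
by case: b; rewrite mulr0 addr0.
Qed.

Lemma af_tco l x b z : af l z = (1 - af (lev x) z) * af l (emb p)
  + af (tco x b) z * af l (emb (q x b)) + af (tco x (~~ b)) z * af l (emb (q x (~~ b))).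
Proof.
rewrite {1}(tcoP H x b z) (levE K x b); move: (af (tco x b) z) (af _ z) => s r.
rewrite !afE /dot !mxE; ring.
Qed.

Lemma dist_p_gt0 v : v != p -> 0 < dist_p v.
Proof.
move=> vp; rewrite dist_pE lt_def sqrtr_ge0 andbT; apply: contra vp => /eqP e.
have := enorm_sqr (emb v - emb p); rewrite e expr0n /= /dot => /esym/eqP.
rewrite -!expr2 paddr_eq0 ?sqr_ge0 // !sqrf_eq0 => /andP[/eqP e0 /eqP e1].
by apply/eqP/(@emb_inj R)/eqP; rewrite -subr_eq0; apply/eqP/row2P; rewrite [RHS]mxE.
Qed.

Lemma base_vtx_neq_p x b : q x b != p.
Proof.
apply/eqP => e; have := lev_q H x b; rewrite e lev_p => /esym/eqP.
by rewrite oner_eq0.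
Qed.

(** Outside the cone of T_x this is [enorm_comb_lt]. A base vertex inside the cone is on the
    boundary of the polygon, hence on the base of T_x, of which it can only be an end. *)
Lemma fan_base_le x y b : af (fan dist_p x) (emb (q y b)) <= dist_p (q y b) /\
  (af (fan dist_p x) (emb (q y b)) = dist_p (q y b) -> exists b', q y b = q x b').
Proof.
set z := emb (q y b); set s := af (tco x false) z; set r := af (tco x true) z.
have ez : z - emb p = s *: (emb (q x false) - emb p) + r *: (emb (q x true) - emb p).
  by apply/eqP; rewrite subr_eq addrC addrA; apply/eqP/tcoP.
have lt : s < 0 \/ r < 0 -> af (fan dist_p x) z < dist_p (q y b).
  move=> sr; rewrite (fanE _ x false) mulrC [X in _ + X]mulrC !dist_pE -/z ez.
  by apply: enorm_comb_lt sr; apply: (tri_neq0 H x false).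
have [s0|s0] := ltP s 0.
  by have h := lt (or_introl s0); split; [exact: ltW | move=> e; rewrite e ltxx in h].
have [r0|r0] := ltP r 0.
  by have h := lt (or_intror r0); split; [exact: ltW | move=> e; rewrite e ltxx in h].
suff [b' e] : exists b', q y b = q x b'.
  by split; [rewrite /z e fan_q | exists b'].
have Pz : momentum_polygon X z := base_polygon H y b.
have lz : af (lev x) z = s + r by rewrite (levE K x false).
have sr1 : 0 <= 1 - (s + r).
  have := side_form_ge0 H (side x) Pz; rewrite (lev_side H) lz pmulr_rge0 //.
  by rewrite ltr0n (cc_gt0 H).
have l0 : af (side_form (side y)) z = 0 by rewrite side_formE lattice_dist_base.
(* The side form of [y] vanishes at the vertex, is nonnegative at the corners of T_x and positive at
   [p]: the weight of [p] is 0. *)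
have := af_tco (side_form (side y)) x false z; rewrite l0 lz -/s -/r.
have lp : 0 < af (side_form (side y)) (emb p).
  by rewrite side_formE; case: (Hg) => _ _ _ -> _; rewrite ltr0z ltz_nat (cc_gt0 H).
have lq b' : 0 <= af (side_form (side y)) (emb (q x b')).
  exact/(side_form_ge0 H)/(base_polygon H).
move=> /esym/eqP; rewrite paddr_eq0 ?addr_ge0 ?mulr_ge0 ?lq ?(ltW lp) //.
rewrite paddr_eq0 ?mulr_ge0 ?lq ?(ltW lp) // !mulf_eq0 (gt_eqF lp) orbF.
case/andP => /andP[/eqP e1 e2] e3.
have ez' : z = s *: emb (q x false) + r *: emb (q x true).
  have -> : z = emb p + (z - emb p) by rewrite addrC subrK.
  by rewrite ez; apply: row2P; rewrite !mxE; move: e1; nra.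
have [s00|sn] := eqVneq s 0.
  exists true; apply: (@emb_inj R); rewrite -/z ez' s00 scale0r add0r.
  by rewrite (_ : r = 1) ?scale1r //; lra.
have [r00|rn] := eqVneq r 0.
  exists false; apply: (@emb_inj R); rewrite -/z ez' r00 scale0r addr0.
  by rewrite (_ : s = 1) ?scale1r //; lra.
(* With both weights positive, the base of T_x is on the side of [y] and the vertex is strictly
   inside it, against [base_off_gap]. *)
exfalso; move: e2 e3; rewrite (negbTE sn) (negbTE rn) /= !side_formE !intr_eq0.
move=> /eqP e2 /eqP e3.
have ss : side x = side y by apply: (base_side H).
have := congr1 (fun w => w - emb (vert (side x))) ez'.
rewrite /z !base_vtxE -ss !embD !embMn => eo.
have {}eo : ((base_off K y b)%:R - ((off x)%:R + r * (mm x)%:R)) *: emb (edge_dir (side x)) = 0.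
  have s1 : s = 1 - r by lra.
  move: eo; rewrite s1 /= natrD => /rowP eo; apply/rowP => k; have := eo k.
  by rewrite !mxE; lra.
have d0 : emb (edge_dir (side x)) != 0.
  apply/eqP => e; case/eqP: (edge_dir_neq0 H (side x)); apply: (@emb_inj R); rewrite e.
  by apply/rowP => k; rewrite !mxE.
move/eqP: eo; rewrite scaler_eq0 (negbTE d0) orbF subr_eq0 => /eqP eo.
have m0 : 0 < (mm x)%:R :> R by rewrite ltr0n (mm_gt0 Hp).
have r1 : 0 < r by rewrite lt_def rn.
have s1 : 0 < s by rewrite lt_def sn.
have o1 : (off x < base_off K y b)%N by rewrite -(ltr_nat R) eo ltrDl mulr_gt0.
have o2 : (base_off K y b < off x + mm x)%N.
  by rewrite -(ltr_nat R) eo natrD ltrD2l gtr_pMl //; lra.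
by apply: (base_off_gap H ss (b := b)); rewrite o1.
Qed.

Lemma core_cut x v : v \in core x -> cut_triangle K x (emb v).
Proof.
move=> /coreP[b [k kd ->]]; apply/(cut_triangleP H).
have k0 : 0 <= k%:R / (int_edge_len K x)%:R :> R by rewrite divr_ge0.
rewrite !dco_edge_pt // dlev_edge_pt // ler_pdivrMr ?ltr0n ?(deg_gt0 H) //.
by split; [rewrite mulr_ge0 ?ler0n | rewrite mulr_ge0 ?ler0n | rewrite mul1r ler_nat].
Qed.

Lemma core_tco_ge0 x b v : v \in core x -> 0 <= af (tco x b) (emb v).
Proof. by move=> /core_cut/(cut_sub_big H)/(big_triangleP H)[]; case: b. Qed.

Lemma core_lev_le1 x v : v \in core x -> af (lev x) (emb v) <= 1.
Proof. by move=> /core_cut/(cut_sub_big H)/(big_triangleP H)[]. Qed.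

Lemma core_lev_ge x v : v \in core x -> lev0 x <= af (lev x) (emb v).
Proof.
move=> /core_cut/(cut_triangleP H)[d0 d1 _]; rewrite (lev_dlev H) lerDl mulr_ge0 //.
  by rewrite subr_ge0 ltW // (lev0_lt1 H).
by rewrite (dlevE K x false) addr_ge0.
Qed.

(* The intersection of two different triangles T_x and T_y is contained in their
   common side through p. *)
Definition adjacent_at x y b v : Prop :=
  q y b = q x (~~ b) /\ af (tco y (~~ b)) (emb v) = 0.

(** A core point of [y] has nonnegative coordinates in T_y, so [fan_base_le] applies at the two base
    ends. For [x] and [y] distinct, equality at both ends would make the triangles share two rays,
    against [base_vtx_swap]. *)
Lemma fan_core_le x y v : v \in core y ->
  af (fan dist_p x) (emb v) <= af (fan dist_p y) (emb v) /\
  (af (fan dist_p x) (emb v) = af (fan dist_p y) (emb v) ->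
   [\/ x = y, v = p | exists b, adjacent_at x y b v]).
Proof.
move=> vy; rewrite (af_tco (fan dist_p x) y false) fan_p mulr0 add0r.
rewrite (fanE dist_p y false) ![dist_p _ * _]mulrC.
have t b := core_tco_ge0 b vy.
have [le0 eq0] := fan_base_le x y false; have [le1 eq1] := fan_base_le x y true.
have m0 := ler_wpM2l (t false) le0; have m1 := ler_wpM2l (t true) le1.
split=> [|e]; first exact: lerD.
have [s0|sn] := eqVneq (af (tco y false) (emb v)) 0.
  have [r0|rn] := eqVneq (af (tco y true) (emb v)) 0.
    constructor 2; apply: (@emb_inj R).
    by rewrite (tcoP H y false (emb v)) s0 r0 !scale0r !addr0.
  have [|b' e'] := eq1.
    by apply: (mulfI rn); move: e; rewrite s0 !mul0r !add0r.
  have [->|xy] := eqVneq x y; first by constructor 1.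
  constructor 3; exists true; split=> //; rewrite e'.
  case: b' e' => // e'; first by move/eqP: xy; rewrite (base_vtx_inj H e').
have e0 : af (fan dist_p x) (emb (q y false)) = dist_p (q y false).
  by apply: (mulfI sn); apply/le_anti; rewrite m0 /=; move: e; lra.
have [b0 e0'] := eq0 e0.
have [->|xy] := eqVneq x y; first by constructor 1.
have b0t : b0 = true.
  by case: b0 e0' => // e0'; move/eqP: xy; rewrite (base_vtx_inj H e0').
rewrite b0t in e0'.
have [r0|rn] := eqVneq (af (tco y true) (emb v)) 0; first by constructor 3; exists false.
have [|b1 e1'] := eq1; first by apply: (mulfI rn); move: e; rewrite e0; lra.
have b1f : b1 = false.
  by case: b1 e1' => // e1'; move/eqP: xy; rewrite (base_vtx_inj H e1').
rewrite b1f in e1'; case: (base_vtx_swap H e0' e1').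
Qed.

Lemma adjacent_tco x y b v : adjacent_at x y b v ->
  [/\ af (tco x b) (emb v) = 0, af (tco x (~~ b)) (emb v) = af (tco y b) (emb v),
    af (lev x) (emb v) = af (lev y) (emb v)
  & forall W, af (fan W x) (emb v) = af (fan W y) (emb v)].
Proof.
move=> [e t0].
have t1 c : af (tco x c) (emb v) = af (tco y b) (emb v) * (c == ~~ b)%:R.
  by rewrite (af_tco _ y b) t0 tco_p e tco_q // mulr0 mul0r add0r addr0.
have tb : af (tco x b) (emb v) = 0 by rewrite t1; case: b {e t0 t1}; rewrite mulr0.
have tn : af (tco x (~~ b)) (emb v) = af (tco y b) (emb v) by rewrite t1 eqxx mulr1.
split=> //; first by rewrite !(levE K _ b) tb tn t0 add0r addr0.
by move=> W; rewrite !(fanE W _ b) tb tn t0 !mulr0 add0r addr0 e.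
Qed.

(** [fan_core_le] in both directions gives equality. Definitions made on each triangle are thus
    consistent on shared rays. *)
Lemma core_consistent x y v : v \in core x -> v \in core y ->
  [/\ af (lev x) (emb v) = af (lev y) (emb v),
    forall W, af (fan W x) (emb v) = af (fan W y) (emb v)
  & [\/ x = y, v = p | exists b, adjacent_at x y b v]].
Proof.
move=> vx vy; have [le1 eq1] := fan_core_le x vy; have [le2 _] := fan_core_le y vx.
have c : [\/ x = y, v = p | exists b, adjacent_at x y b v].
  by apply: eq1; apply/le_anti; rewrite le1.
split=> // [|W]; case: (c) => [->//|->|[b /adjacent_tco[]]//].
  by rewrite !lev_p.
by rewrite !fan_p.
Qed.

End FanFunctions.

(** * The potential *)

(** The step from [y] to [x] prescribes an increment 1, 0 or -1. The value at [x] counts the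
    increasing steps up to [x] and the decreasing steps after it, which keeps it a natural
    number. *)
Lemma exists_potential (T : finType) (succ le : rel T) (P Q : pred T) :
  (forall y x z, succ y x -> le z x = le z y || (z == x)) ->
  (forall y x, succ y x -> ~~ le x y) ->
  (forall y y' x, succ y x -> succ y' x -> y = y') ->
  exists E : T -> nat, forall y x, succ y x -> (E x + Q x = E y + P y)%N.
Proof.
move=> sle nle suniq.
pose up x := [exists y, succ y x && P y] && ~~ Q x.
pose down x := [exists y, succ y x && ~~ P y] && Q x.
exists (fun x => \sum_(z | le z x) up z + \sum_(z | ~~ le z x) down z)%N => y x yx.
have ux : up x = P y && ~~ Q x.
  congr (_ && _); apply/existsP/idP => [[y' /andP[/suniq/(_ yx)->]]//|Py].
  by exists y; rewrite yx.
have dx : down x = ~~ P y && Q x.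
  congr (_ && _); apply/existsP/idP => [[y' /andP[/suniq/(_ yx)->]]//|Py].
  by exists y; rewrite yx.
have xx : le x x by rewrite (sle y x x yx) eqxx orbT.
have lyx := nle y x yx.
rewrite /= (bigD1 x (P := fun z => le z x)) //= [in RHS](bigD1 x (P := fun z => ~~ le z y)) //= ux dx.
rewrite (eq_bigl (fun z => le z y)); last first.
  move=> z; rewrite (sle y x z yx); have [->|] := eqVneq z x; rewrite ?orbF ?andbT //.
  by rewrite andbF (negbTE lyx).
rewrite [X in (_ + _ + X + _ = _)%N](eq_bigl (fun z => ~~ le z y && (z != x))); last first.
  by move=> z; rewrite (sle y x z yx) negb_or.
by case: (P y) (Q x) => [] [] /=; lia.
Qed.

Lemma sum_interval a m n : (\sum_(o < n) (a <= o < a + m) <= m)%N.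
Proof.
suff : (\sum_(o < n) (a <= o < a + m) <= minn n (a + m) - minn n a)%N by lia.
elim: n => [|n ih]; first by rewrite big_ord0.
rewrite big_ord_recr /=; move: ih; move: (\sum_(_ < n) _)%N => S.
by case: (leqP a n) => h1; case: (ltnP n (a + m)) => h2 /=; lia.
Qed.

Section Potential.
Variables (R : realType) (X : toric_model R) (K : cut_data X).
Hypothesis H : cut_model K.
Local Notation emb := (emb R).
Implicit Types (x y z : exc X) (b : bool) (v : 'rV[int]_2) (i : 'I_(nsides X)).

Let Hg : good_toric_model X. Proof. by case: H. Qed.
Let Hp : polarized X. Proof. by case: H. Qed.

Local Notation q := (base_vtx K).
Local Notation off := (cut_off K).
Local Notation tco := (tco K).
Local Notation lev := (lev K).
Local Notation core := (core K).

(** If all unit segments of the side given by [gap_side] were covered, counting them would bound its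
    length by the sum of the [mm x]. *)
Lemma gap_unit : exists i o, (o < llen (edge i))%N /\
  forall x, side x = i -> (o < off x)%N \/ (off x + mm x <= o)%N.
Proof.
have [i hi] := gap_side Hg Hp; exists i.
have [o] : exists o : 'I_(llen (edge i)),
    ~~ [exists x, (side x == i) && (off x <= o < off x + mm x)%N].
  apply/existsP; move: hi; apply: contraTT; rewrite negb_exists => /forallP c.
  rewrite -leqNgt -{1}(card_ord (llen (edge i))) -sum1_card.
  apply: (@leq_trans (\sum_(o < llen (edge i)) \sum_(x | side x == i)
      (off x <= o < off x + mm x))%N).
    apply: leq_sum => o _; have := c o; rewrite negbK => /existsP[x /andP[xi ox]].
    by rewrite (bigD1 x xi) /= ox.
  by rewrite exchange_big; apply: leq_sum => x _; apply: sum_interval.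
rewrite negb_exists => /forallP c; exists o; split=> // x xi.
have := c x; rewrite xi eqxx /= negb_and -ltnNge -leqNgt.
by case/orP; [left | right].
Qed.

(** Levels 0 and 1 are left out because the parabolas vanish there: a core point at [p] or on the
    base imposes nothing on [E]. *)
Definition inner_ray x b : bool :=
  has (fun v => [&& 0 < af (lev x) (emb v), af (lev x) (emb v) < 1
    & af (tco x (~~ b)) (emb v) == 0]) (core x).

Definition side_rank (i0 i : 'I_(nsides X)) : nat := ((i + (nsides X - i0)) %% nsides X)%N.

Lemma side_rank_lt i0 i : (side_rank i0 i < nsides X)%N.
Proof. by rewrite ltn_mod; case: (Hg) => n3 _ _ _ _; apply: ltn_trans n3. Qed.

Lemma side_rankS i0 i : side_rank i0 (ordS i) = ((side_rank i0 i).+1 %% nsides X)%N.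
Proof. by rewrite /side_rank /= modnDml -[in RHS]addn1 modnDml addn1. Qed.

Lemma side_rank_inj i0 : injective (side_rank i0).
Proof.
by move=> i j /eqP; rewrite /side_rank eqn_modDr !modn_small // => /eqP/val_inj.
Qed.

Lemma side_rank_eq0 i0 i : side_rank i0 i = 0%N -> i = i0.
Proof.
by move=> r0; apply: (@side_rank_inj i0); rewrite r0 /side_rank addnC subnK ?modnn // ltnW.
Qed.

(* The boundary is cut in a unit segment that meets no base; the position of a
   base along the cut boundary is given by rank and cut_off. *)
Lemma inner_potential : exists E : exc X -> nat, forall y x,
  q y true = q x false -> (E x + inner_ray x false = E y + inner_ray y true)%N.
Proof.
have [i0 [o0 [o0l gap]]] := gap_unit.
(* Side [i0] is cut at [o0]: its bases before the cut come last and get the extra rank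
   [nsides X]. *)
pose rank x := if (side_rank i0 (side x) == 0%N) && (off x <= o0)%N then nsides X
  else side_rank i0 (side x).
have rank_side x y : rank x = rank y -> side x = side y.
  rewrite /rank; have := side_rank_lt i0 (side x); have := side_rank_lt i0 (side y).
  case: ifP => [/andP[/eqP/side_rank_eq0-> _]|_]; case: ifP => [/andP[/eqP/side_rank_eq0-> _]|_] //.
  - by move=> + _ e; rewrite -e ltnn.
  - by move=> _ + e; rewrite e ltnn.
  - by move=> _ _ /side_rank_inj.
pose le x y := (rank x < rank y)%N || (rank x == rank y) && (off x <= off y)%N.
pose succ y x := q y true == q x false.
have mp x := mm_gt0 Hp x.
have bl x := base_off_le H x true.
have step y x : succ y x ->
    (rank y = rank x /\ side y = side x /\ off x = off y + mm y)%N \/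
    (rank x = (rank y).+1 /\ off x = 0 /\ off y + mm y = llen (edge (side y)))%N.
  move=> /eqP/(base_vtx_sides H) /=; have := bl x; have := bl y; have := mp x; have := mp y.
  move=> mpy mpx bly blx; case=> [[s e]|[e _ _]|[e s e']]; first 2 last.
  - right; split=> //; rewrite /rank s side_rankS e leq0n andbT.
    have : ~~ ((side_rank i0 (side y) == 0%N) && (off y <= o0)%N).
      apply/negP => /andP[/eqP/side_rank_eq0 s0 le0]; have := gap y s0.
      by move: o0l le0; rewrite -s0 -e'; clear; lia.
    move/negbTE => ->; have [->|ne] := eqVneq (side_rank i0 (side y)).+1 (nsides X).
      by rewrite modnn eqxx.
    by rewrite modn_small // ltn_neqAle ne side_rank_lt.
  - left; split=> //; rewrite /rank s -e.
    have [/eqP/side_rank_eq0 s0|//] := boolP (side_rank i0 (side x) == 0%N).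
    have := gap y; rewrite s s0 => /(_ erefl) g /=.
    by rewrite (_ : (off y <= o0) = (off y + mm y <= o0))%N //; move: g mpy; clear; lia.
  - by move: e mpy; clear; lia.
suff [E hE] : exists E : exc X -> nat, forall y x, succ y x ->
    (E x + inner_ray x false = E y + inner_ray y true)%N.
  by exists E => y x e; apply: hE; apply/eqP.
apply: (@exists_potential _ succ le (inner_ray^~ true) (inner_ray^~ false))
  => [y x z /step st|y x /step|y y' x /eqP e /eqP e'].
- have [-> |zx] := eqVneq z x; first by rewrite orbT /le eqxx leqnn orbT.
  rewrite orbF /le.
  have dj u w : u != w -> rank u = rank w ->
      (off u + mm u <= off w)%N \/ (off w + mm w <= off u)%N.
    by move=> uw /rank_side; apply: bases_disjoint.
  have mz := mp z; have mx := mp x; have my := mp y; have blz := bl z; rewrite /= in blz.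
  case: st => [[ry [sy oy]]|[rx [ox oy]]].
    rewrite ry; case: ltngtP => //= rz; have := dj z x zx rz.
    have [->|zy] := eqVneq z y; first by move: oy; clear; lia.
    have := dj z y zy; rewrite rz ry => /(_ erefl).
    by move: oy mx my mz; clear; lia.
  rewrite rx; case: (ltngtP (rank z) (rank y)) => rz.
  - by rewrite ltnS (ltnW rz).
  - rewrite /= ltnS leqNgt rz /=; case: eqP => //= rz'.
    by have := dj z x zx; rewrite rz' rx => /(_ erefl); move: ox mz mx; clear; lia.
  - rewrite rz ltnS leqnn /=; apply/esym.
    have [->|zy] := eqVneq z y; first by rewrite leqnn.
    have := dj z y zy rz; rewrite (rank_side _ _ rz) in blz.
    by move: oy blz mz; move: (llen _) => L; clear; lia.
- have my := mp y; rewrite /le; case=> [[-> [_ ->]]|[-> _]]; rewrite ?ltnn ?eqxx /=.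
    by move: my; clear; lia.
  by clear; lia.
- by apply: (base_vtx_inj H (b := true)); rewrite e e'.
Qed.

End Potential.

(** * Heights of the core *)

Section Coordinates.
Variables (R : realType) (X : toric_model R) (K : cut_data X).
Hypothesis H : cut_model K.
Variable E : exc X -> nat.
Hypothesis hE : forall y x, base_vtx K y true = base_vtx K x false ->
  (E x + inner_ray K x false = E y + inner_ray K y true)%N.
Local Notation affine := ('rV[R]_2 * R^o)%type.
Local Notation emb := (emb R).
Implicit Types (x y z : exc X) (b : bool) (v : 'rV[int]_2)
  (W : 'rV[int]_2 -> R) (G : nat -> R -> R).

Local Notation p := (base_pt X).
Local Notation q := (base_vtx K).
Local Notation tco := (tco K).
Local Notation dco := (dco K).
Local Notation lev := (lev K).
Local Notation dlev := (dlev K).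
Local Notation core := (core K).
Local Notation deg := (int_edge_len K).
Local Notation apex := (cut_apex K).
Local Notation edge_pt := (edge_pt K).
Local Notation dist_p := (@dist_p R X).

Lemma adjacent_potential x y b v : adjacent_at K x y b v -> v \in core y ->
  0 < af (lev y) (emb v) < 1 ->
  (E x + inner_ray K x (~~ b) = E y + 1)%N.
Proof.
move=> [e t0] vy /andP[l0 l1].
have iy : inner_ray K y b by apply/hasP; exists v; rewrite // l0 l1 t0 eqxx.
case: b e t0 iy => /= e t0 iy; first by rewrite (hE e) iy.
by have := hE (esym e); rewrite iy.
Qed.

(** An inner core point is a convex combination of the apex, with positive weight, and a base end,
    where the coordinate is nonnegative. *)
Lemma inner_ray_apex x b : inner_ray K x b -> af (tco x (~~ b)) (emb (apex x)) = 0.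
Proof.
case/hasP => _ /coreP[b' [k kd ->]] /and3P[_ l1 /eqP t0].
have d0 : 0 < (deg x)%:R :> R by rewrite ltr0n (deg_gt0 H).
have kd' : (k < deg x)%N.
  rewrite ltn_neqAle kd andbT; apply/negP => /eqP ek.
  by move: l1; rewrite ek edge_pt_deg // lev_q // ltxx.
have s1 : 0 < 1 - k%:R / (deg x)%:R :> R by rewrite subr_gt0 ltr_pdivrMr // mul1r ltr_nat.
have s0 : 0 <= k%:R / (deg x)%:R :> R by rewrite divr_ge0 // ltW.
move: t0 s1 s0; rewrite af_edge_pt // tco_q //; move: (_ / _) => s t0 s1 s0.
move/eqP: t0; rewrite paddr_eq0 ?mulr_ge0 ?ler0n ?(ltW s1) ?(apex_tco_ge0 H) //.
by rewrite mulf_eq0 (gt_eqF s1) /= => /andP[/eqP].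
Qed.

(** With the apex on the ray, the interior edge covers the ray from level [lev0 x] to level 1, and
    its lattice points are core points. *)
Lemma ray_core x b v : af (tco x (~~ b)) (emb (apex x)) = 0 ->
  af (tco x (~~ b)) (emb v) = 0 -> lev0 x <= af (lev x) (emb v) <= 1 ->
  v \in core x.
Proof.
move=> a0 v0 /andP[l0 l1].
have e : dco x (~~ b) = tco x (~~ b).
  apply: (af_eq3 (dtri_neq0 H x b)).
  - by rewrite dco_apex a0.
  - by rewrite dco_q // tco_q.
  - by rewrite dco_q // tco_q.
have d0 : af (dco x (~~ b)) (emb v) = 0 by rewrite e.
have s0 : 0 < 1 - lev0 x by rewrite subr_gt0 (lev0_lt1 H).
move: l0 l1; rewrite (lev_dlev H) (dlevE K x b) d0 addr0.
rewrite lerDl pmulr_rge0 // => l0 l1.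
have l1' : af (dco x b) (emb v) <= 1 by rewrite -(ler_pM2l s0); lra.
have [|k kd ->] := edge_pt_lattice H (b := b) _ d0; first by rewrite l0.
by apply/coreP; exists b, k.
Qed.

Lemma lev0_eq0_apex x : lev0 x = 0 -> apex x = p.
Proof.
move=> l0; have := lev_apex H x; rewrite l0 (levE K x false) => /eqP.
rewrite paddr_eq0 ?(apex_tco_ge0 H) // => /andP[/eqP t0 /eqP t1].
by apply: (@emb_inj R); rewrite (tcoP H x false (emb (apex x))) t0 t1 !scale0r !addr0.
Qed.

Definition core_pts : seq 'rV[int]_2 := p :: flatten [seq core x | x <- enum (exc X)].

Lemma core_ptsP v : reflect (v = p \/ exists x, v \in core x) (v \in core_pts).
Proof.
rewrite inE; apply: (iffP orP) => [[/eqP->|/flatten_mapP[x _ vx]]|[->|[x vx]]].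
- by left.
- by right; exists x.
- by left.
- by right; apply/flatten_mapP; exists x; rewrite ?mem_enum.
Qed.

(* A coordinate of the heights: a fan function plus, on the triangle T_x, a
   function G (E x) of the level. *)
Definition crd W G v : R :=
  if [pick x | v \in core x] is Some y
  then af (fan K W y) (emb v) + G (E y) (af (lev y) (emb v)) else 0.

(** Ensures that triangles with different [E] agree at both ends of a common ray. *)
Definition ends0 G := forall e, G e 0 = 0 /\ G e 1 = 0.

Lemma core_potential x y v : v \in core x -> v \in core y ->
  0 < af (lev y) (emb v) < 1 -> E x = E y.
Proof.
move=> vx vy l01; have [le _ c] := core_consistent H vx vy.
case: c => [->//|vp|[b a]].
  by move: l01; rewrite vp lev_p ltxx.
have := adjacent_potential a vy l01.
have [t0 _ _ _] := adjacent_tco H a.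
have -> : inner_ray K x (~~ b).
  by apply/hasP; exists v => //; rewrite le; case/andP: l01 => -> ->; rewrite negbK t0 eqxx.
by rewrite !addn1 => -[].
Qed.

Lemma crd_core W G x v : ends0 G -> v \in core x ->
  crd W G v = af (fan K W x) (emb v) + G (E x) (af (lev x) (emb v)).
Proof.
move=> g01 vx; rewrite /crd; case: pickP => [y vy|/(_ x)]; last by rewrite vx.
have [le fe _] := core_consistent H vx vy; rewrite fe le; congr (_ + _).
have l0 : 0 <= af (lev y) (emb v).
  by rewrite (levE K y false) addr_ge0 ?(core_tco_ge0 H).
have l1 : af (lev y) (emb v) <= 1 := core_lev_le1 H vy.
have [->|n0] := eqVneq (af (lev y) (emb v)) 0.
  by have [-> _] := g01 (E x); have [-> _] := g01 (E y).
have [->|n1] := eqVneq (af (lev y) (emb v)) 1.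
  by have [_ ->] := g01 (E x); have [_ ->] := g01 (E y).
by rewrite (core_potential vx vy) // !lt_neqAle eq_sym n0 n1 l0.
Qed.

Lemma crd_p W G : ends0 G -> crd W G p = 0.
Proof.
move=> g01; rewrite /crd; case: pickP => // y _; rewrite fan_p lev_p add0r.
by case: (g01 (E y)).
Qed.

Definition lam x k : R := lev0 x + (1 - lev0 x) * (k%:R / (deg x)%:R).

Lemma lev_edge_pt x b k : af (lev x) (emb (edge_pt x b k)) = lam x k.
Proof. by rewrite (lev_dlev H) dlev_edge_pt. Qed.

Lemma lam_lt x j k : (j < k)%N -> lam x j < lam x k.
Proof.
move=> jk; rewrite ltrD2l ltr_pM2l ?subr_gt0 ?(lev0_lt1 H) //.
by rewrite ltr_pM2r ?invr_gt0 ?ltr0n ?(deg_gt0 H) // ltr_nat.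
Qed.

Lemma lam_ge x k : lev0 x <= lam x k.
Proof.
by rewrite lerDl mulr_ge0 ?divr_ge0 // subr_ge0 ltW // (lev0_lt1 H).
Qed.

Lemma lam_le1 x k : (k <= deg x)%N -> lam x k <= 1.
Proof.
move=> kd; rewrite /lam; have l1 := lev0_lt1 H x.
have : k%:R / (deg x)%:R <= 1 :> R by rewrite ler_pdivrMr ?ltr0n ?(deg_gt0 H) // mul1r ler_nat.
by rewrite -(ler_pM2l (_ : 0 < 1 - lev0 x)) ?subr_gt0 //; lra.
Qed.

(* The fan function plus the secant of the level function on the k-th strip. *)
Definition strip_form W G x k : affine := fan K W x + (afc (G (E x) (lam x k))
  + (G (E x) (lam x k.+1) - G (E x) (lam x k)) *: ((deg x)%:R *: dlev x - afc k%:R)).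

Lemma strip_formE W G x k a : af (strip_form W G x k) a = af (fan K W x) a +
  (G (E x) (lam x k) + (G (E x) (lam x k.+1) - G (E x) (lam x k)) *
     ((deg x)%:R * af (dlev x) a - k%:R)).
Proof. by rewrite !afD afZ afB afZ !af_c. Qed.

Lemma strip_form_edge_pt W G x b j k : af (strip_form W G x k) (emb (edge_pt x b j)) =
  af (fan K W x) (emb (edge_pt x b j)) + (G (E x) (lam x k) +
    (G (E x) (lam x k.+1) - G (E x) (lam x k)) * (j%:R - k%:R)).
Proof.
rewrite strip_formE dlev_edge_pt //; congr (_ + (_ + _ * (_ - _))).
by field; rewrite degR_neq0.
Qed.

Lemma strip_form_corner W G x k v : ends0 G -> (k < deg x)%N ->
  v \in std_corners K x k -> crd W G v = af (strip_form W G x k) (emb v).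
Proof.
move=> g01 kd vk.
have [b [j [jk ev]]] : exists b j, (j = k \/ j = k.+1) /\ v = edge_pt x b j.
  move: vk; rewrite !inE => /or4P[] /eqP->.
  - by exists false, k; split; [left|].
  - by exists false, k.+1; split; [right|].
  - by exists true, k; split; [left|].
  - by exists true, k.+1; split; [right|].
have vx : v \in core x.
  by apply/coreP; exists b, j; rewrite // ; case: jk => -> //; exact: ltnW.
rewrite (crd_core _ g01 vx) ev strip_form_edge_pt lev_edge_pt; congr (_ + _).
case: jk => ->; first by rewrite subrr mulr0 addr0.
by rewrite -natr1; ring.
Qed.

(** One function for each value [e], so that each value of [E] receives its own weight. *)
Definition parabola e : nat -> R -> R := fun e' l => (e' == e)%:R * (l ^+ 2 - l).

Lemma parabola_ends e : ends0 (parabola e).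
Proof. by split; rewrite /parabola; ring. Qed.

(** The secant of [l ^+ 2 - l] between two levels differs from it by the product of the differences
    with these levels. *)
Lemma strip_form_parabola x k a :
  (parabola (E x) (E x) (lam x k) + (parabola (E x) (E x) (lam x k.+1)
     - parabola (E x) (E x) (lam x k)) * ((deg x)%:R * af (dlev x) a - k%:R)) =
  af (lev x) a ^+ 2 - af (lev x) a
   - (af (lev x) a - lam x k) * (af (lev x) a - lam x k.+1).
Proof.
rewrite /parabola eqxx !mul1r (lev_dlev H) /lam -natr1; field.
by rewrite degR_neq0.
Qed.

(** The left side is affine in [l], with values [- l0 * l1] at 0 and [- (1 - l0) * (1 - l1)] at
    1. *)
Lemma secant_lt0 (l0 l1 l : R) : 0 < l0 -> l0 < l1 -> l1 <= 1 -> 0 <= l -> l < 1 ->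
  l ^+ 2 - l - (l - l0) * (l - l1) < 0.
Proof.
move=> h0 h1 h2 h3 h4.
have -> : l ^+ 2 - l - (l - l0) * (l - l1) = - ((1 - l) * (l0 * l1) + l * ((1 - l0) * (1 - l1))).
  by ring.
rewrite oppr_lt0 ltr_pwDl ?mulr_gt0 //; try lra.
by rewrite !mulr_ge0 //; lra.
Qed.

Lemma lam_gt0 x k : apex x != p -> 0 < lam x k.
Proof.
move=> ap; apply: lt_le_trans (lam_ge x k); rewrite lt_def (lev0_ge0 H) andbT.
by apply: contra ap => /eqP/lev0_eq0_apex->.
Qed.

Lemma apex_core x : apex x \in core x.
Proof. by apply/coreP; exists false, 0%N; rewrite // edge_pt0. Qed.

Lemma base_vtx_core x b : q x b \in core x.
Proof. by apply/coreP; exists b, (deg x); rewrite ?edge_pt_deg. Qed.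

Definition dif W G x k v := crd W G v - af (strip_form W G x k) (emb v).

(** The leading function decides off T_x. Where it ties, on T_x and its rays, all fan coordinates
    tie and the convexity of the parabola decides. The clause on larger [e] allows larger values of
    [E] to have larger weights. *)
Lemma dif_core_pts x k v : (k < deg x)%N -> v \in core_pts ->
  v \notin std_corners K x k ->
  0 < dif dist_p (fun _ _ => 0) x k v \/
  [/\ forall W, dif W (fun _ _ => 0) x k v = 0,
      forall e, (E x < e)%N -> dif (fun=> 0) (parabola e) x k v = 0
    & 0 < dif (fun=> 0) (parabola (E x)) x k v].
Proof.
move=> kd vc vn.
have z01 : ends0 (fun _ _ => 0) by [].
have fan0 y a : af (fan K (fun=> 0) y) a = 0.
  by rewrite (fanE K _ y true) !mul0r addr0.
have strip0 W a : af (strip_form W (fun _ _ => 0) x k) a = af (fan K W x) a.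
  by rewrite strip_formE subrr mul0r !addr0.
have strip_e e a : (E x < e)%N -> af (strip_form (fun=> 0) (parabola e) x k) a = 0.
  move=> ex; rewrite strip_formE fan0 /parabola (ltn_eqF ex).
  by rewrite !mul0r subrr mul0r !addr0.
have strip_x a : af (strip_form (fun=> 0) (parabola (E x)) x k) a =
    af (lev x) a ^+ 2 - af (lev x) a
     - (af (lev x) a - lam x k) * (af (lev x) a - lam x k.+1).
  by rewrite strip_formE fan0 add0r strip_form_parabola.
have lk1 := lam_lt x (ltnSn k); have l1 := lam_le1 kd.
(* In the core of [x] the difference is a product of two differences of levels, positive for a level
   outside the strip. *)
have [vx|vx] := boolP (v \in core x).
  right; split.
  - by move=> W; rewrite /dif strip0 (crd_core _ z01 vx) addr0 subrr.
  - move=> e ex; rewrite /dif strip_e // (crd_core _ (parabola_ends e) vx) fan0.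
    by rewrite /parabola (ltn_eqF ex) mul0r !addr0 subr0.
  rewrite /dif strip_x (crd_core _ (parabola_ends _) vx) fan0 add0r /parabola eqxx mul1r.
  have /coreP[b [j jd ev]] := vx.
  have [jk jk1] : j != k /\ j != k.+1.
    by split; apply: contra vn => /eqP jk; rewrite ev jk !inE; case: b {ev jk}; rewrite eqxx ?orbT.
  rewrite ev lev_edge_pt opprB addrC subrK.
  case: (ltngtP j k) jk => // jk _.
    rewrite nmulr_rgt0 subr_lt0 ?lam_lt //.
    exact: leq_trans jk _.
  have jk' : (k.+1 < j)%N by rewrite ltn_neqAle eq_sym jk1.
  by rewrite mulr_gt0 // subr_gt0 lam_lt.
have strict l : apex x != p -> 0 <= l -> l < 1 ->
    l ^+ 2 - l - (l - lam x k) * (l - lam x k.+1) < 0.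
  by move=> ap; apply: secant_lt0 => //; apply: lam_gt0.
have [vp|vp] := eqVneq v p.
  right; split=> [W|e ex|].
  - by rewrite /dif vp crd_p // strip0 fan_p subrr.
  - by rewrite /dif vp crd_p ?strip_e ?subrr //; apply: parabola_ends.
  rewrite /dif strip_x vp lev_p (crd_p _ (parabola_ends _)) sub0r oppr_gt0.
  by apply: strict => //; apply: contra vx => /eqP ap; rewrite vp -ap apex_core.
have [y vy] : exists y, v \in core y.
  by case/core_ptsP: vc => // ep; rewrite ep eqxx in vp.
have [le eq] := fan_core_le H x vy.
have [lt|ge] := ltP (af (fan K dist_p x) (emb v)) (af (fan K dist_p y) (emb v)).
  by left; rewrite /dif strip0 (crd_core _ z01 vy) addr0 subr_gt0.
right; have {eq}[exy|ep|[b a]] : [\/ x = y, v = p | exists b, adjacent_at K x y b v].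
- by apply: eq; apply/le_anti; rewrite le.
- by rewrite exy vy in vx.
- by rewrite ep eqxx in vp.
have [t0 t1 el ef] := adjacent_tco H a; have [eq tn] := a.
have ly : af (lev y) (emb v) = af (tco y b) (emb v) by rewrite (levE K y b) tn addr0.
have lp : 0 < af (lev y) (emb v).
  rewrite lt_def ly (core_tco_ge0 H) // andbT; apply: contra vp => /eqP t.
  apply/eqP/(@emb_inj R).
  by rewrite (tcoP H y b (emb v)) t tn !scale0r !addr0.
have l1' : af (lev y) (emb v) < 1.
  rewrite lt_neqAle (core_lev_le1 H vy) andbT; apply: contra vx => /eqP l.
  suff -> : v = q y b by rewrite eq base_vtx_core.
  apply: (@emb_inj R); rewrite (tcoP H y b (emb v)) -ly l tn scale0r addr0.
  by rewrite scale1r addrC subrK.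
(* If the interior edge of Delta_x runs along this ray, its core points exhaust the levels from
   [lev0 x] on; so [v], not in [core x], is lower. *)
have nray : af (tco x b) (emb (apex x)) = 0 -> af (lev y) (emb v) < lev0 x.
  move=> a0; rewrite ltNge; apply: contra vx => l0.
  by apply: (@ray_core x (~~ b)); rewrite ?negbK // el l0 ltW.
have l01 : 0 < af (lev y) (emb v) < 1 by rewrite lp.
have := adjacent_potential a vy l01.
have fan_dif W : dif W (fun _ _ => 0) x k v = 0.
  by rewrite /dif strip0 (crd_core _ z01 vy) addr0 ef subrr.
(* With an inner point of T_x on the ray, [E x = E y] and [v] is at a level below the strip, where
   the parabola exceeds its secant. Otherwise [E x = E y + 1]: the parabola of index [E x]
   contributes 0 at [v], and the secant is negative there. *)
have [i|_] := boolP (inner_ray K x (~~ b)).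
  have a0 : af (tco x b) (emb (apex x)) = 0 by have := inner_ray_apex i; rewrite negbK.
  rewrite !addn1 => -[exy]; split=> // [e ex|].
    rewrite /dif strip_e // (crd_core _ (parabola_ends e) vy) fan0.
    by rewrite /parabola -exy (ltn_eqF ex) mul0r !addr0 subr0.
  rewrite /dif strip_x (crd_core _ (parabola_ends _) vy) fan0 add0r /parabola -exy eqxx.
  rewrite mul1r el opprB addrC subrK nmulr_rgt0 subr_lt0.
    exact: lt_trans (lt_le_trans (nray a0) (lam_ge x k)) lk1.
  exact: lt_le_trans (nray a0) (lam_ge x k).
rewrite addn0 addn1 => exy; split=> // [e ex|].
  rewrite /dif strip_e // (crd_core _ (parabola_ends e) vy) fan0.
  by rewrite /parabola ltn_eqF ?mul0r ?addr0 ?subr0 //; move: ex; rewrite exy => /ltnW.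
rewrite /dif strip_x (crd_core _ (parabola_ends _) vy) fan0 add0r /parabola.
rewrite ltn_eqF ?mul0r ?sub0r ?oppr_gt0; last by rewrite exy.
rewrite el; apply: strict => //; last exact: ltW.
apply/eqP => ap; have l0 : lev0 x = 0 by rewrite -(lev_apex H) ap lev_p.
by have := nray; rewrite ap tco_p l0 ltNge (ltW lp) => /(_ erefl).
Qed.

End Coordinates.

(** * Coordinates of the heights and their weights *)

Section CoreHeights.
Variables (R : realType) (X : toric_model R) (K : cut_data X).
Hypothesis H : cut_model K.
Variable E : exc X -> nat.
Hypothesis hE : forall y x, base_vtx K y true = base_vtx K x false ->
  (E x + inner_ray K x false = E y + inner_ray K y true)%N.
Local Notation affine := ('rV[R]_2 * R^o)%type.
Local Notation emb := (emb R).
Implicit Types (x y z : exc X) (b : bool) (v : 'rV[int]_2)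
  (W : 'rV[int]_2 -> R) (G : nat -> R -> R).

Local Notation p := (base_pt X).
Local Notation q := (base_vtx K).
Local Notation tco := (tco K).
Local Notation lev := (lev K).
Local Notation core := (core K).
Local Notation core_pts := (core_pts K).
Local Notation deg := (int_edge_len K).
Local Notation dist_p := (@dist_p R X).
Local Notation crd := (crd K E).
Local Notation dif := (dif K E).
Local Notation strip_form := (strip_form K E).
Local Notation desc := (('rV[int]_2 -> R) * (nat -> R -> R))%type.

(** The last two conditions give [ends0]; otherwise the function detects one level on the triangles
    with one value of [E]. *)
Definition key (k : nat * R) : nat -> R -> R :=
  fun e l => [&& e == k.1, l == k.2, l != 0 & l != 1]%:R.

(** [rev] puts the parabolas of larger index first, as [dif_core_pts] requires. The hats of the base
    vertices may precede them, since they tie whenever the leading function does not decide. *)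
Definition descs : seq desc :=
  [seq ((fun v => (v == q xb.1 xb.2)%:R), fun _ _ => 0) |
     xb <- [seq (x, b) | x <- enum (exc X), b <- [:: false; true]]]
  ++ [seq (fun=> 0, parabola e) | e <- rev (iota 0 (\max_x E x).+1)]
  ++ [seq (fun=> 0, key k) |
       k <- flatten [seq [seq (E x, af (lev x) (emb v)) | v <- core x] | x <- enum (exc X)]].

Definition verts : seq 'rV[int]_2 := [seq vert i | i <- enum 'I_(nsides X)].

Lemma exists_big : exists B : R, 0 < B /\
  forall x v, v \in verts -> af (fan K dist_p x) (emb v) < B.
Proof.
exists (1 + \sum_x \sum_(v <- verts) `|af (fan K dist_p x) (emb v)|).
have s0 (I : Type) (r : seq I) (P : pred I) (F : I -> R) : 0 <= \sum_(i <- r | P i) `|F i|.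
  by apply: sumr_ge0.
split=> [|x v vv].
  by rewrite ltr_pwDl // sumr_ge0 // => x _; apply: s0.
apply: (@le_lt_trans _ _ (\sum_x \sum_(v <- verts) `|af (fan K dist_p x) (emb v)|)); last first.
  by rewrite ltrDr.
rewrite (bigD1 x) //= -[X in X <= _]addr0; apply: lerD; last first.
  by rewrite sumr_ge0 // => y _; apply: s0.
rewrite (big_rem v) //= -[X in X <= _]addr0; apply: lerD; last exact: s0.
exact: ler_norm.
Qed.

Variable B : R.
Hypotheses (B0 : 0 < B)
  (hB : forall x v, v \in verts -> af (fan K dist_p x) (emb v) < B).

(* Vertices of the polygon that are not core points are put very high. *)
Definition lead v : R := if v \in core_pts then crd dist_p (fun _ _ => 0) v else B.

Definition hcoord (i : option desc) v : R :=
  if i is Some d then crd d.1 d.2 v else lead v.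

Definition hcoord_form (i : option desc) x k : affine :=
  if i is Some d then strip_form d.1 d.2 x k else strip_form dist_p (fun _ _ => 0) x k.

Definition hcoords : seq (option desc) := None :: map Some descs.

Lemma z01 : ends0 (fun _ _ => 0 : R). Proof. by []. Qed.

Lemma key_ends k : ends0 (key k).
Proof. by move=> e; rewrite /key eqxx !andbF [1 == 1]eqxx !andbF. Qed.

Lemma descP d : d \in descs -> ends0 d.2 /\ (d.1 = (fun=> 0) \/ d.2 = (fun _ _ => 0)).
Proof.
rewrite !mem_cat => /or3P[] /mapP[k _ ->] /=.
- by split; [|right].
- by split; [exact: parabola_ends|left].
- by split; [exact: key_ends|left].
Qed.

Lemma lead_core v : v \in core_pts -> lead v = crd dist_p (fun _ _ => 0) v.
Proof. by rewrite /lead => ->. Qed.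

Lemma hcoord_corner i x k v : i \in hcoords -> (k < deg x)%N ->
  v \in std_corners K x k -> hcoord i v = af (hcoord_form i x k) (emb v).
Proof.
move=> ii kd vk; have vc : v \in core_pts.
  apply/core_ptsP; right; exists x; apply/coreP.
  move: vk; rewrite !inE => /or4P[] /eqP->.
  - by exists false, k => //; apply: ltnW.
  - by exists false, k.+1.
  - by exists true, k => //; apply: ltnW.
  - by exists true, k.+1.
case: i ii => [d|_]; last by rewrite /= lead_core //; apply: (strip_form_corner H hE).
rewrite inE /= => /mapP[d' /descP[dz _] [->]].
exact: (@strip_form_corner _ _ _ H _ hE d'.1 d'.2 x k v dz kd vk).
Qed.

Lemma hcoord_lexpos x k v : (k < deg x)%N -> v \in core_pts ++ verts ->
  v \notin std_corners K x k ->
  lexpos [seq hcoord i v - af (hcoord_form i x k) (emb v) | i <- hcoords].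
Proof.
move=> kd vV vk; rewrite /hcoords /= -map_comp.
have [vc|vc] := boolP (v \in core_pts); last first.
  rewrite /lead (negbTE vc) strip_formE subrr mul0r !addr0 subr_gt0 hB //.
  by move: vV; rewrite mem_cat (negbTE vc).
rewrite lead_core // -/(dif dist_p (fun _ _ => 0) x k v).
have [->//|[f0 ge gx]] := dif_core_pts H hE kd vc vk.
rewrite f0 ltxx eqxx /= !map_cat.
rewrite lexpos_cat0; last by apply/allP => _ /mapP[_ /mapP[xb _ ->] ->] /=; rewrite -/(dif _ _ _ _ _) f0.
apply: lexpos_cat; rewrite -map_comp.
have Ex : (E x < (\max_x E x).+1)%N by rewrite ltnS leq_bigmax.
have -> : iota 0 (\max_x E x).+1 = iota 0 (E x) ++ E x :: iota (E x).+1 (\max_x E x - E x).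
  rewrite -[X in iota 0 X](subnKC (ltnW Ex)) iotaD add0n subSn; last by rewrite -ltnS.
  by [].
rewrite rev_cat rev_cons map_cat -cats1 map_cat -catA lexpos_cat0.
  by rewrite /= -/(dif _ _ _ _ _) gx.
apply/allP => _ /mapP[e + ->] /=; rewrite mem_rev mem_iota => /andP[ee _].
by rewrite -/(dif _ _ _ _ _) ge.
Qed.

Lemma hcoord_p i : i \in hcoords -> hcoord i p = 0.
Proof.
case: i => [d|_]; first by rewrite inE /= => /mapP[d' /descP[dz _] [->]]; apply: crd_p.
by rewrite /= lead_core ?crd_p //; apply/core_ptsP; left.
Qed.

Lemma crd_lead_gt0 x v : v \in core x -> v != p ->
  0 < af (fan K dist_p x) (emb v).
Proof.
move=> vx vp; rewrite (fanE K _ x false).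
have d0 b : 0 < dist_p (q x b) by apply/dist_p_gt0/(base_vtx_neq_p H).
have t b := core_tco_ge0 H b vx.
have [s0|sn] := eqVneq (af (tco x false) (emb v)) 0.
  rewrite s0 mulr0 add0r mulr_gt0 // lt_def t andbT; apply: contra vp => /eqP r0.
  by apply/eqP/(@emb_inj R); rewrite (tcoP H x false (emb v)) s0 r0 !scale0r !addr0.
rewrite ltr_pwDl ?mulr_ge0 ?t ?(ltW (d0 _)) // mulr_gt0 // lt_def sn t //.
Qed.

Lemma hcoord_p_lexpos v : v \in core_pts ++ verts -> v != p ->
  lexpos [seq hcoord i v | i <- hcoords].
Proof.
move=> vV vp; rewrite /hcoords /=; apply/orP; left.
have [vc|vc] := boolP (v \in core_pts); last by rewrite /lead (negbTE vc).
rewrite lead_core //; case/core_ptsP: vc => [e|[x vx]]; first by rewrite e eqxx in vp.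
by rewrite (crd_core H hE _ z01 vx) addr0; apply: crd_lead_gt0.
Qed.

(** All four properties concern the signs of finitely many vectors. The dependencies of core points
    enter with both signs, so that a vanishing weighted sum forces every coordinate to vanish, and
    the leading coordinate is never of the sign opposite to the sum. *)
Lemma hcoord_weights : exists w : seq R,
 [/\ forall x k v, (k < deg x)%N -> v \in core_pts ++ verts ->
      v \notin std_corners K x k ->
      0 < wsum w [seq hcoord i v - af (hcoord_form i x k) (emb v) | i <- hcoords],
    forall v, v \in core_pts ++ verts -> v != p ->
      0 < wsum w [seq hcoord i v | i <- hcoords],
    forall a b c d : 'rV[int]_2, a \in core_pts -> b \in core_pts -> c \in core_pts ->
      d \in core_pts -> wsum w [seq dep (hcoord i) a b c d | i <- hcoords] = 0 ->
      forall i, i \in hcoords -> dep (hcoord i) a b c d = 0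
  & forall a b c d : 'rV[int]_2, a \in core_pts -> b \in core_pts -> c \in core_pts ->
      d \in core_pts ->
      (0 <= wsum w [seq dep (hcoord i) a b c d | i <- hcoords] -> 0 <= dep lead a b c d) /\
      (wsum w [seq dep (hcoord i) a b c d | i <- hcoords] <= 0 -> dep lead a b c d <= 0)].
Proof.
pose V3 := core_pts ++ verts.
pose cs1 := [seq [seq hcoord i t.2 - af (hcoord_form i t.1.1 t.1.2) (emb t.2) | i <- hcoords] |
  t <- [seq (xk, v) | xk <- flatten [seq [seq (x, k) | k <- iota 0 (deg x)] | x <- enum (exc X)],
                      v <- V3]].
pose cs2 := [seq [seq hcoord i v | i <- hcoords] | v <- V3].
pose cs3 := [seq [seq dep (hcoord i) t.1.1 t.1.2 t.2.1 t.2.2 | i <- hcoords] |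
  t <- [seq (s, r) | s <- [seq (u, u') | u <- core_pts, u' <- core_pts],
                     r <- [seq (u, u') | u <- core_pts, u' <- core_pts]]].
have [|w _ hw] := @lex_weights R (size hcoords) (cs1 ++ cs2 ++ cs3 ++ map (map -%R) cs3).
  move=> c; rewrite !mem_cat => /or4P[] /mapP.
  - by move=> [t _ ->]; rewrite size_map.
  - by move=> [t _ ->]; rewrite size_map.
  - by move=> [t _ ->]; rewrite size_map.
  - by move=> [_ /mapP[t _ ->] ->]; rewrite !size_map.
have wN c : wsum w (map -%R c) = - wsum w c.
  elim: c (w) => [|x c ih] [|y u] //=; rewrite ?oppr0 //.
  by rewrite ih mulrN opprD.
have in3 (a b c d : 'rV[int]_2) : a \in core_pts -> b \in core_pts -> c \in core_pts -> d \in core_pts ->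
    [seq dep (hcoord i) a b c d | i <- hcoords] \in cs3.
  move=> ha hb hc hd; apply/mapP; exists ((a, b), (c, d)) => //.
  by apply: allpairs_f; apply: allpairs_f.
have tri c : c \in cs3 -> [\/ 0 < wsum w c /\ lexpos c,
    wsum w c < 0 /\ lexpos (map -%R c) | all (pred1 0) c].
  move=> cc; case: (lex_trichotomy c) => lc; last by constructor 3.
    by constructor 1; split=> //; apply: hw => //; rewrite !mem_cat cc !orbT.
  constructor 2; split=> //; rewrite -oppr_gt0 -wN; apply: hw => //.
  by rewrite !mem_cat; apply/or4P; constructor 4; apply: map_f.
have w0 c : all (pred1 0) c -> wsum w c = 0.
  elim: c (w) => [|x c ih] [|y u] //= /andP[/eqP-> /ih->].
  by rewrite mulr0 addr0.
exists w; split.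
- move=> x k v kd vV vk; apply: hw (hcoord_lexpos kd vV vk); rewrite mem_cat.
  apply/orP; left; apply/mapP; exists ((x, k), v) => //; apply: allpairs_f => //.
  apply/flatten_mapP; exists x; rewrite ?mem_enum //; apply/mapP; exists k => //.
  by rewrite mem_iota.
- move=> v vV vp; apply: hw (hcoord_p_lexpos vV vp); rewrite !mem_cat.
  by apply/or4P; constructor 2; apply/mapP; exists v.
- move=> a b c d ha hb hc hd e i ii; have := tri _ (in3 a b c d ha hb hc hd).
  rewrite e ltxx; case=> [[]//|[]//|/allP z]; apply/eqP/z/mapP; by exists i.
- move=> a b c d ha hb hc hd; have := tri _ (in3 a b c d ha hb hc hd).
  case=> [[pos]|[neg]|z].
  - rewrite /hcoords /= => l; split; last by rewrite leNgt pos.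
    by case/orP: l => [/ltW|/andP[/eqP-> _]].
  - rewrite /hcoords /= => l; split; first by rewrite leNgt neg.
    by move: l; rewrite oppr_gt0 oppr_eq0 => /orP[/ltW|/andP[/eqP-> _]].
  - by move: z; rewrite /hcoords /= => /andP[/eqP-> _].
Qed.

End CoreHeights.

Lemma exists_interpolation (R : realType) (a b c : 'rV[int]_2) (ra rb rc : R) :
  area R a b c != 0 -> exists l : 'rV[R]_2 * R^o,
  [/\ af l (emb R a) = ra, af l (emb R b) = rb & af l (emb R c) = rc].
Proof.
rewrite /area; move: (emb R a) (emb R b) (emb R c) => u v w d.
have d' : cross (w - u) (v - u) != 0 by rewrite crossC oppr_eq0.
exists (afc ra + (rb - ra) *: bary u v w + (rc - ra) *: bary u w v).
rewrite !afD !(afZ (_ - _)) !af_c !bary_o !bary_b !bary_a //.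
by split; ring.
Qed.

(** * Coplanar core points *)

Section FourCorePoints.
Variables (R : realType) (X : toric_model R) (K : cut_data X).
Hypothesis H : cut_model K.
Variable E : exc X -> nat.
Hypothesis hE : forall y x, base_vtx K y true = base_vtx K x false ->
  (E x + inner_ray K x false = E y + inner_ray K y true)%N.
Local Notation emb := (emb R).
Local Notation area := (area R).
Implicit Types (x y z : exc X) (v : 'rV[int]_2).

Local Notation p := (base_pt X).
Local Notation q := (base_vtx K).
Local Notation tco := (tco K).
Local Notation dco := (dco K).
Local Notation dlev := (dlev K).
Local Notation lev := (lev K).
Local Notation core := (core K).
Local Notation core_pts := (core_pts K).
Local Notation deg := (int_edge_len K).
Local Notation dist_p := (@dist_p R X).
Local Notation crd := (crd K E).
Variable B : R.
Local Notation hcoords := (hcoords K E).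
Local Notation hcoord := (hcoord K E B).
Local Notation lead := (lead K E B).

(* The open segment from u to v contains a lattice point, or a point of some
   triangle Delta_x that is on none of its interior edges. *)
Definition crossed (u v : 'rV[int]_2) : Prop := exists2 t : R, 0 < t < 1 &
  (exists z : 'rV[int]_2, emb z = t *: emb u + (1 - t) *: emb v) \/
  exists x, let m := t *: emb u + (1 - t) *: emb v in
    [/\ 0 < af (dco x false) m, 0 < af (dco x true) m & af (dlev x) m <= 1].

(** [C] stands for the core points of one cell; [Cdep] and [Clead] express coplanarity and support
    in the separate coordinates. *)
Variable C : pred 'rV[int]_2.
Hypothesis Ccore : forall v, C v -> v \in core_pts.
Hypothesis Cdep : forall (a b c d : 'rV[int]_2), C a -> C b -> C c -> C d ->
  forall i, i \in hcoords -> dep (hcoord i) a b c d = 0.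
Hypothesis Clead : forall (a b c : 'rV[int]_2), C a -> C b -> C c ->
  forall v, v \in core_pts -> area a b c * dep lead a b c v <= 0.
Hypothesis Carea : forall (a b c : 'rV[int]_2), C a -> C b -> C c ->
  a != b -> a != c -> b != c -> area a b c != 0.

Lemma core_sub x v : v \in core x -> v \in core_pts.
Proof. by move=> vx; apply/core_ptsP; right; exists x. Qed.

Lemma lead_in x v : v \in core x -> lead v = af (fan K dist_p x) (emb v).
Proof.
by move=> vx; rewrite lead_core ?(core_sub vx) // (crd_core H hE _ _ vx) ?addr0.
Qed.

Lemma lead_p : lead p = 0.
Proof. by rewrite lead_core ?crd_p //; apply/core_ptsP; left. Qed.

Lemma key_coord x v : v \in core x ->
  Some ((fun=> 0) : 'rV[int]_2 -> R, key (E x, af (lev x) (emb v))) \in hcoords.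
Proof.
move=> vx; rewrite inE; apply/orP; right; apply: map_f.
rewrite !mem_cat; apply/or3P; constructor 3; apply: map_f.
by apply/flatten_mapP; exists x; rewrite ?mem_enum //; apply/mapP; exists v.
Qed.

Lemma hat_coord x b :
  Some ((fun v => (v == q x b)%:R) : 'rV[int]_2 -> R, (fun _ _ => 0)) \in hcoords.
Proof.
rewrite inE; apply/orP; right; apply: map_f.
rewrite !mem_cat; apply/or3P; constructor 1; apply/mapP; exists (x, b) => //.
by apply: allpairs_f; rewrite ?mem_enum //; case: b.
Qed.

Lemma crd_key k x v : v \in core x -> crd (fun=> 0) (key k) v = key k (E x) (af (lev x) (emb v)).
Proof.
move=> vx; rewrite (crd_core H hE _ (key_ends k) vx) (fanE K _ x true) !mul0r.
by rewrite !add0r.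
Qed.

Lemma crd_key_p k : crd (fun=> 0) (key k) p = 0.
Proof. by rewrite crd_p //; apply: key_ends. Qed.

(** Distinct core points at the same inner level are opposite on the two interior edges, so their
    midpoint is interior to Delta_x. *)
Lemma edge_pt_crossed x v v' : v \in core x -> v' \in core x -> v != v' ->
  0 < af (lev x) (emb v) -> af (lev x) (emb v) < 1 ->
  af (lev x) (emb v') = af (lev x) (emb v) -> crossed v v'.
Proof.
move=> /coreP[b [j jd ->]] /coreP[b' [j' jd' ->]] ne l0 l1; rewrite !lev_edge_pt // => el.
have ej : j' = j.
  by case: (ltngtP j' j) => // /(lam_lt H x); rewrite el ltxx.
have d0 : 0 < (deg x)%:R :> R by rewrite ltr0n (deg_gt0 H).
have bb : b' = ~~ b by move: ne; rewrite ej; case: b {l0 l1}; case: b' => //; rewrite eqxx.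
have j0 : (0 < j)%N.
  by rewrite lt0n; apply/negP => /eqP e; move: ne; rewrite ej e !edge_pt0 // eqxx.
exists 2^-1; first by apply/andP; split; lra.
right; exists x => /=; rewrite !af_conv !dlev_edge_pt // !dco_edge_pt // bb ej.
have s0 : 0 < j%:R / (deg x)%:R :> R by rewrite divr_gt0 // ltr0n.
have s1 : j%:R / (deg x)%:R <= 1 :> R by rewrite ler_pdivrMr // mul1r ler_nat.
by case: (b) => /=; split; lra.
Qed.

(** The plane through the leading values at [a], [b], [c] is below the leading function at [p] and
    at both base ends. It agrees at [a], a combination of these with positive weights, so it agrees
    at all three and is the plane of T_x. *)
Lemma nonray_lead x a b c d : C a -> C b -> C c -> C d -> uniq [:: a; b; c; d] ->
  a \in core x -> 0 < af (tco x false) (emb a) -> 0 < af (tco x true) (emb a) ->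
  af (lev x) (emb a) < 1 -> forall v, v \in [:: b; c; d] ->
  lead v = af (fan K dist_p x) (emb v).
Proof.
move=> Ca Cb Cc Cd; rewrite /= !inE !negb_or => /and4P[/and3P[ab ac ad] /andP[bc bd] cd _].
move=> ax t0 t1 l1; have abc := Carea Ca Cb Cc ab ac bc.
have [l [la lb lc]] := exists_interpolation (lead a) (lead b) (lead c) abc.
have depl v : dep lead a b c v = - (area a b c * (lead v - af l (emb v))).
  rewrite -[LHS]subr0 -(dep_af l a b c v) -depB /dep la lb lc !subrr.
  by rewrite !mulr0 subrr !add0r.
have le v : v \in core_pts -> af l (emb v) <= lead v.
  move=> vc; have := Clead Ca Cb Cc vc; rewrite depl mulrN oppr_le0 mulrA -expr2.
  by rewrite pmulr_rge0 ?subr_ge0 // lt_def sqrf_eq0 abc sqr_ge0.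
have lp : af l (emb p) <= 0 by rewrite -lead_p; apply: le; apply/core_ptsP; left.
have lq b' : af l (emb (q x b')) <= dist_p (q x b').
  rewrite -(fan_q H dist_p x b') -(lead_in (base_vtx_core H x b')).
  exact/le/core_sub/(base_vtx_core H).
have := la; rewrite (lead_in ax) (af_tco H l x false) (fanE K _ x false) => e.
have m0 := ler_wpM2l (ltW t0) (lq false); have m1 := ler_wpM2l (ltW t1) (lq true).
have s0 : 0 < 1 - af (lev x) (emb a) by rewrite subr_gt0.
have mp : (1 - af (lev x) (emb a)) * af l (emb p) <= 0 by rewrite pmulr_rle0.
have ep : af l (emb p) = 0 by apply: (mulfI (lt0r_neq0 s0)); rewrite mulr0; move: e => /=; lra.
have eq0 : af l (emb (q x false)) = dist_p (q x false).
  by apply: (mulfI (lt0r_neq0 t0)); move: e => /=; lra.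
have eq1 : af l (emb (q x true)) = dist_p (q x true).
  by apply: (mulfI (lt0r_neq0 t1)); move: e => /=; lra.
have lx : l = fan K dist_p x.
  apply: (af_eq3 (tri_neq0 H x false)); first by rewrite ep fan_p.
    by rewrite eq0 fan_q.
  by rewrite eq1 (fan_q H _ x true).
move=> v; rewrite !inE => /or3P[] /eqP->; rewrite -lx //.
have := Cdep Ca Cb Cc Cd (mem_head _ _) => /=; rewrite depl => /eqP.
by rewrite oppr_eq0 mulf_eq0 (negbTE abc) subr_eq0 => /eqP.
Qed.

(** The key of the level of [a] is not 0 at [a], so its dependency needs a second point [v] with the
    same level and [E]. By [nonray_lead] the point [v] is in T_x, and it turns out to be opposite to
    [a] on the other interior edge. *)
Lemma nonray_crossed x a b c d : C a -> C b -> C c -> C d -> uniq [:: a; b; c; d] ->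
  a \in core x -> 0 < af (tco x false) (emb a) -> 0 < af (tco x true) (emb a) ->
  af (lev x) (emb a) < 1 -> exists2 v, v \in [:: b; c; d] & crossed a v.
Proof.
move=> Ca Cb Cc Cd u ax t0 t1 l1; have ld := nonray_lead Ca Cb Cc Cd u ax t0 t1 l1.
have l0 : 0 < af (lev x) (emb a) by rewrite (levE K x false) addr_gt0.
set k := (E x, af (lev x) (emb a)).
have ka : crd (fun=> 0) (key k) a = 1.
  by rewrite (crd_key _ ax) /key !eqxx (gt_eqF l0) (lt_eqF l1).
have [v vs kv] : exists2 v, v \in [:: b; c; d] & crd (fun=> 0) (key k) v != 0.
  have := Cdep Ca Cb Cc Cd (key_coord ax); rewrite /dep /hcoord /= -/k ka => e.
  have bcd : area b c d != 0.
    move: u; rewrite /= !inE !negb_or => /and4P[_ /andP[bc bd] cd _].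
    exact: Carea.
  have [b0|b0] := eqVneq (crd (fun=> 0) (key k) b) 0; last by exists b; rewrite ?inE ?eqxx.
  have [c0|c0] := eqVneq (crd (fun=> 0) (key k) c) 0; last by exists c; rewrite ?inE ?eqxx ?orbT.
  exists d; rewrite ?inE ?eqxx ?orbT //; apply/eqP => d0.
  by move: e; rewrite b0 c0 d0 !mulr0 !subr0 addr0 mulr1 => e; rewrite e eqxx in bcd.
exists v => //; have Cv : C v by move: vs; rewrite !inE => /or3P[] /eqP->.
have av : a != v.
  move: u; rewrite /= !inE !negb_or => /and4P[/and3P[ab ac ad] _ _ _].
  by move: vs; rewrite !inE => /or3P[] /eqP->.
have vc := Ccore Cv; case/core_ptsP: (vc) => [vp|[y vy]].
  by move: kv; rewrite vp crd_key_p eqxx.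
move: kv; rewrite (crd_key _ vy) /key /=.
case: and4P => [[/eqP ey /eqP ly _ _] _|]; last by rewrite eqxx.
have fe : af (fan K dist_p x) (emb v) = af (fan K dist_p y) (emb v).
  by rewrite -(ld _ vs) (lead_in vy).
have [vx|vx] := boolP (v \in core x).
  have [lxy _ _] := core_consistent H vx vy.
  by apply: edge_pt_crossed av l0 l1 _ => //; rewrite lxy.
have [_ /(_ fe)[exy|vp|[b' adj]]] := fan_core_le H x vy.
- by rewrite exy vy in vx.
- by move: ly l0; rewrite vp lev_p => <-; rewrite ltxx.
have l01 : 0 < af (lev y) (emb v) < 1 by rewrite ly l0.
(* On a shared ray, equal [E] means that the ray is inner for [x], and then [ray_core] puts [v] in
   [core x]. *)
have := adjacent_potential hE adj vy l01; rewrite ey.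
have [i|_] := boolP (inner_ray K x (~~ b')); last by move/eqP; rewrite eqn_add2l.
have [t0' _ lxy _] := adjacent_tco H adj.
have a0 := inner_ray_apex H i; rewrite negbK in a0.
case/negP: vx; apply: (@ray_core _ _ _ H x (~~ b')); rewrite ?negbK //.
by rewrite lxy ly (core_lev_ge H ax) ltW.
Qed.

(* Position of a core point v on the ray through r. *)
Definition on_ray (r v : 'rV[int]_2) (s : R) : Prop :=
  [/\ 0 < s, s <= 1, emb v = emb p + s *: (emb r - emb p),
    exists y b, q y b = r &
    exists y, [/\ v \in core y, af (lev y) (emb v) = s &
      forall r', crd (fun u => (u == r')%:R) (fun _ _ => 0) v = (r == r')%:R * s]].

Lemma core_cases x v : v \in core x ->
  [/\ 0 < af (tco x false) (emb v), 0 < af (tco x true) (emb v) & af (lev x) (emb v) < 1]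
  \/ (v = p \/ exists r s, on_ray r v s).
Proof.
move=> vx; have t b := core_tco_ge0 H b vx.
have ray b : af (tco x (~~ b)) (emb v) = 0 -> v = p \/ exists r s, on_ray r v s.
  move=> t0; have [vp|vp] := eqVneq v p; first by left.
  right; exists (q x b), (af (tco x b) (emb v)).
  have lv : af (lev x) (emb v) = af (tco x b) (emb v) by rewrite (levE K x b) t0 addr0.
  have ev := tcoP H x b (emb v); rewrite t0 scale0r addr0 in ev.
  split.
  - rewrite lt_def t andbT; apply: contra vp => /eqP s0.
    by apply/eqP/(@emb_inj R); rewrite ev s0 scale0r addr0.
  - by rewrite -lv (core_lev_le1 H).
  - exact: ev.
  - by exists x, b.
  - exists x; split=> // r'; rewrite (crd_core H hE _ _ vx) // addr0 (fanE K _ x b).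
    by rewrite t0 mulr0 addr0.
have [t0|n0] := eqVneq (af (tco x true) (emb v)) 0; first by right; apply: (ray false).
have [t1|n1] := eqVneq (af (tco x false) (emb v)) 0; first by right; apply: (ray true).
have [l1|nl] := eqVneq (af (lev x) (emb v)) 1; last first.
  by left; split; rewrite ?lt_def ?n0 ?n1 ?t // eq_sym nl (core_lev_le1 H).
(* At level 1 an edge point is an end of the base, hence on a ray. *)
right; have /coreP[b [j jd ev]] := vx; apply: (ray b).
have -> : v = q x b.
  rewrite -(edge_pt_deg H) ev; congr (edge_pt _ _ _ _).
  move: jd; rewrite leq_eqVlt => /orP[/eqP//|/(lam_lt H x)].
  by rewrite -(lev_edge_pt H x b) -ev l1 ltNge (lam_le1 H).
by rewrite tco_q //; case: (b).
Qed.

Lemma ray_collinear r a b c s t u : on_ray r a s -> on_ray r b t -> on_ray r c u ->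
  area a b c = 0.
Proof.
move=> [_ _ ea _ _] [_ _ eb _ _] [_ _ ec _ _].
by rewrite areaE ea eb ec /cross !mxE; ring.
Qed.

Lemma ray_collinear_p r a b s t : on_ray r a s -> on_ray r b t -> area p a b = 0.
Proof.
move=> [_ _ ea _ _] [_ _ eb _ _].
by rewrite areaE ea eb /cross !mxE; ring.
Qed.

Lemma crd_key_ray r v s k : on_ray r v s -> exists e, crd (fun=> 0) (key k) v = key k e s.
Proof. by move=> [_ _ _ _ [y [vy <- _]]]; exists (E y); apply: crd_key. Qed.

Lemma key_level k e s : key k e s != 0 :> R -> s = k.2.
Proof. by rewrite /key; case: and4P => [[_ /eqP]|]; rewrite // eqxx. Qed.

Lemma key01 k e s : key k e s = 0 :> R \/ key k e s = 1 :> R.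
Proof. by rewrite /key; case: and4P; [right|left]. Qed.

(** Hats and keys force [sb = sd] and [sa = sc]. The segments from [b] to [d] and from [a] to [c]
    are then parallel, the first being shorter, so [a + (d - b)] is a lattice point inside the
    second. *)
Lemma rays_crossed a b c d r1 r2 sa sb sc sd : C a -> C b -> C c -> C d ->
  uniq [:: a; b; c; d] -> r1 != r2 ->
  on_ray r1 a sa -> on_ray r1 b sb -> on_ray r2 c sc -> on_ray r2 d sd ->
  sb < sa -> sd < sc -> crossed a c.
Proof.
move=> Ca Cb Cc Cd; rewrite /= !inE !negb_or => /and4P[/and3P[ab ac ad] /andP[bc bd] cd _].
move=> r12 ra rb rc rd sab scd.
have nA := Carea Cb Cc Cd bc bd cd; have nB := Carea Ca Cc Cd ac ad cd.
have nC := Carea Ca Cb Cd ab ad bd; have nD := Carea Ca Cb Cc ab ac bc.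
have [a0 a1 ea [ya [ba qa]] [za [_ la ha]]] := ra.
have [b0 b1 eb _ [zb [cb lb hb]]] := rb.
have [c0 c1 ec [yc [bc' qc]] [zc [_ lc hc]]] := rc.
have [d0 d1 ed _ [zd [cd' ld hd]]] := rd.
have sum0 : area b c d - area a c d + area a b d - area a b c = 0.
  by have := @dep_af R (afc 1) a b c d; rewrite /dep !af_c !mulr1.
have h1 : area b c d * sa - area a c d * sb = 0.
  have := Cdep Ca Cb Cc Cd (hat_coord ya ba); rewrite /dep /hcoord /= ha hb hc hd qa.
  by rewrite eqxx eq_sym (negbTE r12) !mul1r !mul0r !mulr0 addr0 subr0.
have h2 : area a b d * sc - area a b c * sd = 0.
  have := Cdep Ca Cb Cc Cd (hat_coord yc bc'); rewrite /dep /hcoord /= ha hb hc hd qc.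
  by rewrite eqxx (negbTE r12) !mul1r !mul0r !mulr0 subrr add0r.
have kb : crd (fun=> 0) (key (E zb, sb)) b = 1.
  by rewrite (crd_key _ cb) lb /key !eqxx (gt_eqF b0) lt_eqF ?(lt_le_trans sab).
have kd : crd (fun=> 0) (key (E zd, sd)) d = 1.
  by rewrite (crd_key _ cd') ld /key !eqxx (gt_eqF d0) lt_eqF ?(lt_le_trans scd).
have := Cdep Ca Cb Cc Cd (key_coord cb); rewrite /dep /hcoord /= lb kb.
have [ea' ->] := crd_key_ray (E zb, sb) ra; have [ec' ->] := crd_key_ray (E zb, sb) rc.
have [ed' ->] := crd_key_ray (E zb, sb) rd.
have -> : key (E zb, sb) ea' sa = 0 :> R.
  by apply/eqP/negPn/negP => /key_level /= e; rewrite e ltxx in sab.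
have := Cdep Ca Cb Cc Cd (key_coord cd'); rewrite /dep /hcoord /= ld kd.
have [fa ->] := crd_key_ray (E zd, sd) ra; have [fc ->] := crd_key_ray (E zd, sd) rc.
have [fb ->] := crd_key_ray (E zd, sd) rb.
have -> : key (E zd, sd) fc sc = 0 :> R.
  by apply/eqP/negPn/negP => /key_level /= e; rewrite e ltxx in scd.
rewrite !mulr0 !mulr1 addr0 sub0r => kkd kkb.
(* The key of level [sb] cannot be nonzero at [b] alone, nor that of level [sd] at [d] alone. The
   alternative [sc = sb] and [sa = sd] contradicts [sb < sa] and [sd < sc]. *)
have ebd : sb = sd.
  have [k1|/key_level //] := eqVneq (key (E zd, sd) fb sb : R) 0.
  have [k2|/key_level /= e1] := eqVneq (key (E zd, sd) fa sa : R) 0.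
    by move: kkd; rewrite k1 k2 !mulr0 subrr sub0r => /eqP; rewrite oppr_eq0 (negbTE nD).
  have [k3|/key_level /= -> //] := eqVneq (key (E zb, sb) ed' sd : R) 0.
  have [k4|/key_level /= e2] := eqVneq (key (E zb, sb) ec' sc : R) 0.
    by move: kkb; rewrite k3 k4 !mulr0 subr0 addr0 => /eqP; rewrite oppr_eq0 (negbTE nB).
  by exfalso; lra.
have k4 : key (E zb, sb) ec' sc = 0 :> R.
  by apply/eqP/negPn/negP => /key_level /= e; rewrite e ebd ltxx in scd.
have eBD : area a c d = - area a b c.
  move: kkb; rewrite k4 mulr0 addr0.
  case: (key01 (E zb, sb) ed' sd) => ->; rewrite ?mulr0 ?mulr1; last by lra.
  by rewrite subr0 => /eqP; rewrite oppr_eq0 (negbTE nB).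
have eAC : area b c d = - area a b d by lra.
have esac : sa = sc.
  apply: (mulfI nA); rewrite -ebd in h2; rewrite eBD eAC in h1; rewrite eAC; lra.
exists (1 - sb / sa).
  by rewrite subr_gt0 ltr_pdivrMr // mul1r sab gtrBl divr_gt0.
left; exists (a + (d - b)); rewrite embD embB ea eb ec ed -esac -ebd.
by apply: row2P; rewrite !mxE; field; rewrite gt_eqF.
Qed.

Let pt v := v = p \/ exists r s, on_ray r v s.

Lemma hat_pt r v : pt v -> crd (fun u => (u == r)%:R) (fun _ _ => 0) v != 0 -> exists s, on_ray r v s.
Proof.
move=> [->|[r' [s rs]]]; first by rewrite crd_p ?eqxx.
have [_ _ _ _ [y [_ _ h]]] := rs; rewrite h; have [<-|] := eqVneq r' r.
  by exists s.
by rewrite mul0r eqxx.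
Qed.

Lemma on_ray_base r v s : on_ray r v s -> exists y b, q y b = r.
Proof. by case. Qed.

Lemma on_ray_hat r v s : on_ray r v s ->
  crd (fun u => (u == r)%:R) (fun _ _ => 0) v = s.
Proof. by case=> _ _ _ _ [y [_ _ ->]]; rewrite eqxx mul1r. Qed.

Lemma on_ray_hat0 r r' v s : r != r' -> on_ray r v s ->
  crd (fun u => (u == r')%:R) (fun _ _ => 0) v = 0.
Proof. by move=> n [_ _ _ _ [y [_ _ ->]]]; rewrite (negbTE n) mul0r. Qed.

Lemma on_ray_inj r u v s t : on_ray r u s -> on_ray r v t -> u != v -> s != t.
Proof.
move=> [_ _ eu _ _] [_ _ ev _ _]; apply: contra => /eqP e.
by apply/eqP/(@emb_inj R); rewrite eu ev e.
Qed.

Let found := exists u v, [/\ C u, C v, u != v & crossed u v].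

(** No three points are collinear, so [c] is on another ray. The hat of that ray vanishes at [a] and
    [b], and its dependency needs [d] on that ray as well. *)
Lemma pair_crossed a b c d r sa sb : C a -> C b -> C c -> C d ->
  uniq [:: a; b; c; d] -> pt c -> pt d -> on_ray r a sa -> on_ray r b sb -> found.
Proof.
move=> Ca Cb Cc Cd u pc pd ra rb.
have := u; rewrite /= !inE !negb_or => /and4P[/and3P[ab ac ad] /andP[bc bd] cd _].
have nC := Carea Ca Cb Cd ab ad bd; have nD := Carea Ca Cb Cc ab ac bc.
case: pc => [ep|[r2 [sc rc]]].
  have pa : p != a by rewrite eq_sym -ep.
  have pb : p != b by rewrite eq_sym -ep.
  rewrite ep in Cc.
  by have := Carea Cc Ca Cb pa pb ab; rewrite (ray_collinear_p ra rb) eqxx.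
have r12 : r != r2.
  by apply: contra nD => /eqP e; rewrite -e in rc; rewrite (ray_collinear ra rb rc).
have [yc [bc' qc]] := on_ray_base rc.
have [sd rd] : exists s, on_ray r2 d s.
  have := Cdep Ca Cb Cc Cd (hat_coord yc bc'); rewrite /dep /hcoord /= qc.
  rewrite (on_ray_hat0 r12 ra) (on_ray_hat0 r12 rb) (on_ray_hat rc) !mulr0 subrr add0r => e.
  apply: (hat_pt pd).
  apply/eqP => e0; move/eqP: e; rewrite e0 mulr0 subr0 mulf_eq0 (negbTE nC) /=.
  by case: rc => s0 _ _ _ _; rewrite gt_eqF.
have uS (a' b' c' d' : 'rV[int]_2) : (a' \in [:: a; b]) && (b' \in [:: a; b]) ->
    (c' \in [:: c; d]) && (d' \in [:: c; d]) -> a' != b' -> c' != d' ->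
    uniq [:: a'; b'; c'; d'].
  rewrite !inE => /andP[/orP[]/eqP-> /orP[]/eqP->] /andP[/orP[]/eqP-> /orP[]/eqP->] //=;
    rewrite ?eqxx // => _ _;
    rewrite !inE !negb_or ?ab ?ac ?ad ?bc ?bd ?cd ?(eq_sym b a) ?(eq_sym d c) ?ab ?cd //.
have nab := on_ray_inj ra rb ab; have ncd := on_ray_inj rc rd cd.
have ba : b != a by rewrite eq_sym.
have dc : d != c by rewrite eq_sym.
case: (ltgtP sb sa) nab => // s1 _; case: (ltgtP sd sc) ncd => // s2 _.
- exists a, c; split=> //; apply: (rays_crossed (b := b) (d := d)) r12 ra rb rc rd s1 s2 => //.
- exists a, d; split=> //; apply: (rays_crossed (b := b) (d := c)) r12 ra rb rd rc s1 s2 => //.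
  by apply: uS; rewrite ?inE ?eqxx ?orbT.
- exists b, c; split=> //; apply: (rays_crossed (b := a) (d := d)) r12 rb ra rc rd s1 s2 => //.
  by apply: uS; rewrite ?inE ?eqxx ?orbT.
- exists b, d; split=> //; apply: (rays_crossed (b := a) (d := c)) r12 rb ra rd rc s1 s2 => //.
  by apply: uS; rewrite ?inE ?eqxx ?orbT.
Qed.

(** The hat of the ray of [a] cannot be nonzero at [a] alone, so a second point is on this ray. *)
Lemma ray_crossed a b c d r sa : C a -> C b -> C c -> C d ->
  uniq [:: a; b; c; d] -> pt b -> pt c -> pt d -> on_ray r a sa -> found.
Proof.
move=> Ca Cb Cc Cd u pb pc pd ra.
have := u; rewrite /= !inE !negb_or => /and4P[/and3P[ab ac ad] /andP[bc bd] cd _].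
have nA := Carea Cb Cc Cd bc bd cd; have [ya [ba qa]] := on_ray_base ra.
have := Cdep Ca Cb Cc Cd (hat_coord ya ba); rewrite /dep /hcoord /= qa (on_ray_hat ra) => e.
have sa0 : area b c d * sa != 0 by rewrite mulf_neq0 //; case: ra => s0 _ _ _ _; rewrite gt_eqF.
have [b0|/(hat_pt pb)[sb rb]] := eqVneq (crd (fun u => (u == r)%:R) (fun _ _ => 0) b) 0;
  last exact: pair_crossed Ca Cb Cc Cd u pc pd ra rb.
have [c0|/(hat_pt pc)[sc rc]] := eqVneq (crd (fun u => (u == r)%:R) (fun _ _ => 0) c) 0.
  have [d0|/(hat_pt pd)[sd rd]] := eqVneq (crd (fun u => (u == r)%:R) (fun _ _ => 0) d) 0.
    by case/negP: sa0; rewrite b0 c0 d0 !mulr0 !subr0 addr0 in e; rewrite e.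
  apply: pair_crossed Ca Cd Cb Cc _ pb pc ra rd.
  by rewrite /= !inE !negb_or ab ac ad bc (eq_sym d b) (eq_sym d c) bd cd.
apply: pair_crossed Ca Cc Cb Cd _ pb pd ra rc.
by rewrite /= !inE !negb_or ab ac ad (eq_sym c b) bc bd cd.
Qed.

Lemma four_core_points a b c d : C a -> C b -> C c -> C d ->
  uniq [:: a; b; c; d] -> found.
Proof.
move=> Ca Cb Cc Cd u.
have u1 : uniq [:: b; c; d; a] by rewrite -(rot_uniq 1) in u.
have u2 : uniq [:: c; d; a; b] by rewrite -(rot_uniq 2) in u.
have u3 : uniq [:: d; a; b; c] by rewrite -(rot_uniq 3) in u.
have cases a' b' c' d' : C a' -> C b' -> C c' -> C d' -> uniq [:: a'; b'; c'; d'] ->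
    found \/ pt a'.
  move=> Ca' Cb' Cc' Cd' u'; case/core_ptsP: (Ccore Ca') => [->|[x ax]]; first by right; left.
  case: (core_cases ax) => [[t0 t1 l1]|pa]; last by right.
  have [v vs av] := nonray_crossed Ca' Cb' Cc' Cd' u' ax t0 t1 l1.
  left; exists a', v; split=> //.
    by move: vs; rewrite !inE => /or3P[] /eqP->.
  by move: u' => /= /andP[+ _]; apply: contra => /eqP->.
have [//|pa] := cases _ _ _ _ Ca Cb Cc Cd u.
have [//|pb] := cases _ _ _ _ Cb Cc Cd Ca u1.
have [//|pc] := cases _ _ _ _ Cc Cd Ca Cb u2.
have [//|pd] := cases _ _ _ _ Cd Ca Cb Cc u3.
case: (pa) => [ap|[r [sa ra]]]; last exact: ray_crossed Ca Cb Cc Cd u pb pc pd ra.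
case: (pb) => [bp|[r [sb rb]]]; last exact: ray_crossed Cb Cc Cd Ca u1 pc pd pa rb.
by move: u; rewrite ap bp /= inE eqxx.
Qed.

End FourCorePoints.

(** * Heights of all lattice points *)

Section Heights.
Variables (R : realType) (X : toric_model R) (K : cut_data X).
Hypothesis H : cut_model K.
Local Notation affine := ('rV[R]_2 * R^o)%type.
Local Notation emb := (emb R).
Local Notation area := (area R).
Implicit Types (x y z : exc X) (v : 'rV[int]_2) (l : affine).

Local Notation p := (base_pt X).
Local Notation dco := (dco K).
Local Notation dlev := (dlev K).
Local Notation core := (core K).
Local Notation core_pts := (core_pts K).
Local Notation deg := (int_edge_len K).
Local Notation verts := (verts X).

Lemma core_heights : exists h : 'rV[int]_2 -> R,
 [/\ forall x k, (k < deg x)%N -> exists2 l, minorant (core_pts ++ verts) h l &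
       forall v, v \in core_pts ++ verts ->
         (af l (emb v) == h v) = (v \in std_corners K x k),
    exists2 l, minorant (core_pts ++ verts) h l &
       forall v, v \in core_pts ++ verts -> (af l (emb v) == h v) = (v == p)
  & forall l (C : pred 'rV[int]_2), minorant core_pts h l ->
      (forall v, C v -> v \in core_pts /\ af l (emb v) = h v) ->
      (forall a b c, C a -> C b -> C c -> a != b -> a != c -> b != c -> area a b c != 0) ->
      forall a b c d, C a -> C b -> C c -> C d -> uniq [:: a; b; c; d] ->
      exists u v, [/\ C u, C v, u != v & crossed K u v]].
Proof.
have [E hE] := inner_potential H; have [B [B0 hB]] := exists_big K.
have [w [w1 w2 w3 w4]] := hcoord_weights H hE B0 hB.
pose h v := wsum w [seq hcoord K E B i v | i <- hcoords K E]; exists h.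
have diffE (L : option _ -> affine) v :
    wsum w [seq hcoord K E B i v - af (L i) (emb v) | i <- hcoords K E] =
    h v - af (awsum w (map L (hcoords K E))) (emb v).
  rewrite af_awsum -[X in _ = _ - X]mul1r -[RHS]addrC -mulNr -wsum_mapZ addrC -wsum_mapD.
  by congr wsum; apply: eq_map => i; rewrite mulN1r.
split.
- move=> x k kd; pose l := awsum w [seq hcoord_form K E i x k | i <- hcoords K E].
  have lt v : v \in core_pts ++ verts -> v \notin std_corners K x k -> 0 < h v - af l (emb v).
    by move=> vV vk; rewrite -diffE; apply: w1.
  have eq v : v \in std_corners K x k -> af l (emb v) = h v.
    move=> vk; rewrite af_awsum; congr wsum; apply/eq_in_map => i ii.
    by rewrite -(hcoord_corner H hE B ii kd vk).
  exists l => [v vV|v vV].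
    by have [/eq->//|vk] := boolP (v \in std_corners K x k); rewrite -subr_ge0 ltW // lt.
  have [/eq->|vk] := boolP (v \in std_corners K x k); first exact: eqxx.
  by apply/negbTE; rewrite lt_eqF // -subr_gt0 lt.
- have hp : h p = 0.
    have e : [seq hcoord K E B i p | i <- hcoords K E] = [seq 0 * 0 | i <- hcoords K E].
      by apply/eq_in_map => i ii; rewrite mul0r; apply: hcoord_p ii.
    by rewrite /h e wsum_mapZ mul0r.
  exists 0 => [v vV|v vV]; rewrite af0.
    by have [->|vp] := eqVneq v p; rewrite ?hp // ltW // w2.
  by have [->|vp] := eqVneq v p; rewrite ?hp ?eqxx // lt_eqF // w2.
move=> l C lh Ch Ca a b c d ha hb hc hd u.
have depE a' b' c' d' : wsum w [seq dep (hcoord K E B i) a' b' c' d' | i <- hcoords K E] =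
    dep h a' b' c' d' by rewrite wsum_dep.
have depl a' b' c' d' : C a' -> C b' -> C c' ->
    dep h a' b' c' d' = - (area a' b' c' * (h d' - af l (emb d'))).
  move=> /Ch[_ ea] /Ch[_ eb] /Ch[_ ec].
  rewrite -[LHS]subr0 -(@dep_af R l a' b' c' d') -depB /dep ea eb ec !subrr.
  by rewrite !mulr0 subrr !add0r.
apply: (four_core_points H hE _ _ _ Ca ha hb hc hd u (B := B)).
- by move=> v /Ch[].
- move=> a' b' c' d' ha' hb' hc' hd' i ii.
  have [ca ea] := Ch _ ha'; have [cb eb] := Ch _ hb'.
  have [cc ec] := Ch _ hc'; have [cd ed] := Ch _ hd'.
  by apply: w3 => //; rewrite depE depl // ed subrr mulr0 oppr0.
- move=> a' b' c' ha' hb' hc' v vc.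
  have [ca _] := Ch _ ha'; have [cb _] := Ch _ hb'; have [cc _] := Ch _ hc'.
  have [pos neg] := w4 _ _ _ _ ca cb cc vc; rewrite depE depl // in pos neg.
  have hv : 0 <= h v - af l (emb v) by rewrite subr_ge0 lh.
  have [s|s] := leP 0 (area a' b' c').
    by rewrite mulr_ge0_le0 // neg // oppr_le0 mulr_ge0.
  by rewrite nmulr_rle0 // pos // oppr_ge0 mulr_le0_ge0 // ltW.
Qed.

Lemma polygon_lattice_pts : exists s : seq 'rV[int]_2, forall v,
  momentum_polygon X (emb v) -> v \in s.
Proof.
pose B := (\sum_i (`|@vert R X i 0%R 0%R| + `|@vert R X i 0%R 1%R|))%N.
pose r := [seq (n%:Z - B%:Z) | n <- iota 0 (B + B).+1].
have rP (a : int) : - B%:Z <= a <= B%:Z -> a \in r.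
  move=> aB; apply/mapP; exists (absz (a + B%:Z)); rewrite ?mem_iota; lia.
have vB (i : 'I_(nsides X)) (k : 'I_2) : (`|vert i 0%R k| <= B)%N.
  rewrite /B (bigD1 i) //=; move: (\sum_(_ | _) _)%N => S.
  case: k => [[|[|//]] hk].
    by rewrite (_ : Ordinal hk = 0); [lia | apply/val_inj].
  by rewrite (_ : Ordinal hk = 1); [lia | apply/val_inj].
exists [seq vec2 a b | a <- r, b <- r] => v Pv.
have bnd (k : 'I_2) : - B%:Z <= v 0 k <= B%:Z.
  have pos (s : R) : s = 1 \/ s = - 1 -> 0 <= B%:R + s * emb v 0 k.
    move=> hs; pose l : affine := (\row_j (if j == k then s else 0), B%:R).
    have lE u : af l u = B%:R + s * u 0 k.
      rewrite afE /dot !mxE /= addrC; congr (_ + _).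
      case: k {l} => [[|[|//]] hk].
        rewrite (_ : Ordinal hk = 0); last exact/val_inj.
        by rewrite eqxx /= mul0r addr0.
      rewrite (_ : Ordinal hk = 1); last exact/val_inj.
      by rewrite eqxx /= mul0r add0r.
    rewrite -lE; have [|//] := hull_face (l := l) Pv.
    move=> _ /mapP[i _ ->]; rewrite lE mxE.
    have : `|vert i 0 k|%:~R <= B%:R :> R by rewrite -[B%:R]/(B%:Z%:~R) ler_int; have := vB i k; lia.
    rewrite intr_norm => hb.
    have : `|s * (vert i 0 k)%:~R| <= B%:R by case: hs => ->; rewrite ?mul1r ?mulN1r ?normrN.
    by rewrite ler_norml => /andP[]; lra.
  have := pos 1 (or_introl erefl); have := pos (-1) (or_intror erefl).
  rewrite mul1r mulN1r mxE -[B%:R]/(B%:Z%:~R) => h1 h2.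
  rewrite -!(ler_int R) rmorphN /=; apply/andP; split; lra.
apply/allpairsP; exists (v 0 0, v 0 1); split; [exact/rP/bnd | exact/rP/bnd|].
by apply: row2P; rewrite mxE.
Qed.

(** A vertex of the polygon is extreme, so it is a vertex of any Delta_x that contains it. *)
Lemma vert_cut_core (i : 'I_(nsides X)) x : cut_triangle K x (emb (vert i)) -> vert i \in core x.
Proof.
pose l := side_form (ord_pred i) + side_form i : affine => hv.
have Pq : forall v, v \in [:: base_start K x; base_end K x; cut_apex K x] ->
    momentum_polygon X (emb v) /\ v \in core x.
  move=> v; rewrite !inE => /or3P[] /eqP->.
  - by split; [exact: (base_polygon H x false) | exact: (base_vtx_core H x false)].
  - by split; [exact: (base_polygon H x true) | exact: (base_vtx_core H x true)].
  - split; last exact: apex_core.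
    by apply: (cut_sub_polygon H (x := x)); apply: hull_mem; rewrite /= !inE eqxx !orbT.
have lv : af l (emb (vert i)) = 0.
  rewrite afD !side_formE (lattice_dist_vert i) addr0.
  by have := lattice_dist_vertS H (ord_pred i); rewrite ord_predK => ->.
have [|_ /(_ lv)] := hull_face (l := l) hv.
  move=> _ /mapP[v /Pq[Pv _] ->]; rewrite afD addr_ge0 //; exact: (side_form_ge0 H).
case e : [seq v <- _ | _] => [|u s]; first by move/hull_nil.
move=> _.
have : u \in u :: s by rewrite mem_head.
rewrite -e mem_filter => /andP[/eqP lu /mapP[v /Pq[Pv vx] ev]].
rewrite ev /l afD in lu; have /(@emb_inj R) <- := vert_extreme H Pv lu.
exact: vx.
Qed.

Lemma core_pts_polygon v : v \in core_pts -> momentum_polygon X (emb v).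
Proof.
case/core_ptsP => [->|[x vx]]; first exact: (base_pt_polygon H).
exact: (cut_sub_polygon H (core_cut H vx)).
Qed.

Lemma corner_core x k v : (k < deg x)%N -> v \in std_corners K x k -> v \in core x.
Proof.
move=> kd; rewrite !inE => vk; apply/coreP; case/or4P: vk => /eqP->.
- by exists false, k => //; apply: ltnW.
- by exists false, k.+1.
- by exists true, k => //; apply: ltnW.
- by exists true, k.+1.
Qed.

(* The lattice points at which heights are prescribed. *)
Lemma exists_vertex_set : exists V : seq 'rV[int]_2,
  [/\ hull (map emb V) = momentum_polygon X, {subset core_pts ++ verts <= V},
      (forall v, v \in V -> v \notin core_pts -> momentum_polygon X (emb v) /\
         forall x, ~ cut_triangle K x (emb v))
    & forall v, momentum_polygon X (emb v) -> v \notin V ->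
         v \notin core_pts /\ exists x, cut_triangle K x (emb v)].
Proof.
have [s hs] := polygon_lattice_pts.
pose P v := `[< momentum_polygon X (emb v) >] && `[< forall x, ~ cut_triangle K x (emb v) >].
pose V := core_pts ++ [seq v <- s | P v]; exists V.
have vV : {subset core_pts ++ verts <= V}.
  move=> v; rewrite !mem_cat => /orP[->//|/mapP[i _ ev]].
  have [//|vc /=] := boolP (v \in core_pts); rewrite mem_filter ev hs ?andbT.
    apply/andP; split; apply/asboolP; first exact: polygon_vert.
    move=> x /vert_cut_core vx; case/negP: vc; rewrite ev.
    by apply/core_ptsP; right; exists x.
  exact: polygon_vert.
have VP v : v \in V -> momentum_polygon X (emb v).
  rewrite mem_cat mem_filter => /orP[/core_pts_polygon//|].
  by case/andP => /andP[/asboolP].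
split=> //.
- apply/seteqP; split=> a.
    by apply: hull_hull => _ /mapP[v /VP + ->].
  apply: hull_hull => _ /mapP[i _ ->]; apply/hull_mem/map_f/vV.
  by rewrite mem_cat; apply/orP; right; apply: map_f; rewrite mem_enum.
- move=> v; rewrite mem_cat mem_filter => /orP[->//|].
  by case/andP => /andP[/asboolP Pv /asboolP Tv] _ _.
- move=> v Pv; rewrite mem_cat negb_or mem_filter negb_and hs // orbF => /andP[vc].
  rewrite negb_and => /orP[/asboolPn//|/asboolPn nT]; split=> //.
  by apply: contra_notP nT => nx x Tx; apply: nx; exists x.
Qed.

Lemma std_corners_cut x k v : (k < deg x)%N ->
  hull (map emb (std_corners K x k)) (emb v) -> cut_triangle K x (emb v).
Proof.
move=> kd; rewrite -standard_cellE // => sv; rewrite (cut_triangle_cells H).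
by exists (standard_cell K x k) => //; exists k.
Qed.

(* Every core point is a vertex of a standard cell: it is the only zero on that
   cell of a coordinate plus a distance to a level. *)
Lemma edge_pt_used V (h : 'rV[int]_2 -> R) x b j : (j <= deg x)%N ->
  {subset core x <= V} ->
  (forall k, (k < deg x)%N -> exists2 l, minorant V h l &
    contact V h l =i std_corners K x k) ->
  used V h (edge_pt K x b j).
Proof.
move=> jd cV hk; have d0 : 0 < (deg x)%:R :> R by rewrite ltr0n (deg_gt0 H).
have [k kd [e [jk es]]] : exists2 k, (k < deg x)%N &
    exists e : R, (j = k \/ j = k.+1) /\
      ((j = k /\ e = 1) \/ (j = k.+1 /\ e = -1)).
  move: jd; rewrite leq_eqVlt => /orP[/eqP->|jd].
    exists (deg x).-1; first by rewrite prednK ?(deg_gt0 H).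
    exists (-1); rewrite prednK ?(deg_gt0 H) //; split; first by right.
    by right.
  exists j => //; exists 1; split; first by left.
  by left.
have [l lV lk] := hk k kd.
pose y : affine := dco x (~~ b) + e *: (dlev x - afc (j%:R / (deg x)%:R)).
have yE b' i : af y (emb (edge_pt K x b' i)) =
    (~~ b == b')%:R * (i%:R / (deg x)%:R) + e * ((i%:R - j%:R) / (deg x)%:R).
  by rewrite afD afZ afB af_c dco_edge_pt // dlev_edge_pt // mulrBl.
have pts v : v \in std_corners K x k -> exists b' i, (i = k \/ i = k.+1) /\ v = edge_pt K x b' i.
  rewrite !inE => /or4P[] /eqP->.
  - by exists false, k; split; [left|].
  - by exists false, k.+1; split; [right|].
  - by exists true, k; split; [left|].
  - by exists true, k.+1; split; [right|].
have d1 : 0 < (deg x)%:R^-1 :> R by rewrite invr_gt0.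
have key i : (i = k \/ i = k.+1) ->
    0 <= e * ((i%:R - j%:R) / (deg x)%:R) /\ (e * ((i%:R - j%:R) / (deg x)%:R) = 0 -> i = j).
  move=> ik; rewrite mulrA; case: es => -[-> ->]; case: ik => ->.
  - by rewrite subrr mulr0 mul0r.
  - rewrite -natr1 addrAC subrr add0r !mul1r; split; first exact: ltW.
    by move=> z; rewrite z ltxx in d1.
  - rewrite -natr1 opprD addrA subrr sub0r mulrNN !mul1r; split; first exact: ltW.
    by move=> z; rewrite z ltxx in d1.
  - by rewrite subrr mulr0 mul0r.
have t0 b' i : 0 <= (~~ b == b')%:R * (i%:R / (deg x)%:R) :> R.
  by rewrite mulr_ge0 ?ler0n // divr_ge0 // ltW.
have [v|a a0 [sl' cl']] := @tilt R V h l y lV.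
  rewrite lk => /pts[b' [i [ik ->]]]; rewrite yE addr_ge0 //.
  by have [] := key i ik.
exists (l - a *: y) => // v; rewrite cl' mem_filter lk inE; apply/andP/eqP.
  move=> [/eqP y0 /pts[b' [i [ik ev]]]]; move: y0; rewrite ev yE => /eqP.
  have [k0 k1] := key i ik.
  rewrite paddr_eq0 // => /andP[+ /eqP/k1 ij]; rewrite ij mulf_eq0 => /orP[|].
    by case: b b' {yE t0 y sl' cl' k0 k1 ev key} => [] [] //=; rewrite oner_eq0.
  rewrite mulf_eq0 invr_eq0 (gt_eqF d0) orbF pnatr_eq0 => /eqP ->.
  by rewrite !edge_pt0.
move=> ->; split.
  by rewrite yE subrr mul0r mulr0 addr0; case: (b); rewrite mul0r.
have : edge_pt K x b j \in std_corners K x k.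
  by rewrite !inE; case: jk => ->; case: (b); rewrite eqxx ?orbT.
by [].
Qed.

(** [phi] extends the core heights by their lower hull; [f1], of smaller weight, makes the points
    outside the core vertices of the subdivision without disturbing the strips; the indicators
    perturb each of these points independently. *)
Lemma polygon_heights : exists (V : seq 'rV[int]_2) (h : 'rV[int]_2 -> R),
 [/\ hull (map emb V) = momentum_polygon X,
    forall v, momentum_polygon X (emb v) -> v \notin V ->
      v \notin core_pts /\ exists x, cut_triangle K x (emb v),
    forall x k, (k < deg x)%N -> exists2 l, minorant V h l &
      contact V h l =i std_corners K x k,
    forall v, v \in V -> used V h v
  & forall l a b c d, minorant V h l -> a \in contact V h l -> b \in contact V h l ->
      c \in contact V h l -> d \in contact V h l -> uniq [:: a; b; c; d] ->
      exists u v, [/\ u \in contact V h l, v \in contact V h l, u != v & crossed K u v]].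
Proof.
have [V [hV sV nV mV]] := exists_vertex_set.
have [h3 [S1 [l2 lp2 e2] S3]] := core_heights.
pose V3 := core_pts ++ verts.
have cV v : v \in core_pts -> v \in V by move=> vc; apply: sV; rewrite mem_cat vc.
have c3 v : v \in core_pts -> v \in V3 by move=> vc; rewrite mem_cat vc.
have coreC x v : v \in core x -> v \in core_pts.
  by move=> vx; apply/core_ptsP; right; exists x.
have V3P v : v \in V -> hull (map emb V3) (emb v).
  move=> vV; have : momentum_polygon X (emb v).
    have [/core_pts_polygon//|vc] := boolP (v \in core_pts).
    by case: (nV v vV vc).
  by apply: hull_sub => _ /mapP[i _ ->]; apply: map_f; rewrite mem_cat;
    apply/orP; right; apply: map_f; rewrite mem_enum.
pose phi v := height V3 h3 (emb v).
have phi_ge l v : v \in V -> minorant V3 h3 l -> af l (emb v) <= phi v.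
  by move=> vV sl; apply: height_ge => //; apply: V3P.
have phi_eq l v : v \in V -> minorant V3 h3 l -> phi v = af l (emb v) ->
    cell V3 h3 l (emb v).
  by move=> vV sl e; apply: cell_height => //; apply: V3P.
have phi_touch l v : minorant V3 h3 l -> v \in V3 -> af l (emb v) = h3 v -> phi v = h3 v.
  move=> sl v3 e; rewrite -e; apply: height_cell => //.
  by apply/hull_mem/map_f/contactP.
have phi_core v : v \in core_pts -> phi v = h3 v.
  move=> vc; case/core_ptsP: (vc) => [vp|[x /coreP[b [j jd ev]]]].
    by apply: (phi_touch _ _ lp2 (c3 v vc)); apply/eqP; rewrite e2 ?vp ?eqxx ?c3 // -vp.
  have [k kd vk] : exists2 k, (k < deg x)%N & v \in std_corners K x k.
    move: jd; rewrite leq_eqVlt => /orP[/eqP ej|jd].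
      exists (deg x).-1; first by rewrite prednK ?(deg_gt0 H).
      by rewrite !inE prednK ?(deg_gt0 H) // ev ej; case: (b); rewrite eqxx ?orbT.
    by exists j => //; rewrite !inE ev; case: (b); rewrite eqxx ?orbT.
  have [l sl el] := S1 x k kd; apply: (phi_touch _ _ sl (c3 v vc)).
  by apply/eqP; rewrite el ?c3.
pose N := [seq v <- V | v \notin core_pts].
pose Q v : R := dot (emb v) (emb v).
pose tang v : affine := (2 *: emb v, - Q v).
have tangE v u : af (tang v) (emb u) = Q u - dot (emb u - emb v) (emb u - emb v).
  by rewrite afE /= /Q /dot !mxE; ring.
pose M : R := 1 + \sum_(v <- V) \sum_(u <- V) `|af (tang v) (emb u)|.
have hM v u : v \in V -> u \in V -> af (tang v) (emb u) < M.
  move=> vV uV; have s0 (r : seq 'rV[int]_2) (F : 'rV[int]_2 -> R) : 0 <= \sum_(i <- r) `|F i|.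
    by apply: sumr_ge0.
  have : `|af (tang v) (emb u)| <= \sum_(v <- V) \sum_(u <- V) `|af (tang v) (emb u)|.
    rewrite (big_rem v) //= (big_rem u) //= -addrA lerDl addr_ge0 ?s0 //.
    by apply: sumr_ge0 => i _; apply: s0.
  by move=> /(le_trans (ler_norm _)); rewrite /M; lra.
(* [M] exceeds all tangents of the paraboloid on [V], so a tangent at a point outside the core,
   lowered by [M], is below the value 0 on the core. *)
pose f1 v : R := if v \in core_pts then 0 else Q v - M.
pose hc (i : nat + 'rV[int]_2) v : R :=
  match i with inl 0%N => phi v | inl _ => f1 v | inr n => (v == n)%:R end.
pose I : seq (nat + 'rV[int]_2) := inl 0%N :: inl 1%N :: map inr N.
pose form (l0 l1 : affine) (lN : 'rV[int]_2 -> R) (i : nat + 'rV[int]_2) : affine :=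
  match i with inl 0%N => l0 | inl _ => l1 | inr n => afc (lN n) end.
pose D L v := [seq hc i v - af (L i) (emb v) | i <- I].
pose T := (nat + 'rV[int]_2 -> affine)%type.
have good_strip x k : (k < deg x)%N -> exists L : T,
    (forall v, v \in V -> v \notin std_corners K x k -> lexpos (D L v)) /\
    (forall v, v \in std_corners K x k -> forall i, i \in I -> hc i v = af (L i) (emb v)).
  move=> kd; have [l sl el] := S1 x k kd; exists (form l 0 (fun=> 0)); split.
    move=> v vV vk; rewrite /D /I /=; apply/orP; left.
    (* A tie would put [v] in the strip: a core point would then be a corner, and a point outside
       the core would be in Delta_x. *)
    rewrite subr_gt0 lt_neqAle phi_ge // andbT; apply/negP => /eqP e.
    have sv := phi_eq l v vV sl (esym e).
    have [vc|vc] := boolP (v \in core_pts).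
      by move: e; rewrite phi_core // => /eqP; rewrite el ?c3 // (negbTE vk).
    have [_ /(_ x)] := nV v vV vc; apply; apply: (std_corners_cut kd).
    apply: hull_sub sv => _ /mapP[u /contactP[u3 /eqP] + ->]; rewrite el //.
    exact: map_f.
  move=> v vk; have vc := coreC _ _ (corner_core kd vk).
  have vN n : n \in N -> (v == n) = false.
    by rewrite mem_filter => /andP[nc _]; apply/negbTE; apply: contra nc => /eqP <-.
  move=> i; rewrite !inE => /or3P[/eqP->|/eqP->|/mapP[n nN ->]] /=.
  - by rewrite phi_core //; apply/esym/eqP; rewrite el ?c3.
  - by rewrite /f1 vc af0.
  - by rewrite vN // af_c.
have good_p : exists L : T,
    (forall v, v \in V -> v \notin [:: p] -> lexpos (D L v)) /\
    (forall v, v \in [:: p] -> forall i, i \in I -> hc i v = af (L i) (emb v)).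
  have pc : p \in core_pts by apply/core_ptsP; left.
  exists (form l2 0 (fun=> 0)); split.
    move=> v vV vk; rewrite /D /I /=; apply/orP; left; rewrite inE in vk.
    rewrite subr_gt0 lt_neqAle phi_ge // andbT; apply/negP => /eqP e.
    have sv := phi_eq l2 v vV lp2 (esym e).
    have : hull [:: emb p] (emb v).
      apply: hull_sub sv => _ /mapP[u /contactP[u3 /eqP] + ->]; rewrite e2 // => /eqP->.
      by rewrite mem_head.
    by move=> /(@hull1 R)/(@emb_inj R) vp; rewrite vp eqxx in vk.
  move=> v; rewrite inE => /eqP->.
  have vN n : n \in N -> (p == n) = false.
    by rewrite mem_filter => /andP[nc _]; apply/negbTE; apply: contra nc => /eqP <-.
  move=> i; rewrite !inE => /or3P[/eqP->|/eqP->|/mapP[n nN ->]] /=.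
  - by rewrite phi_core //; apply/esym/eqP; rewrite e2 ?c3.
  - by rewrite /f1 pc af0.
  - by rewrite vN // af_c.
have good_n n : n \in V -> n \notin core_pts -> exists L : T,
    (forall v, v \in V -> v \notin [:: n] -> lexpos (D L v)) /\
    (forall v, v \in [:: n] -> forall i, i \in I -> hc i v = af (L i) (emb v)).
  move=> nVn nc; have [l sl ln] := support_exists h3 (V3P n nVn).
  exists (form l (tang n - afc M) (fun m => (n == m)%:R)); split.
    move=> v vV; rewrite inE => vn; rewrite /D /I /=.
    (* Ties of [phi] are broken by [f1], whose tangent plane at [n] touches only at [n]. *)
    have := phi_ge l v vV sl; rewrite -subr_ge0 le_eqVlt => /orP[/eqP<-|->] //.
    rewrite ltxx eqxx /=; apply/orP; left; rewrite /f1.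
    have [vc|vc] := boolP (v \in core_pts).
      by rewrite afB af_c sub0r opprB subr_gt0 hM.
    have -> : Q v - M - af (tang n - afc M) (emb v) = dot (emb v - emb n) (emb v - emb n).
      by rewrite afB af_c tangE; ring.
    rewrite lt_def dot_ge0 andbT; apply: contra vn.
    rewrite /dot -!expr2 paddr_eq0 ?sqr_ge0 // !sqrf_eq0 => /andP[/eqP e0 /eqP e1].
    by apply/eqP/(@emb_inj R)/eqP; rewrite -subr_eq0; apply/eqP/row2P; rewrite [RHS]mxE.
  move=> v; rewrite inE => /eqP-> i.
  rewrite !inE => /or3P[/eqP->|/eqP->|/mapP[m mN ->]] /=.
  - exact: height_cell.
  - by rewrite /f1 (negbTE nc) afB af_c tangE subrr /dot !mxE !mul0r addr0 subr0.
  - by rewrite af_c.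
pose good (C : seq 'rV[int]_2) (L : T) := (forall v, v \in V -> v \notin C -> lexpos (D L v)) /\
  (forall v, v \in C -> forall i, i \in I -> hc i v = af (L i) (emb v)).
pose strips := [seq std_corners K xk.1 xk.2 |
  xk <- [seq (x, k) | x <- enum (exc X), k <- iota 0 (deg x)]].
pose Cs := strips ++ [:: p] :: [seq [:: n] | n <- N].
have stripsP C : C \in strips -> exists x k, (k < deg x)%N /\ C = std_corners K x k.
  case/mapP => -[x k] /allpairsPdep[y [j [_ + [-> ->]]]] ->.
  by rewrite mem_iota add0n /= => jd; exists y, j.
have CsV C : C \in Cs -> {subset C <= V}.
  rewrite mem_cat inE => /or3P[/stripsP[x [k [kd ->]]] v /(corner_core kd)/coreC/cV//||].
    by move=> /eqP-> v; rewrite inE => /eqP->; apply/cV/core_ptsP; left.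
  by move=> /mapP[n + ->] v; rewrite mem_filter inE => /andP[_ nVn] /eqP->.
have [L hL] : exists L : seq 'rV[int]_2 -> T, forall C, C \in Cs -> good C (L C).
  suff : forall C, exists L : T, C \in Cs -> good C L by move=> /choice[L hL]; exists L.
  move=> C; have [|_] := boolP (C \in Cs); last by exists (fun=> 0).
  rewrite mem_cat inE => /or3P[/stripsP[x [k [kd ->]]]|/eqP->|/mapP[n + ->]].
  - by have [L hL] := good_strip x k kd; exists L.
  - by have [L hL] := good_p; exists L.
  - by rewrite mem_filter => /andP[nc nVn]; have [L hL] := good_n n nVn nc; exists L.
pose quads := [seq (r, s) | r <- [seq (a, b) | a <- V, b <- V],
                            s <- [seq (a, b) | a <- V, b <- V]].
pose depI (r : ('rV[int]_2 * 'rV[int]_2) * ('rV[int]_2 * 'rV[int]_2)) :=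
  [seq dep (hc i) r.1.1 r.1.2 r.2.1 r.2.2 | i <- I].
have wz (w c : seq R) : all (pred1 0) c -> wsum w c = 0.
  by elim: c w => [|t c ih] [|e w] //= /andP[/eqP-> /ih->]; rewrite mulr0 addr0.
have wn0 (w : seq R) n : wsum w (nseq n 0) = 0 by rewrite wz // all_pred1_nseq.
pose n0 := size (map inr N : seq (nat + 'rV[int]_2)).
(* The vector [1 :: nseq n0.+1 0] makes the first weight positive, so that on the core [h] is a
   positive multiple of [h3]. *)
pose cs := (1 :: nseq n0.+1 0) :: [seq D (L C) v | C <- Cs, v <- V]
   ++ map depI quads ++ [seq map -%R (depI r) | r <- quads].
have [c|w sw hw] := @lex_weights R n0.+2 cs.
  rewrite inE !mem_cat => /or4P[/eqP->|/allpairsP[[C v] [_ _ ->]]|/mapP[r _ ->]|/mapP[r _ ->]].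
  - by rewrite /= size_nseq.
  - by rewrite size_map.
  - by rewrite size_map.
  - by rewrite !size_map.
pose h v := wsum w [seq hc i v | i <- I].
pose ell C : affine := awsum w (map (L C) I).
have diffE C v : h v - af (ell C) (emb v) = wsum w (D (L C) v).
  rewrite af_awsum -[X in _ - X]mul1r -mulNr -wsum_mapZ -wsum_mapD.
  by congr wsum; apply: eq_map => i; rewrite mulN1r.
have touch C : C \in Cs -> exists2 l, minorant V h l & contact V h l =i C.
  move=> CC; have [h1 h2] := hL C CC.
  have pos v : v \in V -> v \notin C -> 0 < h v - af (ell C) (emb v).
    move=> vV vC; rewrite diffE; apply: hw; last exact: h1.
    rewrite inE mem_cat; apply/or3P; constructor 2.
    by apply/allpairsP; exists (C, v).
  have zero v : v \in C -> h v - af (ell C) (emb v) = 0.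
    move=> vC; rewrite diffE wz //; apply/allP => _ /mapP[i iI ->] /=.
    by rewrite (h2 v vC i iI) subrr.
  exists (ell C).
    move=> v vV; have [/zero/eqP|vC] := boolP (v \in C).
      by rewrite subr_eq0 => /eqP->.
    by rewrite -subr_ge0 ltW // pos.
  move=> v; apply/contactP/idP.
    move=> [vV e]; apply/negPn/negP => /(pos v vV).
    by rewrite e subrr ltxx.
  by move=> vC; split; [apply: CsV vC | apply/eqP; rewrite eq_sym -subr_eq0 zero].
have usedV v : v \in V -> used V h v.
  move=> vV; have usedC : [:: v] \in Cs -> used V h v.
    by move=> /touch[l lV lv]; exists l => // u; rewrite lv !inE.
  have [vc|vc] := boolP (v \in core_pts); last first.
    apply: usedC; rewrite mem_cat inE; apply/or3P; constructor 3.
    by rewrite map_f // mem_filter vc.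
  case/core_ptsP: vc => [vp|[x vx]].
    by apply: usedC; rewrite vp mem_cat mem_head orbT.
  case/coreP: (vx) => b [j jd ->]; apply: edge_pt_used => //.
    by move=> u /coreC/cV.
  move=> k kd; apply: touch; rewrite mem_cat; apply/orP; left.
  apply/mapP; exists (x, k) => //; apply/allpairsPdep; exists x, k.
  by rewrite mem_enum mem_iota add0n.
exists V, h; split=> //.
  move=> x k kd; apply: touch; rewrite mem_cat; apply/orP; left.
  apply/mapP; exists (x, k) => //; apply/allpairsPdep; exists x, k.
  by rewrite mem_enum mem_iota add0n.
move=> l a b c d lV la lb lc ld u4.
have areaN a' b' c' : a' \in contact V h l -> b' \in contact V h l ->
    c' \in contact V h l -> a' != b' -> a' != c' -> b' != c' -> area a' b' c' != 0.
  by move=> *; apply: (used_area usedV lV).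
have inV v : v \in contact V h l -> v \in V by move=> /contactP[].
have hl v : v \in contact V h l -> h v = af l (emb v) by move=> /contactP[].
have hcore v : v \in core_pts -> h v = head 0 w * h3 v.
  move=> vc; rewrite /h /I; case: (w) => /= [|w0 w']; first by rewrite mul0r.
  rewrite phi_core // [wsum _ _]wz ?addr0 //= /f1 vc eqxx /=.
  apply/allP => _ /mapP[_ /mapP[n + ->] ->]; rewrite mem_filter => /andP[nc _] /=.
  by rewrite pnatr_eq0 eqb0; apply: contra nc => /eqP <-.
have w0 : 0 < head 0 w.
  have -> : head 0 w = wsum w (1 :: nseq n0.+1 0).
    by case: (w) => // e w'; rewrite -[RHS]/(e * 1 + wsum w' (nseq n0.+1 0)) wn0 addr0 mulr1.
  by apply: hw; [exact: mem_head | rewrite /= ltr01].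
have [abcd|/allPn[n nin nc]] := boolP (all (mem core_pts) [:: a; b; c; d]).
  have [a4 b4 c4 d4] : [/\ a \in core_pts, b \in core_pts, c \in core_pts & d \in core_pts].
    by move: abcd => /= /and5P[].
  have [| | | | | | |u [v [/andP[uc ul] /andP[vc vl] uv cr]]] :=
    S3 ((head 0 w)^-1 *: l) [pred v | (v \in core_pts) && (v \in contact V h l)] _ _ _
      a b c d _ _ _ _ u4.
  - move=> v vc; rewrite afZ ler_pdivrMl // -hcore //; exact/lV/cV.
  - move=> v /= /andP[vc vl]; split=> //.
    by rewrite afZ -hl // hcore // mulKf ?gt_eqF.
  - by move=> a' b' c' /= /andP[_ ?] /andP[_ ?] /andP[_ ?]; apply: areaN.
  - by rewrite /= a4.
  - by rewrite /= b4.
  - by rewrite /= c4.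
  - by rewrite /= d4.
  - by exists u, v.
have nl : n \in contact V h l.
  by move: nin; rewrite !inE => /or4P[] /eqP->.
have dh : wsum w (depI ((a, b), (c, d))) = 0.
  rewrite wsum_dep -(dep_af l a b c d) /dep /=.
  by rewrite -/(h a) -/(h b) -/(h c) -/(h d) !hl.
have qs : ((a, b), (c, d)) \in quads.
  apply/allpairsP; exists ((a, b), (c, d)); split=> //; apply/allpairsP.
    by exists (a, b); split=> //; apply: inV.
  by exists (c, d); split=> //; apply: inV.
have z0 : all (pred1 0) (depI ((a, b), (c, d))).
  case: (lex_trichotomy (depI ((a, b), (c, d)))) => // lp.
    suff : 0 < wsum w (depI ((a, b), (c, d))) by rewrite dh ltxx.
    apply: hw lp; rewrite inE !mem_cat; apply/or4P; constructor 3.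
    exact: map_f.
  suff : 0 < wsum w (map -%R (depI ((a, b), (c, d)))).
    rewrite -map_comp (eq_map (g := fun i => -1 * dep (hc i) a b c d)).
      by rewrite wsum_mapZ dh mulr0 ltxx.
    by move=> i; rewrite /= mulN1r.
  apply: hw lp; rewrite inE !mem_cat; apply/or4P; constructor 4.
  by apply/mapP; exists ((a, b), (c, d)).
(* The dependency of the indicator of [n] is, up to sign, the area of the other three points, which
   is not 0. *)
have : dep (hc (inr n)) a b c d == 0.
  apply: (allP z0); apply/mapP; exists (inr n) => //; rewrite !inE; apply: map_f.
  by rewrite mem_filter nc inV.
have {u4} [ab [ac [ad [bc [bd cd]]]]] :
    a != b /\ a != c /\ a != d /\ b != c /\ b != d /\ c != d.
  move: u4; rewrite /= !inE !negb_or.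
  by move=> /and4P[/and3P[-> -> ->] /andP[-> ->] -> _].
have sym (u v : 'rV[int]_2) : u != v -> (v == u) = false by rewrite eq_sym => /negbTE.
move: nin; rewrite /dep /= !inE => /or4P[] /eqP->;
  rewrite eqxx ?(negbTE ab) ?(negbTE ac) ?(negbTE ad) ?(negbTE bc) ?(negbTE bd)
    ?(negbTE cd) ?(sym _ _ ab) ?(sym _ _ ac) ?(sym _ _ ad) ?(sym _ _ bc) ?(sym _ _ bd)
    ?(sym _ _ cd) !mulr0 mulr1 ?subr0 ?addr0 ?sub0r ?add0r ?oppr_eq0 => e0; exfalso;
  move: e0; exact/negP/areaN.
Qed.

End Heights.

(** * The good decomposition *)

Lemma exists_small (R : realType) (s : seq (R * R)) :
  (forall u, u \in s -> 0 < u.1 \/ u.1 = 0 /\ 0 < u.2) ->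
  exists t, 0 < t < 1 /\ forall u, u \in s -> 0 < u.1 + t * u.2.
Proof.
move=> hs; have [e e0 he] := exists_eps s fst (fun u => - u.2).
pose t := Num.min e 2^-1; have t0 : 0 < t by rewrite lt_min e0 invr_gt0 ltr0n.
exists t; split.
  by rewrite t0 gt_min [X in _ || X]invf_lt1 ?ltr0n // ltr1n orbT.
move=> u us; case: (hs u us) => [u0|[-> u0]]; last by rewrite add0r mulr_gt0.
by have := he t t0 _ u us u0; rewrite mulrN opprK; apply; rewrite ge_min lexx.
Qed.

Section GoodDecomposition.
Variables (R : realType) (X : toric_model R) (K : cut_data X).
Hypothesis H : cut_model K.
Local Notation affine := ('rV[R]_2 * R^o)%type.
Local Notation emb := (emb R).
Local Notation area := (area R).
Local Notation apex := (cut_apex K).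
Local Notation q := (base_vtx K).
Local Notation dco := (dco K).
Local Notation dlev := (dlev K).
Local Notation core_pts := (core_pts K).
Local Notation deg := (int_edge_len K).
Implicit Types (x y : exc X) (v : 'rV[int]_2) (l : affine) (z : 'rV[R]_2).

Variables (V : seq 'rV[int]_2) (h : 'rV[int]_2 -> R).
Hypotheses (hV : hull (map emb V) = momentum_polygon X)
  (hC : forall v, momentum_polygon X (emb v) -> v \notin V ->
     v \notin core_pts /\ exists x, cut_triangle K x (emb v))
  (hS : forall x k, (k < deg x)%N -> exists2 l, minorant V h l &
      contact V h l =i std_corners K x k)
  (hU : forall v, v \in V -> used V h v)
  (hQ : forall l a b c d, minorant V h l -> a \in contact V h l -> b \in contact V h l ->
      c \in contact V h l -> d \in contact V h l -> uniq [:: a; b; c; d] ->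
      exists u v, [/\ u \in contact V h l, v \in contact V h l, u != v & crossed K u v]).
Local Notation minorant := (minorant V h).
Local Notation contact := (contact V h).
Local Notation cell := (cell V h).

Lemma cell_polygon l z : cell l z -> momentum_polygon X z.
Proof. by move=> /cell_hull; rewrite hV. Qed.

Lemma contact_cell l v : v \in contact l -> cell l (emb v).
Proof. by move=> vl; apply/hull_mem/map_f. Qed.

Lemma dlev_le1 x z : momentum_polygon X z -> af (dlev x) z <= 1.
Proof.
move=> /(@side_form_ge0 _ _ _ H (side x)); rewrite (lev_side H) (lev_dlev H).
rewrite pmulr_rge0 ?ltr0n ?(cc_gt0 H) // subr_ge0 => e.
have l1 := lev0_lt1 H x.
by rewrite -(ler_pM2l (x := 1 - lev0 x)) ?subr_gt0 //; lra.
Qed.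

(* Near z, the two-dimensional cell contains a point interior to a strip. *)
Lemma cut_interior_cell l x z : minorant l -> two_dim (cell l) -> cell l z ->
  0 < af (dco x false) z -> 0 < af (dco x true) z -> cell l `<=` cut_triangle K x.
Proof.
move=> lV l2 lz z0 z1; have d0 : 0 < (deg x)%:R :> R by rewrite ltr0n (deg_gt0 H).
set s := af (dlev x) z; have s0 : 0 < s by rewrite /s (dlevE K x false) addr_gt0.
have s1 : s <= 1 by apply: dlev_le1 (cell_polygon lz).
have [v vl vs] : exists2 v, v \in contact l & af (dlev x) (emb v) != s.
  apply: contrapT => nv; have : dlev x - afc s = 0.
    apply: two_dim_affine l2 _ => v vl; rewrite afB af_c; apply/eqP.
    by rewrite subr_eq0; apply/negPn/negP => vs; apply: nv; exists v.
  move=> /(congr1 (fun f => af f (emb (apex x)))).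
  by rewrite af0 afB af_c (dlevE K x false) !dco_apex addr0 add0r => /eqP; rewrite oppr_eq0 gt_eqF.
have v1 : af (dlev x) (emb v) <= 1 by apply/dlev_le1/cell_polygon/contact_cell/vl.
(* If [z] is on the line between two strips, the strip on the side of [v] is taken. *)
have [k kd [ka kb]] : exists2 k, (k < deg x)%N &
    (0 < s - k%:R / (deg x)%:R \/ s - k%:R / (deg x)%:R = 0 /\ 0 < af (dlev x) (emb v) - s) /\
    (0 < k.+1%:R / (deg x)%:R - s \/
       k.+1%:R / (deg x)%:R - s = 0 /\ 0 < s - af (dlev x) (emb v)).
  have [k kd /andP[k0 k1]] := grid_interval s0 s1 (deg_gt0 H x).
  move: k1; rewrite le_eqVlt => /orP[/eqP sk|k1]; last first.
    by exists k => //; split; left; rewrite subr_gt0.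
  case: (ltgtP (af (dlev x) (emb v)) s) vs => // vs _.
    by exists k => //; split; [left; rewrite subr_gt0 | right; rewrite sk subrr -sk subr_gt0].
  exists k.+1; last first.
    split; first by right; rewrite {1}sk subrr subr_gt0.
    by left; rewrite sk subr_gt0 ltr_pM2r ?invr_gt0 // ltr_nat.
  by rewrite -(ltr_nat R) -(ltr_pM2r (x := (deg x)%:R^-1)) ?invr_gt0 // -sk divff ?gt_eqF // (lt_le_trans vs).
pose t0 b := (af (dco x b) z, af (dco x b) (emb v) - af (dco x b) z).
have [u|t [/andP[tp t1] ht]] := @exists_small R
    [:: t0 false; t0 true; (s - k%:R / (deg x)%:R, af (dlev x) (emb v) - s);
      (k.+1%:R / (deg x)%:R - s, s - af (dlev x) (emb v))].
  by rewrite !inE => /or4P[] /eqP-> //=; left.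
pose w := t *: emb v + (1 - t) *: z.
have wl : cell l w by apply: hull_conv; rewrite ?(ltW tp) ?(ltW t1) //; apply: contact_cell.
have wd b : 0 < af (dco x b) w.
  have := ht (t0 b); rewrite !inE; case: b => /=; rewrite eqxx ?orbT => /(_ isT) /=;
    by rewrite af_conv; lra.
have wk : k%:R / (deg x)%:R < af (dlev x) w.
  have := ht (s - k%:R / (deg x)%:R, af (dlev x) (emb v) - s).
  by rewrite !inE eqxx ?orbT => /(_ isT) /=; rewrite af_conv -/s; lra.
have wk1 : af (dlev x) w < k.+1%:R / (deg x)%:R.
  have := ht (k.+1%:R / (deg x)%:R - s, s - af (dlev x) (emb v)).
  by rewrite !inE eqxx ?orbT => /(_ isT) /=; rewrite af_conv -/s; lra.
have [l' lV' lk] := hS kd.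
have cl' : cell l' = standard_cell K x k.
  by rewrite (standard_cellE H); apply: hull_eq; apply: eq_mem_map.
have wl' : cell l' w.
  by rewrite cl'; apply/(standard_cellP H) => //; split; rewrite ?ltW.
(* [l' - l] is nonnegative at the corners of the strip and vanishes at [w], a combination of them
   with positive weights; so it vanishes at the corners, and [l = l']. *)
have y0 v' : v' \in std_corners K x k -> 0 <= af (l' - l) (emb v').
  by rewrite -lk => /contactP[v'V e]; rewrite afB e subr_ge0 lV.
have yw : af (l' - l) w = 0 by rewrite afB (cell_val lV lV' wl wl') subrr.
have sw : 0 < af (dlev x) w by rewrite (dlevE K x false) addr_gt0 ?wd // (wd true).
move: yw; rewrite {1}(@strip_conv _ _ _ H x k w (lt0r_neq0 sw)).
set al := _ / _; set r := _ - k%:R.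
have r0 : 0 < r by rewrite subr_gt0 -ltr_pdivrMr.
have r1 : 0 < 1 - r by rewrite subr_gt0 ltrBlDr addrC natr1 -ltr_pdivlMr.
have al0 : 0 < al by rewrite divr_gt0.
have al1 : 0 < 1 - al.
  rewrite subr_gt0 ltr_pdivrMr // mul1r (dlevE K x false) ltrDl; exact: (wd true).
have c b j : j = k \/ j = k.+1 -> 0 <= af (l' - l) (emb (edge_pt K x b j)).
  by move=> jk; apply: y0; rewrite !inE; case: jk => ->; case: b; rewrite eqxx ?orbT.
rewrite !af_conv => /eqP; rewrite paddr_eq0; last 2 first.
- by rewrite mulr_ge0 ?(ltW al0) // addr_ge0 // mulr_ge0 ?(ltW r0) ?(ltW r1) // c; auto.
- by rewrite mulr_ge0 ?(ltW al1) // addr_ge0 // mulr_ge0 ?(ltW r0) ?(ltW r1) // c; auto.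
clearbody al r. rewrite !mulf_eq0 !(gt_eqF al0) !(gt_eqF al1) /=.
rewrite !paddr_eq0 ?mulr_ge0 ?(ltW r0) ?(ltW r1) // ?c; auto.
rewrite !mulf_eq0 (gt_eqF r0) (gt_eqF r1) /= => /andP[/andP[/eqP a1 /eqP a0] /andP[/eqP b1 /eqP b0]].
have ends b : af (l' - l) (emb (edge_pt K x b k)) = 0 ->
    af (l' - l) (emb (edge_pt K x b k.+1)) = 0 ->
    af (l' - l) (emb (apex x)) = 0 /\ af (l' - l) (emb (q x b)) = 0.
  rewrite !(af_edge_pt H) -natr1 => e0 e1.
  have e : af (l' - l) (emb (apex x)) = af (l' - l) (emb (q x b)).
    apply: (mulfI (lt0r_neq0 d0)); apply/eqP; rewrite -subr_eq0; apply/eqP.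
    rewrite -[RHS](mulr0 ((deg x)%:R ^+ 2)) -[in RHS](subrr 0) -{1}e0 -e1.
    by field; rewrite gt_eqF.
  by rewrite -e; split; rewrite -e0 -e; ring.
have [ea e0] := ends false a0 a1; have [_ e1] := ends true b0 b1.
have /eqP := af_indep (dtri_neq0 H x false) ea e0 e1.
rewrite subr_eq0 => /eqP<-; rewrite cl' (cut_triangle_cells H) => u us.
by exists (standard_cell K x k) => //; exists k.
Qed.

Section Triangle.
Variable l : affine.
Hypotheses (lV : minorant l) (l2 : two_dim (cell l))
  (lN : forall x, ~ (cell l `<=` cut_triangle K x)).

Lemma contact_conv u v t : u \in contact l -> v \in contact l -> 0 < t < 1 ->
  cell l (t *: emb u + (1 - t) *: emb v).
Proof.
by move=> ul vl /andP[/ltW t0 /ltW t1]; apply: hull_conv => //; apply: contact_cell.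
Qed.

(** A point of [V] is extreme in the cell. A lattice point outside [V] is in some Delta_x but not in
    the core, hence off the interior edges, where [cut_interior_cell] applies. *)
Lemma no_lattice_between u v t (z : 'rV[int]_2) : u \in contact l -> v \in contact l ->
  u != v -> 0 < t < 1 -> emb z = t *: emb u + (1 - t) *: emb v -> False.
Proof.
move=> ul vl uv t01 ez; have lz := contact_conv ul vl t01; rewrite -ez in lz.
have [zV|zV] := boolP (z \in V).
  case/andP: t01 => t0 t1; case: (used_extreme (hU zV) lV ul vl (ltW t0) (ltW t1) ez) => zE.
    have /eqP := ez; rewrite zE -subr_eq0 opprD addrA -{1}[emb u]scale1r -scalerBl -scalerBr.
    by rewrite scaler_eq0 !subr_eq0 (gt_eqF t1) => /eqP/emb_inj/eqP; rewrite (negbTE uv).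
  have /eqP := ez; rewrite zE addrC -subr_eq0 opprD addrA -{1}[emb v]scale1r -scalerBl.
  rewrite opprB addrCA subrr addr0 -scalerBr.
  by rewrite scaler_eq0 subr_eq0 (gt_eqF t0) => /eqP/emb_inj/eqP; rewrite eq_sym (negbTE uv).
have [zc [x zx]] := hC (cell_polygon lz) zV.
have /(cut_triangleP H)[z0 z1 zl] := zx.
have ge b : 0 <= af (dco x b) (emb z) by case: b.
have pos b : 0 < af (dco x b) (emb z).
  rewrite lt_def ge andbT; apply: contra zc => /eqP zb0.
  have zb1 : 0 <= af (dco x (~~ b)) (emb z) <= 1.
    by rewrite ge (le_trans _ zl) // (dlevE K x (~~ b)) lerDl ge.
  have := edge_pt_lattice H zb1; rewrite negbK => /(_ zb0) [n nd ->].
  by apply/core_ptsP; right; exists x; apply/coreP; exists (~~ b), n.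
by apply: (lN (cut_interior_cell lV l2 lz (pos false) (pos true))).
Qed.

Lemma not_crossed u v : u \in contact l -> v \in contact l -> u != v -> ~ crossed K u v.
Proof.
move=> ul vl uv [t t01 [[z]|[x [m0 m1 _]]]]; first exact: no_lattice_between.
exact: (lN (cut_interior_cell lV l2 (contact_conv ul vl t01) m0 m1)).
Qed.

Lemma contact_third a b : exists c, [/\ c \in contact l, c != a & c != b].
Proof.
(* For [a = b] any nonzero direction serves: a two-dimensional cell cannot have all contact points
   on the line through [a] along [w]. *)
pose w : 'rV[R]_2 := if a == b then const_mx 1 else emb b - emb a.
have w0 : w != 0.
  rewrite /w; have [_|ab] := boolP (a == b); last first.
    by rewrite subr_eq0 eq_sym; apply: contra ab => /eqP/emb_inj->.
  apply/eqP => /(congr1 (fun u : 'rV[R]_2 => u 0 0)).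
  by rewrite !mxE => /eqP; rewrite oner_eq0.
apply: contrapT => nc; have : cross_form (emb a) w = 0.
  apply: two_dim_affine l2 _ => c cl; rewrite cross_formE.
  have [->|ca] := eqVneq c a; first by rewrite subrr /cross !mxE !mulr0 subrr.
  have [cb|cb] := eqVneq c b; last by case: nc; exists c.
  move: ca; rewrite /w cb eq_sym => /negbTE->; exact: crossvv.
pose o : 'rV[R]_2 := \row_j (if j == 0 then - w 0 1 else w 0 0).
move=> /(congr1 (fun f => af f (emb a + o))) /eqP.
rewrite af0 cross_formE addrC addKr /cross !mxE /= mulrN opprK -!expr2.
rewrite paddr_eq0 ?sqr_ge0 // !sqrf_eq0 => /andP[/eqP e0 /eqP e1].
by case/eqP: w0; apply: row2P; rewrite [RHS]mxE.
Qed.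

Lemma llen_contact u v : u \in contact l -> v \in contact l -> u != v -> llen (v - u) = 1%N.
Proof.
move=> ul vl uv; have n0 : (0 < llen (v - u))%N.
  rewrite gcdn_gt0 !absz_gt0 -negb_and; apply: contra uv => /andP[/eqP e0 /eqP e1].
  by rewrite eq_sym -subr_eq0; apply/eqP/row2P; rewrite [RHS]mxE.
apply/eqP; rewrite eqn_leq n0 andbT leqNgt; apply/negP => n1.
have := edge_scale n0; set n := llen _ in n0 n1 *; set w := map_mx _ _ => ew.
have nR : n%:R != 0 :> R by rewrite pnatr_eq0 -lt0n.
(* [u + w] is the first lattice point after [u], as [w] is the primitive vector of the segment and
   [n] its lattice length. *)
apply: (@no_lattice_between u v (1 - n%:R^-1) (u + w)) => //.
  by rewrite subr_gt0 invf_lt1 ?ltr0n // ltr1n n1 gtrDl oppr_lt0 invr_gt0 ltr0n.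
have -> : emb v = emb u + n%:R *: emb w by rewrite -embMn -embD -ew addrC subrK.
by rewrite embD; move: (emb u) (emb w) => f g; apply: row2P; rewrite !mxE; field.
Qed.

(** A fourth contact point would give a crossed pair by [hQ], against [not_crossed]. *)
Lemma size1_cell : size1_triangle (cell l).
Proof.
have [a [al _ _]] := contact_third 0 0.
have [b [bl ba _]] := contact_third a a.
have [c [cl ca cb]] := contact_third a b.
exists a, b, c; split.
- have := used_area hU lV al bl cl; rewrite areaE -!embB cross_emb intr_eq0; apply; by rewrite eq_sym.
- by split; apply: llen_contact => //; rewrite // eq_sym.
apply: hull_eq; apply: eq_mem_map => d; apply/idP/idP; last first.
  by rewrite !inE => /or3P[] /eqP->.
move=> dl; apply/negPn/negP; rewrite !inE !negb_or => /and3P[da db dc].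
have [|u [v [ul vl uv]]] := hQ lV al bl cl dl; last exact: not_crossed.
by rewrite /= !inE !negb_or !(eq_sym a) ba ca da !(eq_sym b) cb db eq_sym dc.
Qed.

End Triangle.

Lemma cells_good : good_decomposition K (cells V h).
Proof.
split.
- by rewrite -hV; apply: cells_decomposition.
- by rewrite -hV; apply: cells_regular.
- move=> x; split; last exact: cut_triangle_cells.
  move=> _ [k kd <-]; have [l lV lk] := hS kd; exists l; split=> //.
    by apply/negP => /eqP e; have := lk (edge_pt K x false k); rewrite e !inE eqxx.
  by rewrite (standard_cellE H); apply: hull_eq; apply: eq_mem_map => v; rewrite lk.
- by move=> S [l [lV _ ->]] l2 lN; apply: size1_cell.
Qed.

End GoodDecomposition.

Theorem theorem2p16 (R : realType) (X : toric_model R) (K : cut_data X) :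
  good_toric_model X -> polarized X -> generic X -> symington_cut K ->
  exists Pc : set (set 'rV[R]_2), good_decomposition K Pc.
Proof.
move=> hg hp _ hc; have H : cut_model K by [].
have [V [h [hV hC hS hU hQ]]] := polygon_heights H.
by exists (cells V h); apply: cells_good.
Qed.
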